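(* Let $\lambda,\mu\in C^1([-1,1])$ be positive with $\lambda(w)=\mu(-w)$ for all $w\in[-1,1]$, and $b,c\in C([-1,1])$. Consider $$u_t(w,t)+\lambda(w)u_w(w,t)=b(w)v(w,t),\qquad v_t(w,t)-\mu(w)v_w(w,t)=c(w)u(w,t),\qquad w\in[-1,1],\ t\ge0,$$ $$u(-1,t)=U_1(t),\qquad v(1,t)=U_2(t),$$ with initial data $(u_0,v_0)\in L^2([-1,1])^2$, under the feedback laws $$U_1(t)=-\int_{-1}^1 u(z,t)L^{11}(z,-1)\,dz-\int_{-1}^1 v(z,t)L^{12}(z,-1)\,dz,\qquad U_2(t)=\int_{-1}^1 u(z,t)L^{21}(z,1)\,dz+\int_{-1}^1 v(z,t)L^{22}(z,1)\,dz,$$ where $L^{11},L^{12},L^{21},L^{22}\in C(E)$ are the unique solutions of the kernel equations below. Then the closed-loop state $(u,v)$ reaches the zero equilibrium in finite time.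
   Context: $E=\{(z,w)\in[-1,1]^2:|z|\le|w|\}$. The kernels satisfy on $E$: $\lambda(w)L^{11}_w+\lambda(z)L^{11}_z=-\lambda'(z)L^{11}-c(z)L^{12}$, $\lambda(w)L^{12}_w-\mu(z)L^{12}_z=-b(z)L^{11}+\mu'(z)L^{12}$, $L^{11}(-w,w)=0$, $L^{12}(w,w)=b(w)/(\lambda(w)+\mu(w))$; and $\mu(w)L^{22}_w+\mu(z)L^{22}_z=b(z)L^{21}-\mu'(z)L^{22}$, $\mu(w)L^{21}_w-\lambda(z)L^{21}_z=\lambda'(z)L^{21}+c(z)L^{22}$, $L^{22}(-w,w)=0$, $L^{21}(w,w)=-c(w)/(\lambda(w)+\mu(w))$ (all functions evaluated at $(z,w)$). These kernels define the Volterra-type transformation $\alpha(w,t)=u(w,t)-\int_{-w}^{w}[u(z,t)L^{11}(z,w)+v(z,t)L^{12}(z,w)]dz$, $\beta(w,t)=v(w,t)-\int_{-w}^{w}[u(z,t)L^{21}(z,w)+v(z,t)L^{22}(z,w)]dz$, mapping the closed loop to $\alpha_t+\lambda\alpha_w=0$, $\beta_t-\mu\beta_w=0$, $\alpha(-1,t)=\beta(1,t)=0$. *)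

(* Defs.v *)
From HB Require Import structures.
From mathcomp Require Import all_boot all_order all_algebra.
From mathcomp Require Import all_classical all_reals all_analysis.
Set Implicit Arguments. Unset Strict Implicit. Unset Printing Implicit Defensive.
Import Order.TTheory GRing.Theory Num.Theory.
Import numFieldNormedType.Exports.
Local Open Scope classical_set_scope.
Local Open Scope ring_scope.

Section Defs.
Context {R : realType}.

Notation leb := (@lebesgue_measure R).

Definition I11 : set R := [set x : R | -1 <= x <= 1].

Definition I0T (T : R) : set R := [set t : R | 0 <= t <= T].

Definition Eset : set (R * R) := [set p | -1 <= p.2 <= 1 /\ `|p.1| <= `|p.2|].

(* f is C^1 on [-1,1] with derivative df (one-sided at the endpoints) *)
Definition C1_on_I (f df : R -> R) : Prop :=
  {within I11, continuous df} /\
  forall x, -1 <= x <= 1 ->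
    (fun h : R => h^-1 * (f (x + h) - f x))
      @ within [set h : R | h != 0 /\ -1 <= x + h <= 1] (nbhs (0 : R)) --> df x.

Definition C1_2 (phi phi1 phi2 : R -> R -> R) : Prop :=
  (forall x y, is_derive x (1 : R) (fun s => phi s y) (phi1 x y)) /\
  (forall x y, is_derive y (1 : R) (fun s => phi x s) (phi2 x y)) /\
  continuous (fun p : R * R => phi p.1 p.2) /\
  continuous (fun p : R * R => phi1 p.1 p.2) /\
  continuous (fun p : R * R => phi2 p.1 p.2).

Definition int2 (f : R -> R -> R) : R :=
  Rintegral leb I11 (fun w => Rintegral leb I11 (fun z => f z w)).

(* Weak (distributional) form, in the interior of E, of the first-order
   equation   a(w) L_w + bz(z) L_z = F(z,w),
   where a' and bz' are the derivatives of a and bz.  Test functions are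
   C^1 with compact support in int E = {|z| < |w| < 1}. *)
Definition weak_transport (a a' bz bz' : R -> R) (L F : R -> R -> R) : Prop :=
  forall phi phiz phiw : R -> R -> R,
    C1_2 phi phiz phiw ->
    (exists d : R, 0 < d /\ forall z w, phi z w != 0 ->
        `|z| + d <= `|w| /\ `|w| <= 1 - d) ->
    - int2 (fun z w => L z w * (a' w * phi z w + a w * phiw z w
                                + bz' z * phi z w + bz z * phiz z w))
    = int2 (fun z w => F z w * phi z w).

Definition kernel_eqs (lam lam' mu mu' b c : R -> R)
    (L11 L12 L21 L22 : R -> R -> R) : Prop :=
  {within Eset, continuous (fun p => L11 p.1 p.2)} /\
  {within Eset, continuous (fun p => L12 p.1 p.2)} /\
  {within Eset, continuous (fun p => L21 p.1 p.2)} /\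
  {within Eset, continuous (fun p => L22 p.1 p.2)} /\
  weak_transport lam lam' lam lam' L11
    (fun z w => - lam' z * L11 z w - c z * L12 z w) /\
  weak_transport lam lam' (fun z => - mu z) (fun z => - mu' z) L12
    (fun z w => - b z * L11 z w + mu' z * L12 z w) /\
  weak_transport mu mu' mu mu' L22
    (fun z w => b z * L21 z w - mu' z * L22 z w) /\
  weak_transport mu mu' (fun z => - lam z) (fun z => - lam' z) L21
    (fun z w => lam' z * L21 z w + c z * L22 z w) /\
  (forall w, -1 <= w <= 1 -> L11 (- w) w = 0) /\
  (forall w, -1 <= w <= 1 -> L12 w w = b w / (lam w + mu w)) /\
  (forall w, -1 <= w <= 1 -> L22 (- w) w = 0) /\
  (forall w, -1 <= w <= 1 -> L21 w w = - c w / (lam w + mu w)).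

Definition L2_I (f : R -> R) : Prop :=
  measurable_fun I11 f /\ leb.-integrable I11 (fun w => (f w ^+ 2)%:E).

Definition state_norm2 (u v : R -> R -> R) (t : R) : R :=
  Rintegral leb I11 (fun w => u w t ^+ 2 + v w t ^+ 2).

Definition U1_fb (L11 L12 u v : R -> R -> R) (t : R) : R :=
  - Rintegral leb I11 (fun z => u z t * L11 z (-1))
  - Rintegral leb I11 (fun z => v z t * L12 z (-1)).
Definition U2_fb (L21 L22 u v : R -> R -> R) (t : R) : R :=
  Rintegral leb I11 (fun z => u z t * L21 z 1)
  + Rintegral leb I11 (fun z => v z t * L22 z 1).

(* (u,v), written u(w,t), v(w,t), is a weak solution in C([0,oo); L^2(-1,1)^2)
   of the closed loop
     u_t + lam u_w = b v,  v_t - mu v_w = c u,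
     u(-1,t) = U1(t),  v(1,t) = U2(t)   (U1, U2 the feedback laws),
   with initial data (u(.,0), v(.,0)). *)
Definition closed_loop_sol (lam lam' mu mu' b c : R -> R)
    (L11 L12 L21 L22 : R -> R -> R) (u v : R -> R -> R) : Prop :=
  (forall t, 0 <= t -> L2_I (fun w => u w t) /\ L2_I (fun w => v w t)) /\
  (forall t0, 0 <= t0 ->
     (fun t => Rintegral leb I11
        (fun w => (u w t - u w t0) ^+ 2 + (v w t - v w t0) ^+ 2))
       @ within [set t : R | 0 <= t] (nbhs t0) --> (0 : R)) /\
  (forall (phi phiw phit : R -> R -> R) (T : R),
     C1_2 phi phiw phit ->
     (forall t, phi 1 t = 0) ->
     (forall w t, T <= t -> phi w t = 0) ->
     Rintegral leb I11 (fun w => u w 0 * phi w 0)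
     + Rintegral leb (I0T T) (fun t => Rintegral leb I11 (fun w =>
          u w t * (phit w t + lam' w * phi w t + lam w * phiw w t)
          + b w * v w t * phi w t))
     + lam (-1) * Rintegral leb (I0T T)
                    (fun t => phi (-1) t * U1_fb L11 L12 u v t) = 0) /\
  (forall (psi psiw psit : R -> R -> R) (T : R),
     C1_2 psi psiw psit ->
     (forall t, psi (-1) t = 0) ->
     (forall w t, T <= t -> psi w t = 0) ->
     Rintegral leb I11 (fun w => v w 0 * psi w 0)
     + Rintegral leb (I0T T) (fun t => Rintegral leb I11 (fun w =>
          v w t * (psit w t - mu' w * psi w t - mu w * psiw w t)
          + c w * u w t * psi w t))
     + mu 1 * Rintegral leb (I0T T)
                    (fun t => psi 1 t * U2_fb L21 L22 u v t) = 0).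

End Defs.

(* Main.v *)
(* Backstepping. Folded along w -> -w, the adjoint of the Volterra transform
   sends a C^1 function chi with chi(1) = 0 to the pair (chi - k1 chi, - k2 chi),
   k_i chi z = int_|z|^1 (L_i z w chi w - L_i z (-w) chi (-w)) dw. The kernels are
   merely continuous, yet lam k1 chi and mu k2 chi are C^1: testing the weak kernel
   equations on products r(z) s(w) and using the du Bois-Reymond lemma, first in w
   and then in z, gives the flux of each equation through the rectangles
   [x, y] x [c, 1], hence its trace on |z| = w. So (chi - k1 chi, - k2 chi) is an
   admissible test pair for the closed loop, and the moments
   A(t)[chi] = int alpha(w, t) chi(w) dw satisfy dA[chi]/dt = A[(lam chi)'].
   With tau(w) = int_(-1)^w 1 / lam and chi_a = max(0, a - tau)^2 / lam this makes
   A(r)[chi_(a + r - t)] constant in r; it is 0 at r = 0 when t >= tau(1) >= a. Second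
   differences in a turn this into alpha(., t) = 0 a.e. Exchanging u and v and
   reflecting w, the same argument gives beta(., t) = 0. Finally, alpha = beta = 0
   is a homogeneous Volterra equation for (u, v), which forces u = v = 0. *)

(* The target equation cannot be found by differentiating the transform: [u] and [v] are weak
   solutions and the kernels have derivatives only as distributions. Duality puts every derivative
   on a test function, and all that is then needed of a kernel is what its flux leaves on the lines
   [|z| = |w|]. The boundary values of the kernels, with the symmetry of [lam] and [mu], make these
   traces equal to 0 for the first kernel and to [b * chi] for the second. One trace is left over,
   at [w = -1]; it is exactly what the feedback [U1] compensates. The other feedback does not enter
   the equation of alpha, because [k2 chi] vanishes at both ends. Coefficients known on [-1,1] and
   kernels known on E are first extended continuously to the line and the plane, so that all
   calculus is about functions continuous everywhere. The square in [chi_a] is the lowest integer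
   power of a positive part that is C^1; this is why two differences in [a] are needed to come back
   to an indicator. The Volterra equation integrates over [|z| <= |w|], so uniqueness spreads from
   the centre [w = 0] outwards and not from one end of the interval. *)
Require Import Defs.
From HB Require Import structures.
From mathcomp Require Import all_boot all_order all_algebra.
From mathcomp Require Import all_classical all_reals all_analysis.
From mathcomp Require Import measurable_realfun ring lra.
Import Order.TTheory GRing.Theory Num.Theory.
Import numFieldNormedType.Exports.
Local Open Scope classical_set_scope.
Local Open Scope ring_scope.
Set Implicit Arguments. Unset Strict Implicit. Unset Printing Implicit Defensive.

(** * Epsilon forms of continuity and derivative; calculus in one variable *)

Section Calculus.
Context {R : realType}.
Implicit Types (f g F G : R -> R) (a b x y : R).
Notation leb := (@lebesgue_measure R).

Lemma continuous_epsP f x : {for x, continuous f} <->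
  forall e : R, 0 < e -> exists2 d : R, 0 < d & forall y, `|y - x| < d -> `|f y - f x| <= e.
Proof.
split=> [cf e e0|H].
  move/cvgrPdist_le : cf => /(_ _ e0) /nbhs_ballP[d /= d0 dP].
  exists d => // y yd; rewrite distrC; apply: dP.
  by rewrite /ball /= distrC.
apply/cvgrPdist_le => e e0; have [d d0 dP] := H _ e0.
apply/nbhs_ballP; exists d => //= y; rewrite /ball /= => yd.
by rewrite distrC dP// distrC.
Qed.

Lemma continuous2_epsP (f : R -> R -> R) x y :
  {for (x, y), continuous (fun p : R * R => f p.1 p.2)} <->
  forall e : R, 0 < e -> exists2 d : R, 0 < d &
    forall x' y', `|x' - x| < d -> `|y' - y| < d -> `|f x' y' - f x y| <= e.
Proof.
split=> [cf e e0|H].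
  move/cvgrPdist_le : cf => /(_ _ e0) /nbhs_ballP[d /= d0 dP].
  exists d => // x' y' xd yd; rewrite distrC; apply: (dP (x', y')).
  by split; rewrite /ball /= distrC.
apply/cvgrPdist_le => e e0; have [d d0 dP] := H _ e0.
exists (ball x d, ball y d) => /=; first by split; exact: nbhsx_ballx.
move=> [x' y'] [/=]; rewrite /ball /= => xd yd.
by rewrite distrC dP// distrC.
Qed.

(** Without a quotient, [y = x] need not be excluded and the errors of several terms simply add
    up. *)
Lemma is_derive_epsP f x a : is_derive x (1 : R) f a <->
  forall e : R, 0 < e -> exists2 d : R, 0 < d &
    forall y, `|y - x| < d -> `|f y - f x - (y - x) * a| <= e * `|y - x|.
Proof.
split=> [[df fa] e e0|H].
  have : (fun h => h^-1 *: ((f \o shift x) (h *: 1) - f x)) @ 0^' --> a.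
    by rewrite -fa.
  move/cvgrPdist_le => /(_ _ e0) /nbhs_ballP[d /= d0 dP].
  exists d => // y yd; have [->|yx] := eqVneq y x.
    by rewrite !subrr mul0r subrr normr0 mulr0.
  have := dP (y - x); rewrite /ball /= sub0r normrN => /(_ yd).
  rewrite subr_eq0 => /(_ yx); rewrite /GRing.scale /= mulr1 subrK => E.
  have yx0 : y - x != 0 by rewrite subr_eq0.
  have -> : f y - f x - (y - x) * a = - ((a - (y - x)^-1 * (f y - f x)) * (y - x)).
    by field.
  by rewrite normrN normrM ler_wpM2r.
have cv : (fun h => h^-1 *: ((f \o shift x) (h *: 1) - f x)) @ 0^' --> a.
  apply/cvgrPdist_le => e e0; have [d d0 dP] := H _ e0.
  apply/nbhs_ballP; exists d => //= h; rewrite /ball /= sub0r normrN => hd h0.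
  have := dP (h + x); rewrite addrK => /(_ hd).
  rewrite /GRing.scale /= mulr1 => E.
  have -> : a - h^-1 * (f (h + x) - f x) = - ((f (h + x) - f x - h * a) / h) by field.
  by rewrite normrN normrM normfV ler_pdivrMr ?normr_gt0.
split; first by apply/cvg_ex; exists a.
exact/cvg_lim.
Qed.

(* A plain definition, so that rewriting never triggers the instance search
   attached to [is_derive]. *)
Definition has_deriv f f' : Prop := forall x, is_derive x (1 : R) f (f' x).

Lemma is_derive_continuous f f' : has_deriv f f' -> continuous f.
Proof.
move=> df x; apply: differentiable_continuous; apply/derivable1_diffP.
exact: ex_derive.
Qed.

Lemma is_derive_unique f x a b :
  is_derive x (1 : R) f a -> is_derive x (1 : R) f b -> a = b.
Proof. by move=> [_ <-] [_ <-]. Qed.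

Lemma between_dist x y z : Num.min x y <= z <= Num.max x y -> `|z - x| <= `|y - x|.
Proof.
have [xy|/ltW yx] := leP x y => /andP[? ?].
  by rewrite !ger0_norm ?subr_ge0//; lra.
by rewrite !ler0_norm ?subr_le0//; lra.
Qed.

Definition clamp a b x : R := Num.max a (Num.min x b).

Lemma clamp_ge a b x : a <= clamp a b x.
Proof. by rewrite /clamp le_max lexx. Qed.

Lemma clamp_le a b x : a <= b -> clamp a b x <= b.
Proof. by move=> ab; rewrite /clamp ge_max ab ge_min lexx orbT. Qed.

Lemma clamp_id a b x : a <= x <= b -> clamp a b x = x.
Proof. by move=> /andP[ax xb]; rewrite /clamp min_l// max_r. Qed.

Lemma clamp_dist a b x y : `|clamp a b y - clamp a b x| <= `|y - x|.
Proof.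
rewrite /clamp !maxEle !minEle.
by repeat case: ifPn => //; rewrite -?ltNge => *; rewrite !ler_norml;
  have [?|?] := leP 0 (y - x); (rewrite ger0_norm//; lra) || (rewrite ltr0_norm//; lra).
Qed.

Lemma continuous_clamp a b : continuous (clamp a b).
Proof.
move=> x; apply/continuous_epsP => e e0; exists e => // y yd.
exact: le_trans (clamp_dist _ _ _ _) (ltW yd).
Qed.

(** [clamp] is 1-Lipschitz, so composing with it turns the one-sided hypothesis at the endpoints
    into a zero derivative on the whole line. *)
Lemma cst_on_itv f a b : a <= b ->
  (forall x (e : R), a <= x <= b -> 0 < e -> exists2 d : R, 0 < d &
    forall y, a <= y <= b -> `|y - x| < d -> `|f y - f x| <= e * `|y - x|) ->
  forall x, a <= x <= b -> f x = f a.
Proof.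
move=> ab H x xab.
have cab z : a <= clamp a b z <= b by rewrite clamp_ge clamp_le.
have : (f \o clamp a b) x = (f \o clamp a b) a.
  apply: is_derive_0_is_cst => z; apply/is_derive_epsP => e e0.
  have [d d0 dP] := H _ _ (cab z) e0.
  exists d => // y yd; rewrite mulr0 subr0.
  have cd := clamp_dist a b z y.
  apply: le_trans (dP _ (cab y) (le_lt_trans cd yd)) _.
  by rewrite ler_wpM2l// ltW.
by rewrite /= !clamp_id// lexx.
Qed.

(** * Primitives of continuous functions *)

Lemma continuous_integrable f a b : continuous f ->
  leb.-integrable `[a, b] (EFin \o f).
Proof.
move=> cf; apply: continuous_compact_integrable; first exact: segment_compact.
exact: continuous_subspaceT.
Qed.

Definition prim f x : R :=
  if 0 <= x then \int[leb]_(t in `[0, x]) f t else - \int[leb]_(t in `[x, 0]) f t.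

Lemma prim0 f : prim f 0 = 0.
Proof. by rewrite /prim lexx set_itv1 Rintegral_set1. Qed.

Lemma Rintegral_chasles f a b c : continuous f -> a <= b -> b <= c ->
  \int[leb]_(t in `[a, c]) f t =
  \int[leb]_(t in `[a, b]) f t + \int[leb]_(t in `[b, c]) f t.
Proof.
move=> cf ab bc.
have /(Rintegral_itvB (x := b)) := continuous_integrable a c cf.
rewrite !bnd_simp => /(_ ab bc) E.
rewrite -(@Rintegral_itv_obnd_cbnd _ b); first by rewrite -E addrC subrK.
apply: integrableS (continuous_integrable b c cf) => //.
exact: subset_itv_oc_cc.
Qed.

Lemma prim_split f n x : continuous f -> n <= 0 -> n <= x ->
  prim f x = \int[leb]_(t in `[n, x]) f t - \int[leb]_(t in `[n, 0]) f t.
Proof.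
move=> cf n0 nx; rewrite /prim; case: ifPn => [x0|].
  by rewrite (Rintegral_chasles cf n0 x0) addrC addKr.
by rewrite -ltNge => /ltW x0; rewrite (Rintegral_chasles cf nx x0) opprD addNKr.
Qed.

Lemma is_derive_prim f : continuous f -> has_deriv (prim f) f.
Proof.
(* Since [n] is strictly below both 0 and [x], near [x] the primitive is an integral from the fixed
   point [n] minus a constant, and [x] is interior to the interval of integration. *)
move=> cf x; pose n := Num.min 0 x - 1.
have [n0 nx] : n < 0 /\ n < x.
  by rewrite /n; split; rewrite minEle; case: ifPn; rewrite -?ltNge; lra.
pose h y := \int[leb]_(t in `[n, y]) f t - \int[leb]_(t in `[n, 0]) f t.
apply: (@near_eq_is_derive _ _ _ h).
  have : \forall y \near x, n < y by apply: lt_nbhsr.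
  by apply: filterS => y ny; rewrite /h -(prim_split cf (ltW n0) (ltW ny)).
have x1 : x < x + 1 by rewrite ltrDl.
have [dF <-] := continuous_FTC1_closed x1 (continuous_integrable n (x + 1) cf) nx (cf x).
rewrite derive1E /h -[X in is_derive _ _ _ X]subr0.
apply: is_deriveB; first exact: derivableP.
Qed.

(** As a difference of values of one global primitive, this oriented integral is additive and
    antisymmetric for bounds in any order; [RintegralE] ties it to the Lebesgue integral for ordered
    bounds. *)
Definition oint f a b : R := prim f b - prim f a.

Lemma RintegralE f a b : continuous f -> a <= b ->
  \int[leb]_(t in `[a, b]) f t = oint f a b.
Proof.
move=> cf ab; pose n := Num.min 0 a.
have [n0 na] : n <= 0 /\ n <= a.
  by rewrite /n; split; rewrite ge_min lexx ?orbT.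
rewrite /oint !(prim_split (n := n) cf)// ?(le_trans na ab)//.
by rewrite (Rintegral_chasles cf na ab); lra.
Qed.

Lemma oint_derive F f a b : continuous f ->
  has_deriv F f -> oint f a b = F b - F a.
Proof.
move=> cf dF; have := @is_derive_0_is_cst R (prim f \- F) b a.
have d0 x : is_derive x (1 : R) (prim f \- F) 0.
  rewrite -(subrr (f x)); by apply: is_deriveB; [exact: is_derive_prim|exact: dF].
by move=> /(_ d0) /=; rewrite /oint; lra.
Qed.

Lemma ointxx f a : oint f a a = 0. Proof. exact: subrr. Qed.

Lemma ointC f a b : oint f a b = - oint f b a.
Proof. by rewrite /oint opprB. Qed.

Lemma oint_cat f a b c : oint f a c = oint f a b + oint f b c.
Proof. by rewrite /oint; lra. Qed.

Lemma ointD f g a b : continuous f -> continuous g ->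
  oint (fun x => f x + g x) a b = oint f a b + oint g a b.
Proof.
move=> cf cg; rewrite (@oint_derive (prim f \+ prim g)).
- by rewrite /oint /=; lra.
- by move=> x; apply: continuousD; [exact: cf|exact: cg].
- by move=> x; apply: is_deriveD; exact: is_derive_prim.
Qed.

Lemma ointZ f k a b : continuous f ->
  oint (fun x => k * f x) a b = k * oint f a b.
Proof.
move=> cf; rewrite (@oint_derive (k \*: prim f)).
- by rewrite /oint /= /GRing.scale /=; lra.
- by move=> x; apply: continuousM; [exact: cst_continuous|exact: cf].
- by move=> x; apply: is_deriveZ; exact: is_derive_prim.
Qed.

Lemma ointN f a b : continuous f -> oint (fun x => - f x) a b = - oint f a b.
Proof.
move=> cf; rewrite -mulN1r -ointZ//; congr (oint _ a b).
by apply/funext => x; rewrite mulN1r.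
Qed.

Lemma ointB f g a b : continuous f -> continuous g ->
  oint (fun x => f x - g x) a b = oint f a b - oint g a b.
Proof.
move=> cf cg; rewrite ointD// ?ointN// => x; apply: continuousN; exact: cg.
Qed.

Lemma eq_oint f g a b : continuous f -> continuous g -> a <= b ->
  (forall x, a <= x <= b -> f x = g x) -> oint f a b = oint g a b.
Proof.
move=> cf cg ab fg; rewrite -!RintegralE//; apply: eq_Rintegral => x.
by rewrite inE /= in_itv /=; exact: fg.
Qed.

Lemma oint_opp f a b : continuous f ->
  oint (fun x => f (- x)) a b = oint f (- b) (- a).
Proof.
move=> cf; rewrite (@oint_derive (fun x => - prim f (- x))).
- by rewrite /oint; lra.
- by move=> x; apply: (continuous_comp (g := f)); [exact: opp_continuous|exact: cf].
move=> x; have -> : f (- x) = - (f (- x) * -1) by lra.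
apply: (@is_deriveN _ _ _ (prim f \o -%R)).
by apply: is_derive1_comp; exact: is_derive_prim.
Qed.

Lemma oint_bound f a b B : continuous f -> a <= b ->
  (forall x, a <= x <= b -> `|f x| <= B) -> `|oint f a b| <= B * (b - a).
Proof.
move=> cf ab fB; rewrite -RintegralE//.
have cn : continuous (fun x => `|f x|).
  by move=> x; apply: continuous_comp; [exact: cf|exact: norm_continuous].
apply: le_trans (le_normr_Rintegral _ (continuous_integrable a b cf)) _ => //.
have cB : continuous (fun _ : R => B) by move=> x; exact: cvg_cst.
have {}fB x : `[a, b]%classic x -> `|f x| <= B by rewrite /= in_itv /=; exact: fB.
apply: le_trans (@le_Rintegral _ _ R leb `[a, b] _ _ (measurable_itv _)
  (continuous_integrable a b cn) (continuous_integrable a b cB) fB) _.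
rewrite RintegralE//.
rewrite (@oint_derive (fun x => B * x)); first by rewrite mulrBr.
  by [].
move=> x; rewrite -[X in is_derive _ _ _ X]mulr1.
exact: (@is_deriveZ _ _ _ id).
Qed.

Lemma oint_bound_abs f a b B : continuous f ->
  (forall x, Num.min a b <= x <= Num.max a b -> `|f x| <= B) ->
  `|oint f a b| <= B * `|b - a|.
Proof.
move=> cf fB; have [ab|/ltW ba] := leP a b.
  rewrite (@ger0_norm _ (b - a)) ?subr_ge0//; apply: oint_bound => // x xab.
  by apply: fB; rewrite min_l// max_r.
rewrite ointC normrN (distrC b) (@ger0_norm _ (a - b)) ?subr_ge0//; apply: oint_bound => // x xab.
by apply: fB; rewrite min_r// max_l.
Qed.

(** The increments of [prim f] are nonnegative and sum to zero, so [prim f] is constant on the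
    interval and its derivative [f] is zero wherever a neighbourhood is available. *)
Lemma oint_eq0 f a b : continuous f -> a <= b ->
  (forall x, a <= x <= b -> 0 <= f x) -> oint f a b = 0 ->
  forall x, a < x < b -> f x = 0.
Proof.
move=> cf ab f0 I0 x /andP[ax xb].
have oint_ge0 c d : a <= c -> c <= d -> d <= b -> 0 <= oint f c d.
  move=> ac cd db; rewrite -RintegralE//; apply: Rintegral_ge0 => y /=.
  rewrite in_itv /= => /andP[cy yd]; apply: f0.
  by rewrite (le_trans ac cy) (le_trans yd db).
apply: (@is_derive_unique (prim f) x); first exact: is_derive_prim.
apply: (@near_eq_is_derive _ _ _ (cst (prim f a))).
have : \forall y \near x, a < y < b.
  by apply: filterS2 (lt_nbhsr ax) (lt_nbhsl xb) => y -> ->.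
apply: filterS => y /andP[/ltW ay /ltW yb] /=.
have := oint_ge0 _ _ (lexx a) ay yb; have := oint_ge0 _ _ ay yb (lexx b).
by move: I0; rewrite /oint; lra.
Qed.

End Calculus.

(** * Continuity rules and the tactic [cont] built on them *)

Section ContinuityRules.
Context {R : realType} {T : topologicalType}.
Implicit Types (f g : T -> R).

Lemma contD f g : continuous f -> continuous g -> continuous (fun x => f x + g x).
Proof. by move=> cf cg x; apply: continuousD; [exact: cf|exact: cg]. Qed.

Lemma contN f : continuous f -> continuous (fun x => - f x).
Proof. by move=> cf x; apply: continuousN; exact: cf. Qed.

Lemma contM f g : continuous f -> continuous g -> continuous (fun x => f x * g x).
Proof. by move=> cf cg x; apply: continuousM; [exact: cf|exact: cg]. Qed.

Lemma contX f n : continuous f -> continuous (fun x => f x ^+ n).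
Proof. by move=> cf x; exact: (continuous_comp (cf x) (@exprn_continuous _ _ _)). Qed.

Lemma cont_norm f : continuous f -> continuous (fun x => `|f x|).
Proof. by move=> cf x; exact: (continuous_comp (cf x) (@norm_continuous _ _ _)). Qed.

Lemma cont_max f g : continuous f -> continuous g ->
  continuous (fun x => Num.max (f x) (g x)).
Proof. by move=> cf cg x; apply: continuous_max; [exact: cf|exact: cg]. Qed.

Lemma cont_cst (k : R) : continuous (fun _ : T => k).
Proof. by move=> x; exact: cvg_cst. Qed.

Lemma cont_comp (F : R -> R) f : continuous F -> continuous f ->
  continuous (fun x => F (f x)).
Proof. by move=> cF cf x; exact: (continuous_comp (cf x) (cF _)). Qed.

Lemma cont_comp2 (F : R -> R -> R) f g :
  continuous (fun p : R * R => F p.1 p.2) -> continuous f -> continuous g ->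
  continuous (fun x => F (f x) (g x)).
Proof.
by move=> cF cf cg x; exact: (cvg_comp2 (cf x) (cg x) (cF (f x, g x))).
Qed.

Lemma cont_inv f : continuous f -> (forall x, f x != 0) ->
  continuous (fun x => (f x)^-1).
Proof. by move=> cf f0 x; apply: continuousV => //; exact: cf. Qed.

End ContinuityRules.

Lemma cont_id {T : topologicalType} : continuous (fun x : T => x).
Proof. by move=> x; exact: cvg_id. Qed.

Lemma cont_fst {R : realType} : continuous (fun p : R * R => p.1).
Proof. by move=> x; exact: cvg_fst. Qed.

Lemma cont_snd {R : realType} : continuous (fun p : R * R => p.2).
Proof. by move=> x; exact: cvg_snd. Qed.

Ltac cont := repeat (cbv beta; first
  [ match goal with H : ?P |- ?Q => constr_eq P Q; exact H end
  | lazymatch goal with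
    | |- forall x, continuous_at x (fun _ => ?k) => apply: cont_cst
    | |- forall x, continuous_at x (fun y => y) => apply: cont_id
    | |- forall x, continuous_at x (fun p => p.1) => apply: cont_fst
    | |- forall x, continuous_at x (fun p => p.2) => apply: cont_snd
    | |- forall x, continuous_at x (fun y => @?f y + @?g y) => refine (@contD _ _ f g _ _)
    | |- forall x, continuous_at x (fun y => - @?f y) => refine (@contN _ _ f _)
    | |- forall x, continuous_at x (fun y => @?f y * @?g y) => refine (@contM _ _ f g _ _)
    | |- forall x, continuous_at x (fun y => @?f y ^+ ?n) => refine (@contX _ _ f n _)
    | |- forall x, continuous_at x (fun y => `|@?f y|) => refine (@cont_norm _ _ f _)
    | |- forall x, continuous_at x (fun y => Num.max (@?f y) (@?g y)) =>
        refine (@cont_max _ _ f g _ _)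
    end
  | match goal with
    | H : forall x, continuous_at x (fun p => ?F p.1 p.2)
      |- forall x, continuous_at x (fun y => ?F (@?f y) (@?g y)) =>
        refine (@cont_comp2 _ _ F f g H _ _)
    | H : forall x, continuous_at x (fun p => ?F p.1 p.2)
      |- forall x, continuous_at x (?F ?a) =>
        refine (@cont_comp2 _ _ F (fun=> a) (fun y => y) H _ _)
    | H : forall x, continuous_at x ?F
      |- forall x, continuous_at x (fun y => ?F (@?f y)) =>
        refine (@cont_comp _ _ F f H _)
    end
  | match goal with H : ?P |- ?P => exact H end ]).

(** * Differentiation rules and the du Bois-Reymond lemma *)

Section Derivation.
Context {R : realType}.
Implicit Types (f g F G : R -> R) (a b x y : R).

Lemma has_derivD F f G g : has_deriv F f -> has_deriv G g ->
  has_deriv (fun x => F x + G x) (fun x => f x + g x).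
Proof. by move=> dF dG x; apply: is_deriveD; [exact: dF|exact: dG]. Qed.

Lemma has_derivN F f : has_deriv F f -> has_deriv (fun x => - F x) (fun x => - f x).
Proof. by move=> dF x; apply: is_deriveN; exact: dF. Qed.

Lemma has_derivB F f G g : has_deriv F f -> has_deriv G g ->
  has_deriv (fun x => F x - G x) (fun x => f x - g x).
Proof. by move=> dF dG; apply: has_derivD => //; exact: has_derivN. Qed.

Lemma has_deriv_eq F f f' : has_deriv F f -> f =1 f' -> has_deriv F f'.
Proof. by move=> dF ff' x; rewrite -ff'; exact: dF. Qed.

Lemma has_derivM F f G g : has_deriv F f -> has_deriv G g ->
  has_deriv (fun x => F x * G x) (fun x => f x * G x + F x * g x).
Proof.
move=> dF dG x; rewrite addrC [f x * _]mulrC.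
by apply: is_deriveM; [exact: dF|exact: dG].
Qed.

Lemma has_deriv_cst (k : R) : has_deriv (fun=> k) (fun=> 0).
Proof. by move=> x; exact: is_derive_cst. Qed.

Lemma has_deriv_id : has_deriv (fun x : R => x) (fun=> 1).
Proof. by move=> x; exact: is_derive_id. Qed.

Lemma has_deriv_comp F f G g : has_deriv F f -> has_deriv G g ->
  has_deriv (fun x => F (G x)) (fun x => f (G x) * g x).
Proof. by move=> dF dG x; apply: is_derive1_comp; [exact: dF|exact: dG]. Qed.

Lemma has_deriv_opp F f : has_deriv F f ->
  has_deriv (fun x => F (- x)) (fun x => - f (- x)).
Proof.
move=> dF; apply: has_deriv_eq.
  exact: has_deriv_comp dF (has_derivN has_deriv_id).
by move=> x /=; rewrite mulrN1.
Qed.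

Lemma has_derivV F f : (forall x, F x != 0) -> has_deriv F f ->
  has_deriv (fun x => (F x)^-1) (fun x => - f x * (F x)^-1 ^+ 2).
Proof.
move=> F0 dF x; have -> : - f x * (F x)^-1 ^+ 2 = - F x ^- 2 *: f x.
  by rewrite /GRing.scale /= exprVn mulrC mulrN mulNr.
by apply: is_deriveV => //; exact: dF.
Qed.

Lemma oint0 f a b : continuous f -> a <= b ->
  (forall x, a <= x <= b -> f x = 0) -> oint f a b = 0.
Proof.
move=> cf ab f0; rewrite (@eq_oint _ f (fun x => 0 * f x))//.
- by rewrite ointZ// mul0r.
- by cont.
- by move=> x /f0 ->; rewrite mul0r.
Qed.

Lemma oint_by_parts F f G g a b : continuous f -> continuous g ->
  has_deriv F f -> has_deriv G g ->
  oint (fun x => f x * G x) a b = F b * G b - F a * G a - oint (fun x => F x * g x) a b.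
Proof.
move=> cf cg dF dG; have cF := is_derive_continuous dF.
have cG := is_derive_continuous dG.
rewrite -(oint_derive a b _ (has_derivM dF dG)); last by cont.
by rewrite ointD; [rewrite addrK|cont|cont].
Qed.

(** Only values of [f] on the interval enter, so this applies to one-sided derivatives at the ends,
    both for the coefficients and for the traces of the kernels. *)
Lemma oint_extension f g a b : a < b -> continuous g ->
  (forall x (e : R), a <= x <= b -> 0 < e -> exists2 d : R, 0 < d &
    forall y, a <= y <= b -> `|y - x| < d ->
      `|f y - f x - (y - x) * g x| <= e * `|y - x|) ->
  forall x, a <= x <= b -> f x = f a + oint g a x.
Proof.
move=> ab cg H x xab.
have := @cst_on_itv R (fun x => f x - prim g x) a b (ltW ab) _ x xab.
move=> H'; have {H'} := H' _; rewrite /oint => E; last first.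
  rewrite -[f x](subrK (prim g x)) E; first by lra.
move=> {x xab E} x e xab e0; have e20 : 0 < e / 2 by rewrite divr_gt0.
have [d1 d10 P1] := H x _ xab e20.
have /is_derive_epsP/(_ _ e20)[d2 d20 P2] := is_derive_prim cg x.
exists (Num.min d1 d2); first by rewrite lt_min d10.
move=> y yab; rewrite lt_min => /andP[/(P1 _ yab) A /P2 B].
have -> : f y - prim g y - (f x - prim g x) =
  (f y - f x - (y - x) * g x) - (prim g y - prim g x - (y - x) * g x) by lra.
by apply: le_trans (ler_normB _ _) _; lra.
Qed.

Definition test_fun a b r r' : Prop :=
  [/\ has_deriv r r', continuous r' & exists2 d : R, 0 < d &
    forall x, (r x != 0) || (r' x != 0) -> a + d <= x <= b - d].

(* Testing with the primitive of [(F - kappa) q], where [q] is a bump and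
   [kappa] the [q]-mean of [F := f - prim g], kills the [q]-variance of [F]. *)
Lemma du_Bois_Reymond f g a b : a < b -> continuous f -> continuous g ->
  (forall r r', test_fun a b r r' ->
    oint (fun x => f x * r' x + g x * r x) a b = 0) ->
  forall x y, a <= x <= b -> a <= y <= b -> f y - f x = oint g x y.
Proof.
move=> ab cf cg H.
pose F x := f x - prim g x.
have cp : continuous (prim g) by apply: is_derive_continuous (is_derive_prim cg).
have cF : continuous F by rewrite /F; cont.
have step d : 0 < d -> a + d < b - d ->
    exists k, forall x, a + d < x < b - d -> F x = k.
  move=> d0 AB; set A := a + d in AB *; set B := b - d in AB *.
  pose q x := Num.max 0 ((x - A) * (B - x)).
  have cq : continuous q by rewrite /q; cont.
  have q0 x : 0 <= q x by rewrite le_max lexx.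
  have qout x : x <= A \/ B <= x -> q x = 0.
    by move=> xAB; apply: max_l; case: xAB => ?; nra.
  have qin x : A < x < B -> 0 < q x.
    by move=> /andP[? ?]; rewrite lt_max; apply/orP; right; nra.
  have Iq : oint q A B != 0.
    apply/eqP => /(oint_eq0 cq (ltW AB) (fun x _ => q0 x))/(_ ((A + B) / 2)) E.
    have AB2 : A < (A + B) / 2 < B by lra.
    by have := qin _ AB2; rewrite E// ltxx.
  pose k := oint (fun x => F x * q x) A B / oint q A B.
  pose m x := (F x - k) * q x.
  have cm : continuous m by rewrite /m; cont.
  have mout x : x <= A \/ B <= x -> m x = 0 by move=> /qout; rewrite /m => ->; rewrite mulr0.
  have Im : oint m A B = 0.
    have -> : m = (fun x => F x * q x - k * q x) by apply/funext => x; rewrite /m mulrBl.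
    by rewrite ointB ?ointZ//; [rewrite /k divfK// subrr|cont|cont].
  (* [m] has integral zero, so this primitive vanishes on both sides of [[A, B]] and is
     admissible. *)
  pose r x := prim m x - prim m A.
  have rA x : x <= A -> r x = 0.
    move=> xA; apply/eqP; rewrite -oppr_eq0 opprB; apply/eqP.
    by apply: oint0 => // y /andP[_ yA]; apply: mout; left.
  have rB x : B <= x -> r x = 0.
    move=> Bx; rewrite -[r x]/(oint m A x) (oint_cat _ _ B) Im add0r.
    by apply: oint0 => // y /andP[By _]; apply: mout; right.
  have dr : has_deriv r m.
    apply: has_deriv_eq (has_derivB (is_derive_prim cm) (has_deriv_cst _)) _.
    by move=> x /=; rewrite subr0.
  have cr := is_derive_continuous dr.
  have aA : a <= A by rewrite /A; lra.
  have Bb : B <= b by rewrite /B; lra.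
  have tm : test_fun a b r m.
    split=> //; exists d => // x xAB; apply/andP; split.
      rewrite leNgt; apply: contraL xAB => /ltW xA.
      by rewrite rA// mout ?eqxx//; left.
    rewrite leNgt; apply: contraL xAB => /ltW xB.
    by rewrite rB// mout ?eqxx//; right.
  have := H r m tm; rewrite ointD; [|cont|cont].
  rewrite (oint_by_parts _ _ cg cm (is_derive_prim cg) dr) (rA a)// (rB b)//.
  rewrite !mulr0 subr0 sub0r -ointB; [|cont|cont] => E.
  have {}E : oint (fun x => F x * m x) a b = 0.
    by rewrite -{}E; congr (oint _ a b); apply/funext => x; rewrite /F mulrBl.
  have cFm : continuous (fun x => F x * m x) by cont.
  have {}E : oint (fun x => F x * m x) A B = 0.
    move: E; rewrite (oint_cat _ _ A) (oint_cat _ A B).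
    rewrite (oint0 cFm aA); last by move=> y ?; rewrite mout ?mulr0//; left; lra.
    rewrite (oint0 cFm Bb); last by move=> y ?; rewrite mout ?mulr0//; right; lra.
    by rewrite addr0 add0r.
  have E2 : oint (fun x => (F x - k) ^+ 2 * q x) A B = 0.
    have -> : (fun x => (F x - k) ^+ 2 * q x) = (fun x => F x * m x - k * m x).
      by apply/funext => x; rewrite /m; ring.
    by rewrite ointB ?ointZ ?E ?Im; [rewrite mulr0 subr0|cont..].
  exists k => x xAB; have cE2 : continuous (fun x => (F x - k) ^+ 2 * q x) by cont.
  have := @oint_eq0 _ _ _ _ cE2 (ltW AB) (fun y _ => mulr_ge0 (sqr_ge0 _) (q0 y)) E2 x xAB.
  move/eqP; rewrite mulf_eq0 (gt_eqF (qin _ xAB)) orbF expf_eq0 /= subr_eq0.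
  by move/eqP.
(* The constants found for different margins agree, because each margin is taken so small that the
   midpoint [M] is inside. *)
pose M := (a + b) / 2.
have aMb : a < M < b by rewrite /M; lra.
have inside x : a < x < b -> F x = F M.
  move=> /andP[ax xb]; have /andP[aM Mb] := aMb.
  pose d := Num.min (Num.min (x - a) (b - x)) (Num.min (M - a) (b - M)) / 2.
  have [d0 [dx1 [dx2 [dM1 dM2]]]] : 0 < d /\ d < x - a /\ d < b - x /\
      d < M - a /\ d < b - M.
    rewrite /d !minEle; clear -ax xb aM Mb; repeat case: ifPn; rewrite -?ltNge => *;
    by repeat split; lra.
  have dAB : a + d < b - d by lra.
  have [k Fk] := step d d0 dAB.
  by rewrite !Fk//; lra.
have edge x : a <= x <= b -> F x = F M.
  move=> /andP[ax xb]; apply/eqP; rewrite -subr_eq0 -normr_eq0 eq_le normr_ge0 andbT.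
  apply/ler_addgt0Pr => e e0; rewrite add0r.
  have /continuous_epsP/(_ _ e0)[d d0 dP] := cF x.
  (* An endpoint is reached by continuity: going from [x] towards [M] by the fraction [s] lands
     inside, and [|M - x| <= (b - a) / 2] keeps the move below [d]. *)
  pose s := Num.min (1 / 2) (d / (b - a)).
  have ba : 0 < b - a by rewrite subr_gt0.
  have s0 : 0 < s by rewrite /s lt_min divr_gt0//= divr_gt0.
  have s2 : s <= 1 / 2 by rewrite /s ge_min lexx.
  have sd : s * (b - a) <= d.
    by rewrite -ler_pdivlMr// /s ge_min lexx orbT.
  pose y := x + s * (M - x).
  have yab : a < y < b by rewrite /y /M; apply/andP; split; nra.
  rewrite distrC -(inside y yab); apply: dP.
  have -> : y - x = s * (M - x) by rewrite /y; ring.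
  have MX : `|M - x| <= (b - a) / 2 by rewrite ler_norml /M; lra.
  by rewrite normrM (gtr0_norm s0); nra.
move=> x y xab yab; have := edge x xab; rewrite -(edge y yab) /F /oint; lra.
Qed.

End Derivation.

(** * Integrals of continuous functions of two variables *)

Section TwoVariables.
Context {R : realType}.
Implicit Types (f : R -> R -> R) (a b x y : R).

(** Compactness of the segment makes the modulus of continuity at [z0] uniform in [w], which is what
    allows limits in [z] under an integral in [w]. *)
Lemma tube f z0 a b (e : R) : continuous (fun p : R * R => f p.1 p.2) -> 0 < e ->
  exists2 d : R, 0 < d &
    forall z w, `|z - z0| < d -> a <= w <= b -> `|f z w - f z0 w| <= e.
Proof.
move=> cf e0; have e20 : 0 < e / 2 by rewrite divr_gt0.
have /compact_near_coveringP/(_ R (nbhs z0)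
  (fun z w => `|f z w - f z0 w| <= e) _) := @segment_compact R a b.
case=> [w _|].
  have /continuous2_epsP/(_ _ e20)[d d0 dP] := cf (z0, w).
  exists (ball w d, ball z0 d) => /=; first by split; exact: nbhsx_ballx.
  move=> [w' z] [/=]; rewrite /ball /= => wd zd.
  have -> : f z w' - f z0 w' = (f z w' - f z0 w) - (f z0 w' - f z0 w) by ring.
  apply: le_trans (ler_normB _ _) _.
  have := dP z w'; rewrite distrC => /(_ zd); rewrite distrC => /(_ wd) A.
  have := dP z0 w'; rewrite subrr normr0 => /(_ d0); rewrite distrC => /(_ wd) B.
  lra.
move=> d /= d0 dP; exists d => // z w zd wab.
by apply: (dP z) => /=; [rewrite /ball /= distrC|rewrite in_itv].
Qed.

Lemma cont_prim2 f : continuous (fun p : R * R => f p.1 p.2) ->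
  continuous (fun p : R * R => prim (f p.1) p.2).
Proof.
move=> cf [z0 c0]; apply/(continuous2_epsP (fun z c => prim (f z) c)) => e e0.
have cfz z : continuous (f z) by cont.
pose N := `|c0| + 1; have N0 : 0 < N by rewrite ltr_wpDl.
have e2N : 0 < e / 2 / N by rewrite !divr_gt0.
have [d1 d10 P1] := tube z0 (- N) N cf e2N.
have cp : continuous (prim (f z0)) by apply: is_derive_continuous (is_derive_prim _).
have e20 : 0 < e / 2 by rewrite divr_gt0.
have /continuous_epsP/(_ _ e20)[d2 d20 P2] := cp c0.
exists (Num.min d1 (Num.min d2 1)); first by rewrite !lt_min d10 d20 ltr01.
move=> z c; rewrite !lt_min => /andP[zd _] /andP[_ /andP[cd c1]].
have cN : `|c| <= N.
  have -> : c = (c - c0) + c0 by ring.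
  by apply: le_trans (ler_normD _ _) _; rewrite /N; lra.
have -> : prim (f z) c - prim (f z0) c0 =
    oint (fun w => f z w - f z0 w) 0 c + (prim (f z0) c - prim (f z0) c0).
  by rewrite ointB// /oint !prim0; ring.
apply: le_trans (ler_normD _ _) _.
have A : `|oint (fun w => f z w - f z0 w) 0 c| <= e / 2 / N * `|c - 0|.
  apply: oint_bound_abs; first by cont.
  move=> w wc; apply: P1 => //.
  move: wc cN; rewrite ge_min le_max ler_norml => /andP[/orP[?|?] /orP[?|?]] /andP[? ?]; lra.
have B : e / 2 / N * `|c - 0| <= e / 2.
  rewrite subr0; apply: le_trans (ler_wpM2l (ltW e2N) cN) _.
  by rewrite divfK// gt_eqF.
have := P2 _ cd; lra.
Qed.

Lemma cont_oint {T : topologicalType} f (g a b : T -> R) :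
  continuous (fun p : R * R => f p.1 p.2) ->
  continuous g -> continuous a -> continuous b ->
  continuous (fun t => oint (f (g t)) (a t) (b t)).
Proof.
move=> cf cg ca cb; have cp := cont_prim2 cf; rewrite /oint.
apply: contD; last apply: contN;
  by apply: (cont_comp2 (F := fun z c => prim (f z) c)).
Qed.

(** No measure theory is involved: as a function of its upper bound in [z], the right-hand side has
    the integrand of the left-hand side as derivative. *)
Lemma oint_swap f a b c d : continuous (fun p : R * R => f p.1 p.2) ->
  oint (fun z => oint (f z) c d) a b = oint (fun w => oint (fun z => f z w) a b) c d.
Proof.
move=> cf; pose f' w z := f z w.
have cf' : continuous (fun p : R * R => f' p.1 p.2) by rewrite /f'; cont.
have cfz z : continuous (f z) by cont.
have cfw w : continuous (f' w) by rewrite /f'; cont.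
pose F t := oint (fun w => oint (f' w) a t) c d.
have cI s t : continuous (fun w => oint (f' w) s t) by apply: cont_oint => //; cont.
have cJ : continuous (fun z => oint (f z) c d) by apply: cont_oint => //; cont.
have dF : has_deriv F (fun z => oint (f z) c d).
  move=> z0; apply/is_derive_epsP => e e0.
  have D0 : 0 < `|d - c| + 1 by rewrite ltr_wpDl.
  have e'0 : 0 < e / (`|d - c| + 1) by rewrite divr_gt0.
  have [dl dl0 dP] := tube z0 (Num.min c d) (Num.max c d) cf e'0.
  exists dl => // z zd.
  have -> : F z - F z0 - (z - z0) * oint (f z0) c d =
      oint (fun w => oint (fun s => f' w s - f' w z0) z0 z) c d.
    have -> : (fun w => oint (fun s => f' w s - f' w z0) z0 z) =
        (fun w => oint (f' w) a z - oint (f' w) a z0 - (z - z0) * f z0 w).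
      apply/funext => w; rewrite ointB//; last by cont.
      rewrite (@oint_derive _ (fun s => f' w z0 * s) (fun=> f' w z0)).
          by rewrite /oint /f'; ring.
        by cont.
      apply: has_deriv_eq (has_derivM (has_deriv_cst _) has_deriv_id) _ => s /=.
      by rewrite mul0r add0r mulr1.
    have c1 : continuous (fun w => oint (f' w) a z - oint (f' w) a z0).
      by apply: contD; [exact: cI|apply: contN; exact: cI].
    have c2 : continuous (fun w => (z - z0) * f z0 w) by cont.
    by rewrite (ointB _ _ c1 c2) (ointB _ _ (cI a z) (cI a z0)) ointZ.
  apply: le_trans (oint_bound_abs (B := e / (`|d - c| + 1) * `|z - z0|) _ _) _.
  - apply: (@cont_oint _ (fun w s => f' w s - f' w z0)); by rewrite /f'; cont.
  - move=> w wcd; apply: oint_bound_abs; first by rewrite /f'; cont.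
    move=> s sz; apply: dP => //; apply: le_lt_trans zd.
    exact: between_dist.
  - rewrite mulrAC; apply: ler_wpM2r => //.
    by rewrite mulrAC ler_pdivrMr// ler_wpM2l ?(ltW e0)// lerDl.
rewrite (oint_derive _ _ cJ dF) /F [X in _ - X = _](_ : _ = 0) ?subr0//.
have -> : (fun w => oint (f' w) a a) = (fun _ : R => 0 * 0).
  by apply/funext => w; rewrite ointxx mulr0.
by rewrite ointZ ?mul0r//; cont.
Qed.

End TwoVariables.

(** * Kernels and their adjoints *)

Section Flux.
Context {R : realType}.
Implicit Types (X Y G L F : R -> R -> R) (a b x y : R).

Lemma test_fun_out a b r r' x : test_fun a b r r' -> x <= a \/ b <= x ->
  r x = 0 :> R /\ r' x = 0.
Proof.
case=> _ _ [d d0 dP] xab.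
have : ~~ ((r x != 0) || (r' x != 0)).
  by apply/negP => /dP /andP[? ?]; case: xab => ?; lra.
by rewrite negb_or !negbK => /andP[/eqP -> /eqP ->].
Qed.

Lemma oint_shrink (f : R -> R) a A B b : continuous f -> a <= A -> B <= b ->
  (forall x, x <= A \/ B <= x -> f x = 0) -> oint f a b = oint f A B.
Proof.
move=> cf aA Bb f0; rewrite (oint_cat _ _ A) (oint_cat _ A B).
rewrite (oint0 cf aA); last by move=> x /andP[_ ?]; apply: f0; left.
rewrite (oint0 cf Bb); last by move=> x /andP[? _]; apply: f0; right.
by rewrite addr0 add0r.
Qed.

(* The upper half of a field on [E], folded along [w -> -w]: this is the weak
   form of [X_z + Y_w = G] on the triangle [|z| < w < 1]. *)
Definition weak_div X Y G : Prop := forall c r r' s s', 0 < c < 1 ->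
  test_fun (- c) c r r' -> test_fun c 1 s s' ->
  oint (fun w => oint (fun z => X z w * (r' z * s w) + Y z w * (r z * s' w)
    + G z w * (r z * s w)) (-1) 1) 0 1 = 0.

(** The divergence theorem on the rectangle [[x, y] x [c, 1]], for a field with no derivatives. The
    rectangle lies in the triangle because [x] and [y] are at most [c] in modulus. *)
Lemma weak_div_flux X Y G c x y :
  continuous (fun p : R * R => X p.1 p.2) ->
  continuous (fun p : R * R => Y p.1 p.2) ->
  continuous (fun p : R * R => G p.1 p.2) -> weak_div X Y G ->
  0 <= c <= 1 -> - c <= x <= c -> - c <= y <= c ->
  oint (X y) c 1 - oint (X x) c 1 =
  oint (fun z => oint (G z) c 1 - Y z 1 + Y z c) x y.
Proof.
(* Test functions need nondegenerate intervals, so [c = 0] and [c = 1] are settled apart; both sides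
   are then zero. *)
move=> cX cY cG wd /andP[]; rewrite le_eqVlt => /predU1P[<- _|c0].
  rewrite oppr0 => /andP[x0 x0'] /andP[y0 y0'].
  have -> : x = 0 by lra.
  have -> : y = 0 by lra.
  by rewrite ointxx subrr.
rewrite le_eqVlt => /predU1P[-> _ _|c1].
  rewrite !ointxx subrr.
  have -> : (fun z => oint (G z) 1 1 - Y z 1 + Y z 1) = (fun _ : R => 0 * 0).
    by apply/funext => z; rewrite ointxx; ring.
  by rewrite ointZ ?mul0r//; cont.
move=> xc yc; have cc : - c < c by lra.
have cI (f : R -> R -> R) : continuous (fun p : R * R => f p.1 p.2) ->
    continuous (fun z => oint (f z) c 1) by move=> cf; apply: cont_oint => //; cont.
have cXI := cI _ cX; have cGI := cI _ cG.
apply: (@du_Bois_Reymond _ (fun z => oint (X z) c 1)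
  (fun z => oint (G z) c 1 - Y z 1 + Y z c) _ _ cc) => //; first by cont.
move=> r r' tr; have [dr cr' _] := tr; have cr := is_derive_continuous dr.
pose P z w := X z w * r' z + G z w * r z.
pose Q z w := Y z w * r z.
have cP : continuous (fun p : R * R => P p.1 p.2) by rewrite /P; cont.
have cQ : continuous (fun p : R * R => Q p.1 p.2) by rewrite /Q; cont.
have cPw w : continuous (P^~ w) by cont.
have cQw w : continuous (Q^~ w) by cont.
pose f w := oint (Q^~ w) (- c) c.
pose g w := oint (P^~ w) (- c) c.
have cf : continuous f.
  by apply: (@cont_oint _ _ (fun w z => Q z w)); cont.
have cg : continuous g.
  by apply: (@cont_oint _ _ (fun w z => P z w)); cont.
(* With [r] frozen, the [z]-moments of the field satisfy a one-dimensional weak equation in [w]. *)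
have fg : f 1 - f c = oint g c 1.
  apply: (du_Bois_Reymond c1) => //; [|lra|lra].
  move=> s s' ts; have [ds cs' _] := ts; have cs := is_derive_continuous ds.
  rewrite -[RHS](wd c r r' s s')//; last by rewrite c0.
  have ci w : continuous (fun z => X z w * (r' z * s w) + Y z w * (r z * s' w)
      + G z w * (r z * s w)) by cont.
  have E : (fun w => oint (fun z => X z w * (r' z * s w) + Y z w * (r z * s' w)
      + G z w * (r z * s w)) (-1) 1) = (fun w => f w * s' w + g w * s w).
    apply/funext => w; rewrite (@oint_shrink _ _ (- c) c _ (ci w)); first last.
    - by move=> z /(test_fun_out tr)[-> ->]; ring.
    - exact: ltW.
    - by rewrite lerN2 ltW.
    rewrite mulrC [g w * _]mulrC -(ointZ _ _ _ (cQw w)) -(ointZ _ _ _ (cPw w)).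
    rewrite -ointD; [|cont|cont]; congr (oint _ _ _); apply/funext => z.
    by rewrite /P /Q; ring.
  rewrite E; apply/esym/oint_shrink; [by cont|exact: ltW|exact: lexx|].
  by move=> z /(test_fun_out ts)[-> ->]; ring.
have -> : (fun z => oint (X z) c 1 * r' z
    + (oint (G z) c 1 - Y z 1 + Y z c) * r z) =
    (fun z => oint (P z) c 1 - (Q z 1 - Q z c)).
  apply/funext => z; rewrite /P /Q ointD; [|cont|cont].
  rewrite (_ : (fun w => X z w * r' z) = (fun w => r' z * X z w)); last first.
    by apply/funext => w; rewrite mulrC.
  rewrite (_ : (fun w => G z w * r z) = (fun w => r z * G z w)); last first.
    by apply/funext => w; rewrite mulrC.
  by rewrite !ointZ; [ring|cont|cont].
have cPI := cI _ cP.
have cQQ : continuous (fun z => Q z 1 - Q z c) by cont.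
rewrite (ointB _ _ cPI cQQ) (ointB _ _ (cQw 1) (cQw c)).
by rewrite (oint_swap _ _ _ _ cP) -/(f 1) -/(f c) fg subrr.
Qed.

(** The lower end [|z|] moves with [z]: besides the flux [Y] through it, this costs the value of [X]
    there, with a sign that depends on the side of 0. [B] joins the two one-sided traces into one
    continuous function, so the derivative also exists at the corner [z = 0]. *)
Lemma weak_div_trace X Y G (B : R -> R) :
  continuous (fun p : R * R => X p.1 p.2) ->
  continuous (fun p : R * R => Y p.1 p.2) ->
  continuous (fun p : R * R => G p.1 p.2) -> continuous B ->
  (forall z, 0 <= z <= 1 -> B z = Y z z - X z z) ->
  (forall z, -1 <= z <= 0 -> B z = Y z (- z) + X z (- z)) ->
  weak_div X Y G -> forall z, -1 <= z <= 1 ->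
  oint (X z) `|z| 1 = oint (fun z => oint (G z) `|z| 1 - Y z 1 + B z) (-1) z.
Proof.
move=> cX cY cG cB B1 B2 wd z z11.
pose H z c := oint (G z) c 1 - Y z 1 + Y z c.
have cGI : continuous (fun p : R * R => oint (G p.1) p.2 1).
  by apply: (@cont_oint _ _ G (fun p => p.1) (fun p => p.2) (fun=> 1)) => //; cont.
have cH : continuous (fun p : R * R => H p.1 p.2).
  by apply: contD => //; apply: contD => //; cont.
pose r z := oint (G z) `|z| 1 - Y z 1 + B z.
have cr : continuous r.
  have c1 : continuous (fun z => oint (G z) `|z| 1).
    by apply: (@cont_oint _ _ G (fun z => z) (fun z => `|z|) (fun=> 1)) => //; cont.
  by rewrite /r; cont.
have m11 : (-1 : R) < 1 by lra.
rewrite (@oint_extension _ (fun z => oint (X z) `|z| 1) r _ _ m11 cr _ z z11).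
  by rewrite normrN1 ointxx add0r.
move=> {z z11} x e x11 e0; have e20 : 0 < e / 2 by rewrite divr_gt0.
have /(continuous2_epsP H)/(_ _ e20)[d1 d10 P1] := cH (x, `|x|).
have /(continuous2_epsP X)/(_ _ e20)[d2 d20 P2] := cX (x, `|x|).
(* Keeps [y] on the side of 0 where [x] is, so that a single formula for [B] applies; from [x = 0]
   both sides are allowed. *)
pose d3 := if x == 0 then 1 else `|x|.
have d30 : 0 < d3 by rewrite /d3; case: eqP => // /eqP; rewrite normr_gt0.
exists (Num.min (Num.min d1 d2) d3); first by rewrite !lt_min d10 d20.
move=> y y11; rewrite !lt_min => /andP[/andP[yd1 yd2] yd3].
have sameside : (0 <= x /\ 0 <= y) \/ (x <= 0 /\ y <= 0).
  move: yd3; rewrite /d3; case: eqP => [->|_]; first by case: (leP 0 y); lra.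
  rewrite ltr_norml; have [x0|x0] := leP 0 x.
    by rewrite ger0_norm//; lra.
  by rewrite ltr0_norm//; lra.
have nx1 : `|x| <= 1 by rewrite ler_norml.
have ny1 : `|y| <= 1 by rewrite ler_norml.
have nxy : `| `|y| - `|x| | <= `|y - x| by exact: ler_dist_dist.
have cHc c : continuous (H^~ c) by cont.
(* The rectangle has the larger of [|x|] and [|y|] as base [c]; [n] is the point of smaller modulus,
   on whose vertical line a piece between [|x|] and [|y|] is missed. *)
have [c [n [cx nx ->]]] : exists c n, [/\ `|c - `|x| | <= `|y - x|,
    `|n - x| <= `|y - x| & oint (X y) `|y| 1 - oint (X x) `|x| 1 =
      oint (H^~ c) x y - oint (X n) `|x| `|y|].
  have flux c : 0 <= c <= 1 -> `|x| <= c -> `|y| <= c ->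
      oint (X y) c 1 - oint (X x) c 1 = oint (H^~ c) x y.
    by rewrite !ler_norml => c01 xc yc; apply: weak_div_flux.
  have [xy|/ltW yx] := leP `|x| `|y|.
    exists `|y|, x; split=> //; first by rewrite subrr normr0.
    by rewrite -flux ?normr_ge0// (oint_cat _ `|x| `|y|); ring.
  exists `|x|, y; split=> //; first by rewrite subrr normr0.
  by rewrite -flux ?normr_ge0// (oint_cat _ `|y| `|x|) [oint _ `|y| `|x|]ointC; ring.
have -> : oint (H^~ c) x y - oint (X n) `|x| `|y| - (y - x) * r x =
    oint (fun z => H z c - H x `|x|) x y - oint (fun w => X n w - X x `|x|) `|x| `|y|.
  have ck (k : R) : continuous (fun _ : R => k) by cont.
  rewrite !ointB//; [|by cont].
  have Ek (k a b : R) : oint (fun=> k) a b = k * (b - a).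
    rewrite (@oint_derive _ (fun s => k * s) (fun=> k))//; first by rewrite mulrBr.
    apply: has_deriv_eq (has_derivM (has_deriv_cst _) has_deriv_id) _ => s /=.
    by rewrite mul0r add0r mulr1.
  rewrite !Ek /r /H; case: sameside => -[x0 y0].
    by rewrite !ger0_norm// B1; [ring|lra].
  by rewrite !ler0_norm// B2; [ring|lra].
apply: le_trans (ler_normB _ _) _.
have A1 : `|oint (fun z => H z c - H x `|x|) x y| <= e / 2 * `|y - x|.
  apply: oint_bound_abs; first by cont.
  move=> z zxy; apply: P1; last exact: le_lt_trans yd1.
  apply: le_lt_trans yd1.
  exact: between_dist.
have A2 : `|oint (fun w => X n w - X x `|x|) `|x| `|y| | <= e / 2 * `| `|y| - `|x| |.
  apply: oint_bound_abs; first by cont.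
  move=> w wxy; apply: P2; first exact: le_lt_trans yd2.
  apply: le_lt_trans yd2; apply: le_trans nxy.
  exact: between_dist.
by have := ler_wpM2l (ltW e20) nxy; lra.
Qed.

End Flux.

(** * Folded adjoints of the kernels and their derivatives *)

Section KernelAdjoint.
Context {R : realType}.
Implicit Types (L F : R -> R -> R) (a b x y : R).
Notation leb := (@lebesgue_measure R).

Lemma I11E : I11 = `[(-1 : R), 1]%classic.
Proof. by rewrite set_itvcc. Qed.

Lemma RintegralI11 (f : R -> R) : continuous f -> Rintegral leb I11 f = oint f (-1) 1.
Proof. by move=> cf; rewrite I11E RintegralE//; lra. Qed.

Lemma int2E (f : R -> R -> R) : continuous (fun p : R * R => f p.1 p.2) ->
  int2 f = oint (fun w => oint (fun z => f z w) (-1) 1) (-1) 1.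
Proof.
move=> cf; rewrite /int2.
have -> : (fun w => Rintegral leb I11 (fun z => f z w)) =
    (fun w => oint (fun z => f z w) (-1) 1).
  by apply/funext => w; rewrite RintegralI11//; cont.
apply: RintegralI11; apply: (@cont_oint _ _ (fun w z => f z w)); cont.
Qed.

Lemma weak_transport_weak_div (lam lam' p p' chi chi' : R -> R) L F :
  has_deriv lam lam' -> continuous lam' -> continuous p -> continuous p' ->
  has_deriv chi chi' -> continuous chi' ->
  continuous (fun q : R * R => L q.1 q.2) ->
  continuous (fun q : R * R => F q.1 q.2) ->
  weak_transport lam lam' p p' L F ->
  let S z w := F z w * chi w + L z w * chi w * p' z
    + L z w * (lam' w * chi w + lam w * chi' w) in
  weak_div (fun z w => p z * (L z w * chi w - L z (- w) * chi (- w)))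
    (fun z w => lam w * L z w * chi w + lam (- w) * L z (- w) * chi (- w))
    (fun z w => S z w - S z (- w)).
Proof.
move=> dlam clam' cp cp' dchi cchi' cL cF wt S c r r' s s' c01 tr ts.
have clam := is_derive_continuous dlam.
have cchi := is_derive_continuous dchi.
have [dr cr' [d1 d10 P1]] := tr; have cr := is_derive_continuous dr.
have [ds cs' [d2 d20 P2]] := ts; have cs := is_derive_continuous ds.
(* Antisymmetrising [s], which lives on [w > 0], brings in [chi] at [w] and, with a minus sign, at
   [- w]: the sign pattern of [adj]. *)
pose t w := chi w * (s w - s (- w)).
pose t' w := chi' w * (s w - s (- w)) + chi w * (s' w + s' (- w)).
have ct : continuous t by rewrite /t; cont.
have ct' : continuous t' by rewrite /t'; cont.
have dt : has_deriv t t'.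
  apply: has_deriv_eq (has_derivM dchi (has_derivB ds (has_deriv_opp ds))) _.
  by move=> w /=; rewrite /t' opprK.
pose h z w := L z w * (lam' w * (r z * t w) + lam w * (r z * t' w)
  + p' z * (r z * t w) + p z * (r' z * t w)).
pose k z w := F z w * (r z * t w).
have ch : continuous (fun q : R * R => h q.1 q.2) by rewrite /h; cont.
have ck : continuous (fun q : R * R => k q.1 q.2) by rewrite /k; cont.
pose phi z w := r z * t w.
have tC : C1_2 phi (fun z w => r' z * t w) (fun z w => r z * t' w).
  rewrite /phi; split; [|split; [|split; [|split]]]; [| |by cont..].
    move=> x y; have := has_derivM dr (has_deriv_cst (t y)) x.
    by rewrite /= mulr0 addr0.
  move=> x y; have := has_derivM (has_deriv_cst (r x)) dt y.
  by rewrite /= mul0r add0r.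
have tS : exists d : R, 0 < d /\ forall z w, phi z w != 0 ->
    `|z| + d <= `|w| /\ `|w| <= 1 - d.
  exists (Num.min d1 d2); split; first by rewrite lt_min d10.
  have m1 : Num.min d1 d2 <= d1 by rewrite ge_min lexx.
  have m2 : Num.min d1 d2 <= d2 by rewrite ge_min lexx orbT.
  move=> z w; rewrite /phi mulf_eq0 negb_or => /andP[r0 t0].
  have zc : `|z| + d1 <= c.
    have := P1 z; rewrite r0 => /(_ isT) /andP[? ?].
    by rewrite -lerBrDr ler_norml; lra.
  suff wc : c <= `|w| <= 1 - d2 by move: wc => /andP[? ?]; lra.
  have P2' x : s x != 0 -> c + d2 <= x <= 1 - d2 by move=> sx; apply: P2; rewrite sx.
  have [sw|sw] := eqVneq (s w) 0.
    have /P2' : s (- w) != 0.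
      by apply: contraNneq t0 => sw'; rewrite /t sw sw' subrr mulr0.
    move=> ?; rewrite -normrN ger0_norm; lra.
  by have /P2' := sw; move=> ?; rewrite ger0_norm; lra.
have := wt _ _ _ tC tS; rewrite -/(int2 h) -/(int2 k) => hk.
have {}hk : int2 (fun z w => h z w + k z w) = 0.
  rewrite int2E; last by cont.
  have -> : (fun w => oint (fun z => h z w + k z w) (-1) 1) =
      (fun w => oint (fun z => h z w) (-1) 1 + oint (fun z => k z w) (-1) 1).
    by apply/funext => w; rewrite ointD//; cont.
  move: hk; rewrite (int2E ch) (int2E ck) => hk.
  rewrite ointD; first by rewrite -hk addrN.
    by apply: (@cont_oint _ _ (fun w z => h z w)); cont.
  by apply: (@cont_oint _ _ (fun w z => k z w)); cont.
move: hk; rewrite int2E; last by cont.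
set m := (fun w => oint (fun z => h z w + k z w) (-1) 1) => hk.
have chk : continuous (fun q : R * R => h q.2 q.1 + k q.2 q.1) by cont.
have cm : continuous m.
  by apply: (@cont_oint _ _ (fun w z => h z w + k z w)); cont.
have cmN : continuous (fun w => m (- w)) by cont.
have {}hk : oint (fun w => m w + m (- w)) 0 1 = 0.
  by rewrite (ointD _ _ cm cmN) (oint_opp _ _ cm) oppr0 addrC -oint_cat.
rewrite -[RHS]hk.
have cS : continuous (fun q : R * R => S q.1 q.2) by rewrite /S; cont.
apply: eq_oint; [|by cont|exact: ler01|].
  apply: (@cont_oint _ _ (fun w z =>
    p z * (L z w * chi w - L z (- w) * chi (- w)) * (r' z * s w)
    + (lam w * L z w * chi w + lam (- w) * L z (- w) * chi (- w)) * (r z * s' w)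
    + (S z w - S z (- w)) * (r z * s w)) (fun w => w) (fun=> -1) (fun=> 1)); cont.
move=> w /andP[w0 w1]; rewrite /m -ointD; [|by cont..].
have {}c0 : 0 < c by have /andP[] := c01.
congr (oint _ _ _); apply/funext => z.
have [sw sw'] : s (- w) = 0 /\ s' (- w) = 0 by apply: (test_fun_out ts); left; lra.
by rewrite /h /k /t /t' /S opprK sw sw'; ring.
Qed.

(* The adjoint, acting on test functions, of the integral operator
   [u |-> fun w => int_(-w)^w u z * L z w dz], folded along [w -> -w]. *)
Definition adj L (g : R -> R) z : R :=
  oint (fun w => L z w * g w - L z (- w) * g (- w)) `|z| 1.

Lemma cont_adj L g : continuous (fun q : R * R => L q.1 q.2) -> continuous g ->
  continuous (adj L g).
Proof.
move=> cL cg; apply: (@cont_oint _ _ (fun z w => L z w * g w - L z (- w) * g (- w))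
  (fun z => z) (fun z => `|z|) (fun=> 1)); cont.
Qed.

Lemma adj_edge L g z : `|z| = 1 -> adj L g z = 0.
Proof. by move=> z1; rewrite /adj z1 ointxx. Qed.

(** [chi 1 = 0] reduces the flux through [w = 1] to the folded term at [w = -1]. One formula for [B]
    serves both signs of [z], since folding exchanges the diagonal and the antidiagonal. *)
Lemma adj_derivative (lam lam' p p' chi chi' B : R -> R) L F :
  has_deriv lam lam' -> continuous lam' -> continuous p -> continuous p' ->
  has_deriv chi chi' -> continuous chi' -> chi 1 = 0 ->
  continuous (fun q : R * R => L q.1 q.2) ->
  continuous (fun q : R * R => F q.1 q.2) ->
  weak_transport lam lam' p p' L F -> continuous B ->
  (forall z, -1 <= z <= 1 -> B z = (lam z - p z) * L z z * chi z
     + (lam (- z) + p z) * L z (- z) * chi (- z)) ->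
  let g w := lam' w * chi w + lam w * chi' w in
  let S z w := F z w * chi w + L z w * chi w * p' z + L z w * g w in
  exists P P', [/\ has_deriv P P', continuous P',
    forall z, P' z = oint (fun w => S z w - S z (- w)) `|z| 1
      - lam (-1) * L z (-1) * chi (-1) + B z
    & forall z, -1 <= z <= 1 -> P z = p z * adj L chi z].
Proof.
move=> dlam clam' cp cp' dchi cchi' chi1 cL cF wt cB BE g S.
have clam := is_derive_continuous dlam.
have cchi := is_derive_continuous dchi.
have cg : continuous g by rewrite /g; cont.
have cS : continuous (fun q : R * R => S q.1 q.2) by rewrite /S; cont.
have wd := weak_transport_weak_div dlam clam' cp cp' dchi cchi' cL cF wt.
set X := (fun z w => p z * _) in wd; set Y := (fun z w => lam w * _ * _ + _) in wd.
pose G z w := S z w - S z (- w).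
have cX : continuous (fun q : R * R => X q.1 q.2) by rewrite /X; cont.
have cY : continuous (fun q : R * R => Y q.1 q.2) by rewrite /Y; cont.
have cG : continuous (fun q : R * R => G q.1 q.2) by rewrite /G; cont.
pose P' z := oint (G z) `|z| 1 - Y z 1 + B z.
have cP' : continuous P'.
  have c1 : continuous (fun z => oint (G z) `|z| 1).
    by apply: (@cont_oint _ _ G (fun z => z) (fun z => `|z|) (fun=> 1)) => //; cont.
  by rewrite /P'; cont.
exists (fun z => oint P' (-1) z), P'; split=> //.
- apply: has_deriv_eq (has_derivB (is_derive_prim cP') (has_deriv_cst _)) _ => z /=.
  by rewrite subr0.
- by move=> z; rewrite /P' /Y chi1; congr (_ + _); ring.
move=> z z11; rewrite -(weak_div_trace cX cY cG cB _ _ wd z11).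
- rewrite /X /adj -ointZ//; cont.
- move=> x x01; rewrite BE /Y /X; first by ring.
  by lra.
- move=> x x01; rewrite BE /Y /X ?opprK; first by ring.
  by lra.
Qed.

End KernelAdjoint.

(** All that the equation of one target component requires, with coefficients on the whole line. The
    reflected second pair of kernels is another instance, so the argument is made once. *)
Record half_kernel {R : realType} (lam lam' mu mu' b c : R -> R)
    (L1 L2 : R -> R -> R) : Prop := HalfKernel {
  hk_lam : has_deriv lam lam';
  hk_lam' : continuous lam';
  hk_mu : has_deriv mu mu';
  hk_mu' : continuous mu';
  hk_lam_gt0 : forall x, 0 < lam x;
  hk_mu_gt0 : forall x, 0 < mu x;
  hk_sym : forall x, -1 <= x <= 1 -> lam x = mu (- x);
  hk_b : continuous b;
  hk_c : continuous c;
  hk_L1 : continuous (fun q : R * R => L1 q.1 q.2);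
  hk_L2 : continuous (fun q : R * R => L2 q.1 q.2);
  hk_eq1 : weak_transport lam lam' lam lam' L1
    (fun z w => - lam' z * L1 z w - c z * L2 z w);
  hk_eq2 : weak_transport lam lam' (fun z => - mu z) (fun z => - mu' z) L2
    (fun z w => - b z * L1 z w + mu' z * L2 z w);
  hk_bc1 : forall w, -1 <= w <= 1 -> L1 (- w) w = 0;
  hk_bc2 : forall w, -1 <= w <= 1 -> L2 w w = b w / (lam w + mu w) }.

Section AdjointTest.
Context {R : realType}.
Variables (lam lam' mu mu' b c : R -> R) (L1 L2 : R -> R -> R).
Hypothesis hk : half_kernel lam lam' mu mu' b c L1 L2.

(** An intertwining relation: the adjoint of the coupled generator, applied to the transformed test
    pair, is the transform of [g], the adjoint of the decoupled generator applied to [chi]. The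
    defect is the trace at [w = -1], which the feedback cancels. *)
Lemma adjoint_test (chi chi' : R -> R) :
  has_deriv chi chi' -> continuous chi' -> chi 1 = 0 ->
  let g w := lam' w * chi w + lam w * chi' w in
  exists f1 f1' f2 f2',
    [/\ has_deriv f1 f1', continuous f1', has_deriv f2 f2' & continuous f2'] /\
    [/\ f1 1 = 0, f1 (-1) = chi (-1), f2 1 = 0 & f2 (-1) = 0] /\
    forall z, -1 <= z <= 1 ->
    [/\ f1 z = chi z - adj L1 chi z, f2 z = - adj L2 chi z,
      lam' z * f1 z + lam z * f1' z + c z * f2 z =
        g z - adj L1 g z + lam (-1) * L1 z (-1) * chi (-1) &
      b z * f1 z - (mu' z * f2 z + mu z * f2' z) =
        - adj L2 g z + lam (-1) * L2 z (-1) * chi (-1)].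
Proof.
move=> dchi cchi' chi1 g.
have [dlam clam' dmu cmu' lam0 mu0 sym cb cc cL1 cL2 eq1 eq2 bc1 bc2] := hk.
have clam := is_derive_continuous dlam.
have cmu := is_derive_continuous dmu.
have cchi := is_derive_continuous dchi.
have cg : continuous g by rewrite /g; cont.
have lamn0 x : lam x != 0 by rewrite gt_eqF.
have mun0 x : mu x != 0 by rewrite gt_eqF.
have cF1 : continuous (fun q : R * R => - lam' q.1 * L1 q.1 q.2 - c q.1 * L2 q.1 q.2).
  by cont.
have cF2 : continuous (fun q : R * R => - b q.1 * L1 q.1 q.2 + mu' q.1 * L2 q.1 q.2).
  by cont.
(* With [p = lam] the diagonal factor [lam z - p z] is zero, and [hk_bc1] removes the antidiagonal
   trace. *)
have [|P1 [P1' [dP1 cP1' P1'E P1E]]] := adj_derivative dlam clam' clam clam'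
    dchi cchi' chi1 cL1 cF1 eq1 (@cont_cst _ _ 0).
  move=> z z11; have zN : -1 <= - z <= 1 by lra.
  by have := bc1 _ zN; rewrite opprK => ->; ring.
have cmuN : continuous (fun z => - mu z) by cont.
have cmuN' : continuous (fun z => - mu' z) by cont.
have cbchi : continuous (fun z => b z * chi z) by cont.
(* With [p = - mu] the diagonal factor [lam z + mu z] cancels the denominator of [hk_bc2] and leaves
   [b z * chi z]; the antidiagonal factor [lam (- z) - mu z] is zero by symmetry. *)
have [|P2 [P2' [dP2 cP2' P2'E P2E]]] := adj_derivative dlam clam' cmuN cmuN'
    dchi cchi' chi1 cL2 cF2 eq2 cbchi.
  move=> z z11; have zN : -1 <= - z <= 1 by lra.
  have := sym _ zN; rewrite opprK => ->.
  rewrite bc2//; have := mu0 z; have := lam0 z => *; field.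
  by rewrite gt_eqF// addr_gt0.
pose f1 z := chi z - P1 z / lam z; pose f2 z := P2 z / mu z.
pose f1' z := chi' z - (P1' z / lam z + P1 z * (- lam' z * (lam z)^-1 ^+ 2)).
pose f2' z := P2' z / mu z + P2 z * (- mu' z * (mu z)^-1 ^+ 2).
have f1E z : -1 <= z <= 1 -> f1 z = chi z - adj L1 chi z.
  by move=> z11; rewrite /f1 P1E// mulrC mulKf.
have f2E z : -1 <= z <= 1 -> f2 z = - adj L2 chi z.
  by move=> z11; rewrite /f2 P2E// mulNr mulNr mulrC mulKf.
have one11 : -1 <= (1 : R) <= 1 by lra.
have mone11 : -1 <= (-1 : R) <= 1 by lra.
have cP1 := is_derive_continuous dP1.
have cP2 := is_derive_continuous dP2.
have clamV := cont_inv clam lamn0; have cmuV := cont_inv cmu mun0.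
exists f1, f1', f2, f2'; split; [split|split; [split|]].
- exact: has_derivB dchi (has_derivM dP1 (has_derivV lamn0 dlam)).
- by rewrite /f1'; cont.
- exact: has_derivM dP2 (has_derivV mun0 dmu).
- by rewrite /f2'; cont.
- by rewrite f1E// adj_edge ?chi1 ?subr0// normr1.
- by rewrite f1E// adj_edge ?subr0// normrN1.
- by rewrite f2E// adj_edge ?oppr0// normr1.
- by rewrite f2E// adj_edge ?oppr0// normrN1.
have ci (L : R -> R -> R) h z : continuous (fun q : R * R => L q.1 q.2) ->
    continuous h -> continuous (fun w => L z w * h w - L z (- w) * h (- w)).
  by move=> cL ch; cont.
have ci1 z := ci _ _ z cL1 cg; have ci2 z := ci _ _ z cL2 cchi.
have ci3 z := ci _ _ z cL2 cg; have ci4 z := ci _ _ z cL1 cchi.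
move=> z z11; rewrite f1E// f2E//; split=> //.
  have -> : lam' z * (chi z - adj L1 chi z) + lam z * f1' z = g z - P1' z.
    by rewrite -f1E// /f1 /f1' /g; field.
  rewrite P1'E -!/(g _).
  have -> : (fun w => (- lam' z * L1 z w - c z * L2 z w) * chi w
        + L1 z w * chi w * lam' z + L1 z w * g w
      - ((- lam' z * L1 z (- w) - c z * L2 z (- w)) * chi (- w)
        + L1 z (- w) * chi (- w) * lam' z + L1 z (- w) * g (- w))) =
      (fun w => (L1 z w * g w - L1 z (- w) * g (- w))
        - c z * (L2 z w * chi w - L2 z (- w) * chi (- w))).
    by apply/funext => w; ring.
  have cA2 : continuous (fun w => c z * (L2 z w * chi w - L2 z (- w) * chi (- w))).
    by cont.
  by rewrite (ointB _ _ (ci1 z) cA2) (ointZ _ _ _ (ci2 z)) /adj; ring.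
have -> : mu' z * - adj L2 chi z + mu z * f2' z = P2' z.
  by rewrite -f2E// /f2 /f2'; field.
rewrite P2'E -!/(g _).
have -> : (fun w => (- b z * L1 z w + mu' z * L2 z w) * chi w
      + L2 z w * chi w * - mu' z + L2 z w * g w
    - ((- b z * L1 z (- w) + mu' z * L2 z (- w)) * chi (- w)
      + L2 z (- w) * chi (- w) * - mu' z + L2 z (- w) * g (- w))) =
    (fun w => (L2 z w * g w - L2 z (- w) * g (- w))
      - b z * (L1 z w * chi w - L1 z (- w) * chi (- w))).
  by apply/funext => w; ring.
have cA1 : continuous (fun w => b z * (L1 z w * chi w - L1 z (- w) * chi (- w))).
  by cont.
by rewrite (ointB _ _ (ci3 z) cA1) (ointZ _ _ _ (ci4 z)) /adj; ring.
Qed.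

End AdjointTest.

(** * Evolution of the target state *)

(** Norm-continuous paths in the dual of C([-1,1]). The moments of [u] and [v], their reflections
    and the target all have this form, the target even before it is known to come from a
    function. *)
Record bounded_functional {R : realType} (M : R -> (R -> R) -> R) : Prop :=
  BoundedFunctional {
  bf_add : forall t (h k : R -> R), 0 <= t -> continuous h -> continuous k ->
    M t (fun w => h w + k w) = M t h + M t k;
  bf_scale : forall t (k : R) (h : R -> R), 0 <= t -> continuous h ->
    M t (fun w => k * h w) = k * M t h;
  bf_bound : forall t, 0 <= t -> exists N : R, forall (h : R -> R) (B : R), continuous h ->
    (forall w, -1 <= w <= 1 -> `|h w| <= B) -> `|M t h| <= N * B;
  bf_close : forall t0 (e : R), 0 <= t0 -> 0 < e -> exists2 d : R, 0 < d &
    forall t, 0 <= t -> `|t - t0| < d -> forall (h : R -> R) (B : R), continuous h ->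
    (forall w, -1 <= w <= 1 -> `|h w| <= B) -> `|M t h - M t0 h| <= e * B }.

Section BoundedFunctional.
Context {R : realType}.
Variable M : R -> (R -> R) -> R.
Hypothesis bM : bounded_functional M.

Lemma bf_opp t (h : R -> R) : 0 <= t -> continuous h -> M t (fun w => - h w) = - M t h.
Proof.
move=> t0 ch; rewrite -mulN1r -(bf_scale bM)//; congr (M t _).
by apply/funext => w; rewrite mulN1r.
Qed.

Lemma bf_sub t (h k : R -> R) : 0 <= t -> continuous h -> continuous k ->
  M t (fun w => h w - k w) = M t h - M t k.
Proof. by move=> t0 ch ck; rewrite (bf_add bM) ?bf_opp//; cont. Qed.

(** The bound [B = 0] for the difference gives [N * 0], whatever [N] is. *)
Lemma bf_eq t (h k : R -> R) : 0 <= t -> continuous h -> continuous k ->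
  (forall w, -1 <= w <= 1 -> h w = k w) -> M t h = M t k.
Proof.
move=> t0 ch ck hk; have [N HN] := bf_bound bM t0.
have := HN (fun w => h w - k w) 0; rewrite mulr0 bf_sub// normr_le0 subr_eq0.
move=> H; apply/eqP/H; first by cont.
by move=> w /hk ->; rewrite subrr normr0.
Qed.

(** Freezing the state at time 0 for negative [t] gives a function continuous on the whole line, as
    [oint] and the du Bois-Reymond lemma require. *)
Lemma bf_continuous (h : R -> R) (B : R) : continuous h ->
  (forall w, -1 <= w <= 1 -> `|h w| <= B) ->
  continuous (fun t : R => M (Num.max 0 t) h).
Proof.
move=> ch hB t0; apply/continuous_epsP => e e0.
have B0 : 0 <= B.
  by apply: le_trans (hB 0 _) => //; lra.
have eB : 0 < e / (B + 1) by rewrite divr_gt0// ltr_wpDl.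
have m0 t : 0 <= Num.max 0 t :> R by rewrite le_max lexx.
have [d d0 dP] := bf_close bM (m0 t0) eB.
exists d => // t td; apply: le_trans (dP _ (m0 t) _ h B ch hB) _.
  apply: le_lt_trans td; rewrite !maxEle.
  by repeat case: ifPn; rewrite -?ltNge => *; rewrite ler_norml;
    have [?|?] := leP 0 (t - t0);
    (rewrite (ger0_norm (x := t - t0))//; lra) ||
    (rewrite (ltr0_norm (x := t - t0))//; lra).
by rewrite mulrAC ler_pdivrMr ?ltr_wpDl// ler_wpM2l ?(ltW e0)// lerDl.
Qed.

End BoundedFunctional.

(** * Bounds on compact sets and the squared positive part *)

Section Bounds.
Context {R : realType}.

Lemma bounded_on_square (L : R -> R -> R) : continuous (fun q : R * R => L q.1 q.2) ->
  exists2 B : R, 0 < B &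
    forall z w, -1 <= z <= 1 -> -1 <= w <= 1 -> `|L z w| <= B.
Proof.
move=> cL.
have cpt := compact_setX (@segment_compact R (-1) 1) (@segment_compact R (-1) 1).
have := continuous_compact (continuous_subspaceT cL) cpt.
move=> /compact_bounded[N [_ HN]].
exists (`|N| + 1); first by rewrite ltr_wpDl.
move=> z w z1 w1; apply: (HN (`|N| + 1)).
  by apply: le_lt_trans (ler_norm _) _; rewrite ltrDl.
by exists (z, w) => //; split => /=; rewrite in_itv.
Qed.

Lemma bounded_on_itv (h : R -> R) : continuous h ->
  exists2 B : R, 0 < B & forall w, -1 <= w <= 1 -> `|h w| <= B.
Proof.
move=> ch; have [|B B0 BP] := @bounded_on_square (fun z _ => h z); first by cont.
by exists B => // w w1; apply: (BP w w).
Qed.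

Lemma adj_bound (L : R -> R -> R) : continuous (fun q : R * R => L q.1 q.2) ->
  exists2 N : R, 0 < N & forall (g : R -> R) (B : R), continuous g ->
    (forall w, -1 <= w <= 1 -> `|g w| <= B) ->
    forall z, -1 <= z <= 1 -> `|adj L g z| <= N * B.
Proof.
move=> cL; have [N N0 NP] := bounded_on_square cL.
exists (N * 2); first by rewrite mulr_gt0.
move=> g B cg gB z z1.
have nz : `|z| <= 1 by rewrite ler_norml.
have B0 : 0 <= B by apply: le_trans (gB 0 _) => //; lra.
apply: le_trans (oint_bound (B := N * 2 * B) _ nz _) _; first by cont.
  move=> w /andP[w0 w1]; have {}w0 : 0 <= w by apply: le_trans w0.
  apply: le_trans (ler_normB _ _) _; rewrite !normrM.
  have w11 : -1 <= w <= 1 by lra.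
  have wN11 : -1 <= - w <= 1 by lra.
  have := ler_pM (normr_ge0 _) (normr_ge0 _) (NP z w z1 w11) (gB w w11).
  have := ler_pM (normr_ge0 _) (normr_ge0 _) (NP z _ z1 wN11) (gB _ wN11).
  lra.
have := normr_ge0 z; have : 0 <= N * 2 * B by rewrite !mulr_ge0// ltW.
by nra.
Qed.

(** The squared positive part is convex with second derivative at most 2. The split into positive
    and negative parts, whose product is zero, makes both inequalities polynomial. *)
Lemma pos2_taylor (x y : R) :
  0 <= Num.max 0 y ^+ 2 - Num.max 0 x ^+ 2 - (y - x) * (2 * Num.max 0 x)
    <= (y - x) ^+ 2.
Proof.
have posE (z : R) : exists p m, [/\ Num.max 0 z = p, z = p - m, p * m = 0, 0 <= p & 0 <= m].
  have [z0|/ltW z0] := leP 0 z.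
    by exists z, 0; rewrite subr0 mulr0 lexx.
  by exists 0, (- z); rewrite sub0r opprK mul0r lexx oppr_ge0.
have [p [m [-> -> pm p0 m0]]] := posE x.
have [q [n [-> -> qn q0 n0]]] := posE y.
have pn : 0 <= p * n by rewrite mulr_ge0.
have qm : 0 <= q * m by rewrite mulr_ge0.
have := sqr_ge0 (q - p); have := sqr_ge0 (n - m).
move: pm qn; set a := p * m; set b := q * n => a0 b0.
move=> *; apply/andP; split.
  have -> : q ^+ 2 - p ^+ 2 - (q - n - (p - m)) * (2 * p) =
    (q - p) ^+ 2 + 2 * (p * n) - 2 * a by rewrite /a; ring.
  lra.
have -> : q ^+ 2 - p ^+ 2 - (q - n - (p - m)) * (2 * p) =
  (q - n - (p - m)) ^+ 2 - (n - m) ^+ 2 - 2 * (q * m) + 2 * b by rewrite /b; ring.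
lra.
Qed.

Lemma has_deriv_pos2 : has_deriv (fun x : R => Num.max 0 x ^+ 2)
  (fun x => 2 * Num.max 0 x).
Proof.
move=> x; apply/is_derive_epsP => e e0; exists e => // y yx.
apply: (@le_trans _ _ (`|y - x| * `|y - x|)); last by rewrite ler_wpM2r// ltW.
have /andP[? ?] := pos2_taylor x y.
by rewrite -normrM -expr2 (ger0_norm (sqr_ge0 _)) ger0_norm.
Qed.

End Bounds.

(** * Transport of the target functional along characteristics *)

Section Transport.
Context {R : realType}.
Variables (lam lam' mu mu' b c : R -> R) (L1 L2 : R -> R -> R).
Hypothesis hk : half_kernel lam lam' mu mu' b c L1 L2.
Variables (Mu Mv : R -> (R -> R) -> R).
Hypotheses (bMu : bounded_functional Mu) (bMv : bounded_functional Mv).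

(** The closed loop tested on [f1 w * h t] and [f2 w * h t], with [U1] already replaced by its
    feedback law. The condition [f2 1 = 0] is what keeps [U2] out. *)
Definition half_evolution : Prop := forall T h h' f1 f1' f2 f2', 0 < T ->
  test_fun 0 T h h' ->
  has_deriv f1 f1' -> continuous f1' -> has_deriv f2 f2' -> continuous f2' ->
  f1 1 = 0 -> f2 1 = 0 -> f2 (-1) = 0 ->
  oint (fun t : R => (Mu (Num.max 0 t) f1 + Mv (Num.max 0 t) f2) * h' t +
    (Mu (Num.max 0 t) (fun w => lam' w * f1 w + lam w * f1' w + c w * f2 w) +
     Mv (Num.max 0 t) (fun w => b w * f1 w - (mu' w * f2 w + mu w * f2' w)) -
     lam (-1) * f1 (-1) * (Mu (Num.max 0 t) (fun z => L1 z (-1)) +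
                           Mv (Num.max 0 t) (fun z => L2 z (-1)))) * h t) 0 T = 0.

Hypothesis ev : half_evolution.

(** The moment of alpha against [g], written by duality so that alpha itself need not be formed
    yet. *)
Definition target t (g : R -> R) : R :=
  Mu t (fun w => g w - adj L1 g w) + Mv t (fun w => - adj L2 g w).

Let cL1 := hk_L1 hk.
Let cL2 := hk_L2 hk.

Let adjD (L : R -> R -> R) (g k : R -> R) : continuous (fun q : R * R => L q.1 q.2) ->
  continuous g -> continuous k ->
  adj L (fun w => g w + k w) = (fun z => adj L g z + adj L k z).
Proof.
move=> cL cg ck; apply/funext => z; rewrite /adj -ointD; [|cont|cont].
by congr (oint _ _ _); apply/funext => w; ring.
Qed.

Let adjZ (L : R -> R -> R) s (g : R -> R) : continuous (fun q : R * R => L q.1 q.2) ->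
  continuous g -> adj L (fun w => s * g w) = (fun z => s * adj L g z).
Proof.
move=> cL cg; apply/funext => z; rewrite /adj -ointZ; [|cont].
by congr (oint _ _ _); apply/funext => w; ring.
Qed.

Lemma target_functional : bounded_functional target.
Proof.
have [N1 N10 P1] := adj_bound cL1; have [N2 N20 P2] := adj_bound cL2.
have c1 g : continuous g -> continuous (adj L1 g) by exact: cont_adj.
have c2 g : continuous g -> continuous (adj L2 g) by exact: cont_adj.
have B1 (g : R -> R) (B : R) : continuous g -> (forall w, -1 <= w <= 1 -> `|g w| <= B) ->
    forall w, -1 <= w <= 1 -> `|g w - adj L1 g w| <= (1 + N1) * B.
  move=> cg gB w w1; apply: le_trans (ler_normB _ _) _.
  by have := gB w w1; have := P1 g B cg gB w w1; lra.
have B2 (g : R -> R) (B : R) : continuous g -> (forall w, -1 <= w <= 1 -> `|g w| <= B) ->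
    forall w, -1 <= w <= 1 -> `|- adj L2 g w| <= N2 * B.
  by move=> cg gB w w1; rewrite normrN; exact: P2.
split.
- move=> t h k t0 ch ck; rewrite /target (adjD cL1)// (adjD cL2)//.
  have := c1 _ ch; have := c1 _ ck; have := c2 _ ch; have := c2 _ ck => ? ? ? ?.
  rewrite [RHS]addrACA -(bf_add bMu)//; [|by cont..].
  rewrite -(bf_add bMv)//; [|by cont..].
  by congr (Mu t _ + Mv t _); apply/funext => w; ring.
- move=> t k h t0 ch; rewrite /target (adjZ _ cL1)// (adjZ _ cL2)//.
  have := c1 _ ch; have := c2 _ ch => ? ?.
  rewrite mulrDr -(bf_scale bMu)//; [|by cont..].
  rewrite -(bf_scale bMv)//; [|by cont..].
  by congr (Mu t _ + Mv t _); apply/funext => w; ring.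
- move=> t t0; have [K1 HK1] := bf_bound bMu t0; have [K2 HK2] := bf_bound bMv t0.
  exists (K1 * (1 + N1) + K2 * N2) => h B ch hB.
  have := c1 _ ch; have := c2 _ ch => ? ?.
  apply: le_trans (ler_normD _ _) _; rewrite mulrDl -!mulrA.
  by apply: lerD; [apply: HK1|apply: HK2]; auto; cont.
move=> t0 e t00 e0.
have E1 : 0 < e / 2 / (1 + N1) by rewrite !divr_gt0// addr_gt0.
have E2 : 0 < e / 2 / N2 by rewrite !divr_gt0.
have [d1 d10 D1] := bf_close bMu t00 E1; have [d2 d20 D2] := bf_close bMv t00 E2.
exists (Num.min d1 d2); first by rewrite lt_min d10.
move=> t tt0; rewrite lt_min => /andP[td1 td2] h B ch hB.
have := c1 _ ch; have := c2 _ ch => ? ?.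
have X1 : `|Mu t (fun w => h w - adj L1 h w) - Mu t0 (fun w => h w - adj L1 h w)|
    <= e / 2 / (1 + N1) * ((1 + N1) * B) by apply: D1 => //; [cont|exact: B1].
have X2 : `|Mv t (fun w => - adj L2 h w) - Mv t0 (fun w => - adj L2 h w)|
    <= e / 2 / N2 * (N2 * B) by apply: D2 => //; [cont|exact: B2].
rewrite mulrA divfK ?gt_eqF ?addr_gt0// in X1.
rewrite mulrA divfK ?gt_eqF// in X2.
rewrite /target opprD addrACA; apply: le_trans (ler_normD _ _) _; lra.
Qed.

Let bT := target_functional.

(** The transformed test pair reduces the closed loop to a weak equation in time alone; both sides
    are continuous, so it integrates between any two times. *)
Lemma target_evolution (chi chi' : R -> R) :
  has_deriv chi chi' -> continuous chi' -> chi 1 = 0 ->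
  forall s t, 0 <= s -> 0 <= t ->
  target t chi - target s chi =
  oint (fun r : R => target (Num.max 0 r) (fun w => lam' w * chi w + lam w * chi' w)) s t.
Proof.
move=> dchi cchi' chi1 s t s0 t0.
set g := (fun w => _ + _).
have cchi := is_derive_continuous dchi.
have clam := is_derive_continuous (hk_lam hk); have clam' := hk_lam' hk.
have cmu := is_derive_continuous (hk_mu hk); have cmu' := hk_mu' hk.
have cb := hk_b hk; have cc := hk_c hk.
have cg : continuous g by rewrite /g; cont.
have [f1 [f1' [f2 [f2' [[df1 cf1' df2 cf2'] [[f11 f1m f21 f2m] fE]]]]]] :=
  adjoint_test hk dchi cchi' chi1.
have cf1 := is_derive_continuous df1; have cf2 := is_derive_continuous df2.
have m0 r : 0 <= Num.max 0 r :> R by rewrite le_max lexx.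
have T0 : 0 < s + t + 1 by lra.
have ct (h : R -> R) : continuous h -> continuous (fun r : R => target (Num.max 0 r) h).
  by move=> ch; have [B _ hB] := bounded_on_itv ch; exact: (bf_continuous bT ch hB).
have c1 := cont_adj cL1; have c2 := cont_adj cL2.
have c11 := c1 _ cg; have c12 := c1 _ cchi; have c21 := c2 _ cg; have c22 := c2 _ cchi.
have cl1 : continuous (fun z => L1 z (-1)) by cont.
have cl2 : continuous (fun z => L2 z (-1)) by cont.
have := @du_Bois_Reymond _ (fun r : R => target (Num.max 0 r) chi)
  (fun r : R => target (Num.max 0 r) g) 0 (s + t + 1) T0 (ct _ cchi) (ct _ cg).
move=> dBR; rewrite -dBR; [|move=> h h' th|lra|lra].
  by rewrite !max_r//.
rewrite -[RHS](ev T0 th df1 cf1' df2 cf2' f11 f21 f2m).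
congr (oint _ _ _); apply/funext => r; move: (Num.max 0 r) (m0 r) (h r) (h' r) => {}r r0 hr hr'.
have -> : target r chi = Mu r f1 + Mv r f2.
  rewrite /target; congr (_ + _).
    by apply: (bf_eq bMu) => //; [cont|move=> w /fE[-> _ _ _]].
  by apply: (bf_eq bMv) => //; [cont|move=> w /fE[_ -> _ _]].
congr (_ + _ * _); rewrite /target.
have -> : Mu r (fun w => lam' w * f1 w + lam w * f1' w + c w * f2 w) =
    Mu r (fun w => g w - adj L1 g w) + lam (-1) * chi (-1) * Mu r (fun z => L1 z (-1)).
  rewrite -(bf_scale bMu)// -(bf_add bMu)//; [|by cont..].
  by apply: (bf_eq bMu) => //; [cont|cont|move=> w /fE[_ _ -> _]; rewrite /g; ring].
have -> : Mv r (fun w => b w * f1 w - (mu' w * f2 w + mu w * f2' w)) =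
    Mv r (fun w => - adj L2 g w) + lam (-1) * chi (-1) * Mv r (fun z => L2 z (-1)).
  rewrite -(bf_scale bMv)// -(bf_add bMv)//; [|by cont..].
  by apply: (bf_eq bMv) => //; [cont|cont|move=> w /fE[_ _ _ ->]; rewrite /g; ring].
by rewrite f1m; ring.
Qed.

Definition travel w : R := oint (fun x => (lam x)^-1) (-1) w.

(** [lam * profile a] depends on [w] only through [a - travel w], and [travel] has derivative
    [1 / lam]. Hence [(lam * profile a)'] is minus the derivative of [profile a] in [a]: transport
    becomes translation of [a]. *)
Definition profile a w : R := Num.max 0 (a - travel w) ^+ 2 * (lam w)^-1.

Let lamn0 x : lam x != 0. Proof. by rewrite gt_eqF// (hk_lam_gt0 hk). Qed.

Let clamV : continuous (fun x => (lam x)^-1).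
Proof. exact: cont_inv (is_derive_continuous (hk_lam hk)) lamn0. Qed.

Lemma has_deriv_travel : has_deriv travel (fun x => (lam x)^-1).
Proof.
apply: has_deriv_eq (has_derivB (is_derive_prim clamV) (has_deriv_cst _)) _ => x.
by rewrite /= subr0.
Qed.

Lemma travel_incr x y : x < y -> travel x < travel y.
Proof.
move=> xy; rewrite -subr_gt0.
have -> : travel y - travel x = oint (fun x => (lam x)^-1) x y by rewrite /travel /oint; ring.
have ge0 z : 0 <= (lam z)^-1 by rewrite invr_ge0 ltW// (hk_lam_gt0 hk).
rewrite lt_neqAle -{2}(RintegralE clamV (ltW xy)) Rintegral_ge0// andbT.
apply/eqP => /esym /(oint_eq0 clamV (ltW xy) (fun z _ => ge0 z))/(_ ((x + y) / 2)) E.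
by have := lamn0 ((x + y) / 2); rewrite -invr_eq0 E ?eqxx//; lra.
Qed.

Lemma travel0 : travel (-1) = 0. Proof. exact: ointxx. Qed.

Lemma cont_profile a : continuous (profile a).
Proof. by have := is_derive_continuous has_deriv_travel; rewrite /profile => ?; cont. Qed.

Lemma profile_deriv a : exists p', [/\ has_deriv (profile a) p', continuous p' &
  forall w, lam' w * profile a w + lam w * p' w =
    - (2 * Num.max 0 (a - travel w) * (lam w)^-1)].
Proof.
have ct := is_derive_continuous has_deriv_travel.
have clam' := hk_lam' hk.
have d1 := has_deriv_comp has_deriv_pos2 (has_derivB (has_deriv_cst a) has_deriv_travel).
have d2 := has_derivM d1 (has_derivV lamn0 (hk_lam hk)).
eexists; split; [exact: d2|cbv beta; cont|].
move=> w; cbv beta; rewrite /profile.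
by have := lamn0 w => l0; field.
Qed.

Lemma target_profile_eq0 t a : travel 1 <= t -> a <= travel 1 -> target t (profile a) = 0.
Proof.
move=> t1 a1; have tr1 : 0 < travel 1 by rewrite -travel0; apply: travel_incr; lra.
have t0 : 0 < t by apply: lt_le_trans t1.
have ctr := is_derive_continuous has_deriv_travel.
have [Lam Lam0 LamP] := bounded_on_itv clamV.
pose a0 := a - t.
have a00 : a0 <= 0 by rewrite /a0; lra.
(* The derivative of the profile in its level, at level [a0 + r]. *)
pose D r w := 2 * Num.max 0 (a0 + r - travel w) * (lam w)^-1.
have cD r : continuous (D r) by rewrite /D; cont.
have tr_ge0 w : -1 <= w <= 1 -> 0 <= travel w.
  case/andP; rewrite le_eqVlt => /predU1P[<- _|w1 _]; first by rewrite travel0.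
  by rewrite -travel0 ltW// travel_incr.
have := @cst_on_itv R (fun r => target r (profile (a0 + r))) 0 t (ltW t0) _ t.
rewrite (ltW t0) lexx addr0 [a0 + t]subrK => ->//.
  rewrite (@bf_eq _ _ bT _ _ (fun w => 0 * profile a0 w))//.
  - by rewrite (bf_scale bT) ?mul0r//; exact: cont_profile.
  - exact: cont_profile.
  - by have := @cont_profile a0 => ?; cont.
  move=> w w1; rewrite mul0r /profile max_l ?expr0n ?mul0r//.
  by have := tr_ge0 w w1; lra.
move=> r e /andP[r0 rt] e0.
pose cr := a0 + r.
have ccr := @cont_profile cr.
have [p' [dp cp' pE]] := profile_deriv cr.
(* [r <= t] keeps the level [cr] at most [a <= travel 1], so the profile is still an admissible test
   function at [w = 1]. *)
have cr1 : profile cr 1 = 0.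
  by rewrite /profile max_l ?expr0n ?mul0r// /cr /a0; lra.
have ev1 := target_evolution dp cp' cr1 r0.
pose G s := target (Num.max 0 s) (fun w => lam' w * profile cr w + lam w * p' w).
have GE : (fun w => lam' w * profile cr w + lam w * p' w) = (fun w => - D r w).
  by apply/funext => w; rewrite pE.
have cDN : continuous (fun w => - D r w) by have := cD r => ?; cont.
have cG : continuous G.
  have [B _ hB] := bounded_on_itv cDN.
  by rewrite /G GE; exact: (bf_continuous bT cDN hB).
have Gr : G r = - target r (D r) by rewrite /G GE max_r// (bf_opp bT).
have e30 : 0 < e / 3 by rewrite divr_gt0.
have /is_derive_epsP/(_ _ e30)[d1 d10 P1] := is_derive_prim cG r.
have [BD BD0 BDP] := bounded_on_itv (cD r).
have e3B : 0 < e / 3 / BD by rewrite divr_gt0.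
have [d2 d20 P2] := bf_close bT r0 e3B.
have [d3 d30 P3] := bf_close bT r0 ltr01.
have [N HN] := bf_bound bT r0.
pose K := (`|N| + 1) * Lam.
have K0 : 0 < K by rewrite mulr_gt0// ltr_wpDl.
have d40 : 0 < e / 3 / K by rewrite divr_gt0.
exists (Num.min (Num.min d1 d2) (Num.min d3 (e / 3 / K))).
  by rewrite !lt_min d10 d20 d30.
move=> s /andP[s0 st]; rewrite !lt_min => /andP[/andP[sd1 sd2] /andP[sd3 sd4]].
(* The increment has three parts, each given [e / 3]: this Taylor remainder, quadratic in [s - r];
   the change of the functional on the fixed [D r]; the remainder of the evolution at a frozen
   level. Their first-order terms cancel. *)
pose W w := profile (a0 + s) w - profile cr w - (s - r) * D r w.
have cW : continuous W.
  by have := @cont_profile (a0 + s); have := cD r => ? ?; rewrite /W; cont.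
have WB w : -1 <= w <= 1 -> `|W w| <= `|s - r| * `|s - r| * Lam.
  move=> /LamP lw; rewrite -normrM -expr2 (ger0_norm (sqr_ge0 _)).
  have -> : W w = (Num.max 0 (a0 + s - travel w) ^+ 2
      - Num.max 0 (cr - travel w) ^+ 2
      - (s - r) * (2 * Num.max 0 (cr - travel w))) * (lam w)^-1.
    by rewrite /W /profile /D /cr; ring.
  have := pos2_taylor (cr - travel w) (a0 + s - travel w).
  have -> : a0 + s - travel w - (cr - travel w) = s - r by rewrite /cr; ring.
  move=> /andP[T0 T1]; rewrite normrM; apply: ler_pM => //.
  by rewrite ger0_norm.
have X1 : `|target s W| <= e / 3 * `|s - r|.
  have A1 := P3 s s0 sd3 W _ cW WB.
  have A2 := HN W _ cW WB.
  have A3 : `|target s W| <= (`|N| + 1) * (`|s - r| * `|s - r| * Lam).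
    rewrite -[target s W](subrK (target r W)); apply: le_trans (ler_normD _ _) _.
    apply: le_trans (lerD A1 A2) _; rewrite mulrDl addrC; apply: lerD => //.
    by rewrite ler_wpM2r ?ler_norm// !mulr_ge0// ltW.
  apply: le_trans A3 _.
  have -> : (`|N| + 1) * (`|s - r| * `|s - r| * Lam) = (`|s - r| * K) * `|s - r|.
    by rewrite /K; ring.
  by rewrite ler_wpM2r// -ler_pdivlMr// ltW.
have X2 : `|(s - r) * (target s (D r) - target r (D r))| <= e / 3 * `|s - r|.
  rewrite normrM mulrC ler_wpM2r//.
  by have := P2 s s0 sd2 (D r) BD (cD r) BDP; rewrite divfK// gt_eqF.
have X3 := P1 s sd1; rewrite Gr in X3.
have tW : target s W = target s (profile (a0 + s)) - target s (profile cr)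
    - (s - r) * target s (D r).
  have c1 := @cont_profile (a0 + s).
  have c2 : continuous (fun w => profile (a0 + s) w - profile cr w) by cont.
  have c3 : continuous (fun w => (s - r) * D r w) by have := cD r => ?; cont.
  by rewrite /W (bf_sub bT s0 c2 c3) (bf_sub bT s0 c1 ccr) (bf_scale bT).
have E3 := ev1 s s0; rewrite -/(G _) /oint in E3.
have -> : target s (profile (a0 + s)) - target r (profile (a0 + r)) =
   target s W + (s - r) * (target s (D r) - target r (D r)) +
   (prim G s - prim G r - (s - r) * - target r (D r)).
  have alg (x1 x2 x3 y1 y2 q : R) : x1 - x3 =
      (x1 - x2 - q * y1) + q * (y1 - y2) + ((x2 - x3) - q * - y2) by ring.
  by rewrite tW -E3; exact: alg.
apply: le_trans (ler_normD _ _) _; apply: le_trans (lerD (ler_normD _ _) (lexx _)) _.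
have -> : e * `|s - r| =
  e / 3 * `|s - r| + e / 3 * `|s - r| + e / 3 * `|s - r| by field.
exact: lerD (lerD X1 X2) X3.
Qed.

End Transport.

(** * Moments of integrable functions on [-1,1] *)

Section Moments.
Context {R : realType}.
Notation leb := (@lebesgue_measure R).
Implicit Types (f h : R -> R).

Definition L1_I f : Prop := leb.-integrable I11 (EFin \o f).

Lemma measurable_I11 : measurable (@I11 R : set (measurableTypeR R)).
Proof. by rewrite I11E; exact: measurable_itv. Qed.

Let mI := measurable_I11.

Lemma L1_measurable f : L1_I f -> measurable_fun I11 f.
Proof. by move=> /integrableP[/measurable_EFinP]. Qed.

Lemma L1_continuous h : continuous h -> L1_I h.
Proof. by move=> ch; rewrite /L1_I I11E; exact: continuous_integrable. Qed.

Lemma le_L1 f h : measurable_fun I11 f -> L1_I h ->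
  (forall w, I11 w -> `|f w| <= `|h w|) -> L1_I f.
Proof.
move=> mf ih fh; have mf' : measurable_fun (I11 : set (measurableTypeR R)) (EFin \o f).
  exact/measurable_EFinP.
apply: (le_integrable mI mf' _ ih).
by move=> w Iw /=; rewrite lee_fin; exact: fh.
Qed.

Lemma L1D f h : L1_I f -> L1_I h -> L1_I (fun w => f w + h w).
Proof. by move=> if1 ih; exact: (integrableD mI if1 ih). Qed.

Lemma L1Z (k : R) f : L1_I f -> L1_I (fun w => k * f w).
Proof. by move=> if1; exact: (integrableZl mI k if1). Qed.

Lemma L1B f h : L1_I f -> L1_I h -> L1_I (fun w => f w - h w).
Proof.
move=> if1 ih; have := L1D if1 (L1Z (-1) ih); congr (_.-integrable _ _).
by apply/funext => w /=; rewrite mulN1r.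
Qed.

Lemma L1_abs f : L1_I f -> L1_I (fun w => `|f w|).
Proof. by move=> if1; exact: (integrable_abse if1). Qed.

Lemma L1_bounded_mul f h (B : R) : L1_I f -> measurable_fun I11 h ->
  (forall w, I11 w -> `|h w| <= B) -> L1_I (fun w => f w * h w).
Proof.
move=> if1 mh hB; apply: (@le_L1 _ (fun w => B * f w)).
- by apply: measurable_funM => //; exact: L1_measurable.
- exact: L1Z.
move=> w Iw; rewrite !normrM mulrC ler_wpM2r//.
by apply: le_trans (ler_norm B); exact: hB.
Qed.

Lemma L1_mul f h : L1_I f -> continuous h -> L1_I (fun w => f w * h w).
Proof.
move=> if1 ch; have [B _ hB] := bounded_on_itv ch.
by apply: (@L1_bounded_mul _ _ B) => //; exact: L1_measurable (L1_continuous ch).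
Qed.

Lemma L1_of_L2 f : L2_I f -> L1_I f.
Proof.
move=> [mf if2]; apply: (@le_L1 _ (fun w => 1 + f w ^+ 2)) => //.
  by apply: L1D => //; apply: L1_continuous; cont.
move=> w _; have f2 := sqr_ge0 (f w).
rewrite [leRHS]ger0_norm; last by lra.
by rewrite ler_norml; have := sqr_ge0 (f w - 1); have := sqr_ge0 (f w + 1); nra.
Qed.

Lemma L2_subr_sqr f h : L2_I f -> L2_I h -> L1_I (fun w => (f w - h w) ^+ 2).
Proof.
move=> [mf if2] [mh ih2].
apply: (@le_L1 _ (fun w => 2 * f w ^+ 2 + 2 * h w ^+ 2)).
- by apply: measurable_funX; exact: measurable_funB.
- by apply: L1D; apply: L1Z.
move=> w _; rewrite ger0_norm ?sqr_ge0// ger0_norm; last first.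
  by rewrite addr_ge0// mulr_ge0// sqr_ge0.
by have := sqr_ge0 (f w + h w); nra.
Qed.

Definition moment f h : R := Rintegral leb I11 (fun w => f w * h w).

Lemma momentD f h k : L1_I f -> continuous h -> continuous k ->
  moment f (fun w => h w + k w) = moment f h + moment f k.
Proof.
move=> if1 ch ck; rewrite /moment -RintegralD//; [|exact: L1_mul..].
by apply: eq_Rintegral => w _; rewrite mulrDr.
Qed.

Lemma momentZ f (k : R) h : L1_I f -> continuous h ->
  moment f (fun w => k * h w) = k * moment f h.
Proof.
move=> if1 ch; rewrite /moment -RintegralZl//; last exact: L1_mul.
by apply: eq_Rintegral => w _; rewrite mulrCA.
Qed.

Lemma momentB f g h : L1_I f -> L1_I g -> continuous h ->
  moment f h - moment g h = moment (fun w => f w - g w) h.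
Proof.
move=> if1 ig ch; rewrite /moment -RintegralB//; [|exact: L1_mul..].
by apply: eq_Rintegral => w _; rewrite mulrBl.
Qed.

Lemma moment_bound f h (B : R) : L1_I f -> continuous h ->
  (forall w, -1 <= w <= 1 -> `|h w| <= B) ->
  `|moment f h| <= Rintegral leb I11 (fun w => `|f w|) * B.
Proof.
move=> if1 ch hB; rewrite /moment.
apply: le_trans (le_normr_Rintegral mI (L1_mul if1 ch)) _.
rewrite mulrC -RintegralZl//; last exact: L1_abs.
apply: le_Rintegral => //; first exact: (L1_abs (L1_mul if1 ch)).
  exact: (L1Z B (L1_abs if1)).
by move=> w Iw; rewrite normrM mulrC ler_wpM2r// hB.
Qed.

(** Test functions are bounded, so continuity in time with values in L^1 is enough to obtain a
    [bounded_functional]. *)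
Definition L1_path (u : R -> R -> R) : Prop :=
  (forall t, 0 <= t -> L1_I (fun w => u w t)) /\
  (forall t0 (e : R), 0 <= t0 -> 0 < e -> exists2 d : R, 0 < d &
    forall t, 0 <= t -> `|t - t0| < d ->
      Rintegral leb I11 (fun w => `|u w t - u w t0|) <= e).

Lemma L1_path_functional u : L1_path u ->
  bounded_functional (fun t h => moment (fun w => u w t) h).
Proof.
move=> [iu cu]; split.
- by move=> t h k t0 ch ck; apply: momentD => //; exact: iu.
- by move=> t k h t0 ch; apply: momentZ => //; exact: iu.
- move=> t t0; exists (Rintegral leb I11 (fun w => `|u w t|)) => h B ch hB.
  by apply: moment_bound => //; exact: iu.
move=> t0 e t00 e0; have [d d0 dP] := cu t0 e t00 e0; exists d => // t t0' td h B ch hB.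
have B0 : 0 <= B by apply: le_trans (hB 0 _) => //; lra.
rewrite momentB//; [|exact: iu..].
apply: le_trans (moment_bound _ ch hB) _; first by apply: L1B; exact: iu.
by rewrite ler_wpM2r// dP.
Qed.

Lemma bounded_functional_opp (M : R -> (R -> R) -> R) : bounded_functional M ->
  bounded_functional (fun t h => M t (fun w => h (- w))).
Proof.
move=> bM; split.
- by move=> t h k t0 ch ck; rewrite (bf_add bM)//; cont.
- by move=> t k h t0 ch; rewrite (bf_scale bM)//; cont.
- move=> t t0; have [N HN] := bf_bound bM t0; exists N => h B ch hB.
  by apply: HN; [cont|move=> w w1; apply: hB; lra].
move=> t0 e t00 e0; have [d d0 dP] := bf_close bM t00 e0; exists d => // t t0' td h B ch hB.
by apply: dP => //; [cont|move=> w w1; apply: hB; lra].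
Qed.

End Moments.

(** * Moment form of the closed loop *)

Section ClosedLoop.
Context {R : realType}.
Notation leb := (@lebesgue_measure R).
Variables (lam lam' mu mu' b c : R -> R) (L11 L12 L21 L22 u v : R -> R -> R).
Hypothesis cl : closed_loop_sol lam lam' mu mu' b c L11 L12 L21 L22 u v.

Lemma closed_loop_L1 : L1_path u /\ L1_path v.
Proof.
have [L2uv [cuv _]] := cl.
have key t0 (e : R) : 0 <= t0 -> 0 < e -> exists2 d : R, 0 < d &
    forall t, 0 <= t -> `|t - t0| < d ->
    Rintegral leb I11 (fun w => (u w t - u w t0) ^+ 2 + (v w t - v w t0) ^+ 2) <= e.
  move=> t00 e0; move/cvgrPdist_le : (cuv t0 t00) => /(_ e e0) /nbhs_ballP[d /= d0 dP].
  exists d => // t tt0 td; have := dP t; rewrite /ball /= distrC => /(_ td tt0).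
  rewrite sub0r normrN; apply: le_trans; exact: ler_norm.
have gen (f : R -> R -> R) : (forall t, 0 <= t -> L2_I (fun w => f w t)) ->
    (forall t t0 w, (f w t - f w t0) ^+ 2 <=
       (u w t - u w t0) ^+ 2 + (v w t - v w t0) ^+ 2) -> L1_path f.
  move=> L2f fuv; split=> [t t0|t0 e t00 e0]; first exact: L1_of_L2 (L2f t t0).
  (* [x <= s + x ^+ 2 / s], integrated over an interval of length 2 with the squares contributing at
     most [s * s], gives [2 * s + s = e]. *)
  pose s := e / 3; have s0 : 0 < s by rewrite divr_gt0.
  have [d d0 dP] := key t0 (s * s) t00 (mulr_gt0 s0 s0).
  exists d => // t tt0 td.
  have [[L2ut L2vt] [L2u0 L2v0]] := (L2uv t tt0, L2uv t0 t00).
  have iD := L1D (L2_subr_sqr L2ut L2u0) (L2_subr_sqr L2vt L2v0).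
  have iE : L1_I (fun w => s + s^-1 * ((u w t - u w t0) ^+ 2 + (v w t - v w t0) ^+ 2)).
    by apply: L1D; [apply: L1_continuous; cont|exact: L1Z].
  apply: (@le_trans _ _ (Rintegral leb I11
      (fun w => s + s^-1 * ((u w t - u w t0) ^+ 2 + (v w t - v w t0) ^+ 2)))).
    apply: le_Rintegral => //; first exact: measurable_I11.
      by apply: L1_abs; apply: L1B; apply: L1_of_L2; apply: L2f.
    move=> w _; apply: (@le_trans _ _ (s + s^-1 * (f w t - f w t0) ^+ 2)); last first.
      by rewrite lerD2l ler_wpM2l ?invr_ge0 ?(ltW s0).
    rewrite -(real_normK (num_real (f w t - f w t0))).
    set x := `|_|; rewrite -(ler_pM2l s0).
    have -> : s * (s + s^-1 * x ^+ 2) = s * s + x ^+ 2 by field; rewrite gt_eqF.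
    by have := sqr_ge0 (s - x); have : 0 <= x := normr_ge0 _; nra.
  have mI := @measurable_I11 R.
  have cs : L1_I (fun _ : R => s) by apply: L1_continuous; cont.
  have Es : Rintegral leb I11 (fun _ : R => s) = s * 2.
    rewrite RintegralI11; last by cont.
    rewrite (@oint_derive _ (fun x => s * x) (fun=> s)); [by ring|by cont|].
    apply: has_deriv_eq (has_derivM (has_deriv_cst _) has_deriv_id) _ => x /=.
    by rewrite mul0r add0r mulr1.
  rewrite RintegralD//; last exact: (L1Z s^-1 iD).
  rewrite (RintegralZl s^-1 mI iD) [X in X + _ <= _](_ : _ = s * 2); last exact: Es.
  have := dP t tt0 td; rewrite -(ler_pM2l (_ : 0 < s^-1)) ?invr_gt0//.
  by rewrite mulrA mulVf ?gt_eqF// mul1r /s; lra.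
split; apply: gen.
- by move=> t t0; have [] := L2uv t t0.
- by move=> t t0 w; rewrite lerDl sqr_ge0.
- by move=> t t0; have [] := L2uv t t0.
- by move=> t t0 w; rewrite lerDr sqr_ge0.
Qed.

Hypotheses (clam : continuous lam) (clam' : continuous lam').
Hypotheses (cmu : continuous mu) (cmu' : continuous mu').
Hypotheses (cb : continuous b) (cc : continuous c).
Hypotheses (cL11 : continuous (fun q : R * R => L11 q.1 q.2)).
Hypotheses (cL12 : continuous (fun q : R * R => L12 q.1 q.2)).
Hypotheses (cL21 : continuous (fun q : R * R => L21 q.1 q.2)).
Hypotheses (cL22 : continuous (fun q : R * R => L22 q.1 q.2)).

Let Mu t h := moment (fun w => u w t) h.
Let Mv t h := moment (fun w => v w t) h.

(** Test functions with separated variables, with [h 0 = 0] so that the initial data drop out. Both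
    feedback terms are kept, because each target component discards a different one. *)
Lemma closed_loop_evolution T h h' f1 f1' f2 f2' : 0 < T -> test_fun 0 T h h' ->
  has_deriv f1 f1' -> continuous f1' -> has_deriv f2 f2' -> continuous f2' ->
  f1 1 = 0 -> f2 (-1) = 0 ->
  oint (fun t => (Mu (Num.max 0 t) f1 + Mv (Num.max 0 t) f2) * h' t +
    (Mu (Num.max 0 t) (fun w => lam' w * f1 w + lam w * f1' w + c w * f2 w) +
     Mv (Num.max 0 t) (fun w => b w * f1 w - (mu' w * f2 w + mu w * f2' w)) -
     lam (-1) * f1 (-1) * (Mu (Num.max 0 t) (fun z => L11 z (-1)) +
                           Mv (Num.max 0 t) (fun z => L12 z (-1))) +
     mu 1 * f2 1 * (Mu (Num.max 0 t) (fun z => L21 z 1) +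
                    Mv (Num.max 0 t) (fun z => L22 z 1))) * h t) 0 T = 0.
Proof.
move=> T0 th df1 cf1' df2 cf2' f11 f2m.
have [pu pv] := closed_loop_L1.
have bMu : bounded_functional Mu by exact: L1_path_functional pu.
have bMv : bounded_functional Mv by exact: L1_path_functional pv.
have [iu _] := pu; have [iv _] := pv.
have [_ [_ [eq_u eq_v]]] := cl.
have [dh ch' _] := th; have ch := is_derive_continuous dh.
have cf1 := is_derive_continuous df1; have cf2 := is_derive_continuous df2.
have h00 : h 0 = 0 by have [] := test_fun_out th (or_introl (lexx 0)).
have hT t : T <= t -> h t = 0 by move=> Tt; have [] := test_fun_out th (or_intror Tt).
have C12 (f f' : R -> R) : has_deriv f f' -> continuous f' ->
    C1_2 (fun w t => f w * h t) (fun w t => f' w * h t) (fun w t => f w * h' t).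
  move=> df cf'; have cf := is_derive_continuous df.
  split; [|split; [|split; [|split]]]; [| |by cont..].
    move=> x y; have := has_derivM df (has_deriv_cst (h y)) x.
    by rewrite /= mulr0 addr0.
  move=> x y; have := has_derivM (has_deriv_cst (f x)) dh y.
  by rewrite /= mul0r add0r.
have cM (M : R -> (R -> R) -> R) (k : R -> R) : bounded_functional M -> continuous k ->
    continuous (fun t : R => M (Num.max 0 t) k).
  by move=> bM ck; have [B _ kB] := bounded_on_itv ck; exact: (bf_continuous bM ck kB).
have RI (F G : R -> R) : continuous G -> (forall t, 0 <= t -> F t = G t) ->
    Rintegral leb (I0T T) F = oint G 0 T.
  move=> cG FG; have -> : I0T T = `[0, T]%classic :> set R by rewrite set_itvcc.
  rewrite -(RintegralE cG (ltW T0)); apply: eq_Rintegral => t.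
  by rewrite inE /= in_itv /= => /andP[t0 _]; exact: FG.
have c1 : continuous (fun w => lam' w * f1 w + lam w * f1' w) by cont.
have c2 : continuous (fun w => b w * f1 w) by cont.
have c3 : continuous (fun w => mu' w * f2 w + mu w * f2' w) by cont.
have c4 : continuous (fun w => c w * f2 w) by cont.
have l1 : continuous (fun z => L11 z (-1)) by cont.
have l2 : continuous (fun z => L12 z (-1)) by cont.
have l3 : continuous (fun z => L21 z 1) by cont.
have l4 : continuous (fun z => L22 z 1) by cont.
have I1 := cM _ _ bMu cf1; have I2 := cM _ _ bMv cf2; have I3 := cM _ _ bMu c1.
have I4 := cM _ _ bMv c2; have I5 := cM _ _ bMv c3; have I6 := cM _ _ bMu c4.
have J1 := cM _ _ bMu l1; have J2 := cM _ _ bMv l2; have J3 := cM _ _ bMu l3.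
have J4 := cM _ _ bMv l4.
have mI := @measurable_I11 R.
have M2 t (P Q : R -> R) : 0 <= t -> continuous P -> continuous Q ->
    Rintegral leb I11 (fun w => u w t * P w + v w t * Q w) = Mu t P + Mv t Q.
  move=> t0 cP cQ; rewrite /Mu /Mv /moment -RintegralD//.
    exact: L1_mul (iu t t0) cP.
  exact: L1_mul (iv t t0) cQ.
pose A t := Mu (Num.max 0 t) f1 * h' t
  + (Mu (Num.max 0 t) (fun w => lam' w * f1 w + lam w * f1' w)
    + Mv (Num.max 0 t) (fun w => b w * f1 w)) * h t.
pose B t := f1 (-1) * h t * (- Mu (Num.max 0 t) (fun z => L11 z (-1))
  - Mv (Num.max 0 t) (fun z => L12 z (-1))).
pose C t := Mv (Num.max 0 t) f2 * h' t
  + (- Mv (Num.max 0 t) (fun w => mu' w * f2 w + mu w * f2' w)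
    + Mu (Num.max 0 t) (fun w => c w * f2 w)) * h t.
pose D t := f2 1 * h t * (Mu (Num.max 0 t) (fun z => L21 z 1)
  + Mv (Num.max 0 t) (fun z => L22 z 1)).
have cA : continuous A by rewrite /A; cont.
have cB : continuous B by rewrite /B; cont.
have cC : continuous C by rewrite /C; cont.
have cD : continuous D by rewrite /D; cont.
have Eu : oint A 0 T + lam (-1) * oint B 0 T = 0.
  have := eq_u _ _ _ T (C12 _ _ df1 cf1'); rewrite h00.
  have -> : (fun w => u w 0 * (f1 w * 0)) = (fun _ : R => 0 * 0).
    by apply/funext => w; rewrite !mulr0.
  rewrite RintegralI11; last by cont.
  rewrite ointZ ?mul0r ?add0r; last by cont.
  rewrite (RI _ A) ?(RI _ B)//.
  - apply=> [t|w t /hT ->]; first by rewrite f11 mul0r.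
    by rewrite mulr0.
  - by move=> t t0; rewrite /U1_fb /B max_r.
  move=> t t0; rewrite /A max_r//.
  transitivity (Rintegral leb I11 (fun w =>
    u w t * (h' t * f1 w + h t * (lam' w * f1 w + lam w * f1' w)) +
    v w t * (h t * (b w * f1 w)))).
    by apply: eq_Rintegral => w _; ring.
  rewrite M2; [|by []|by cont|by cont].
  rewrite (bf_add bMu) ?(bf_scale bMu) ?(bf_scale bMv)//; [|by cont..].
  by rewrite /Mu /Mv; ring.
have Ev : oint C 0 T + mu 1 * oint D 0 T = 0.
  have := eq_v _ _ _ T (C12 _ _ df2 cf2'); rewrite h00.
  have -> : (fun w => v w 0 * (f2 w * 0)) = (fun _ : R => 0 * 0).
    by apply/funext => w; rewrite !mulr0.
  rewrite RintegralI11; last by cont.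
  rewrite ointZ ?mul0r ?add0r; last by cont.
  rewrite (RI _ C) ?(RI _ D)//.
  - apply=> [t|w t /hT ->]; first by rewrite f2m mul0r.
    by rewrite mulr0.
  - by move=> t t0; rewrite /U2_fb /D max_r.
  move=> t t0; rewrite /C max_r//.
  transitivity (Rintegral leb I11 (fun w =>
    u w t * (h t * (c w * f2 w)) +
    v w t * (h' t * f2 w - h t * (mu' w * f2 w + mu w * f2' w)))).
    by apply: eq_Rintegral => w _; ring.
  rewrite M2; [|by []|by cont|by cont].
  rewrite (bf_sub bMv) ?(bf_scale bMv) ?(bf_scale bMu)//; [|by cont..].
  by rewrite /Mu /Mv; ring.
have -> : (fun t => (Mu (Num.max 0 t) f1 + Mv (Num.max 0 t) f2) * h' t +
    (Mu (Num.max 0 t) (fun w => lam' w * f1 w + lam w * f1' w + c w * f2 w) +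
     Mv (Num.max 0 t) (fun w => b w * f1 w - (mu' w * f2 w + mu w * f2' w)) -
     lam (-1) * f1 (-1) * (Mu (Num.max 0 t) (fun z => L11 z (-1)) +
                           Mv (Num.max 0 t) (fun z => L12 z (-1))) +
     mu 1 * f2 1 * (Mu (Num.max 0 t) (fun z => L21 z 1) +
                    Mv (Num.max 0 t) (fun z => L22 z 1))) * h t) =
   (fun t => (A t + lam (-1) * B t) + (C t + mu 1 * D t)).
  apply/funext => t; have m0 : 0 <= Num.max 0 t :> R by rewrite le_max lexx.
  rewrite (bf_add bMu m0 c1 c4) (bf_sub bMv m0 c2 c3).
  by rewrite /A /B /C /D -/(Mu _ _) -/(Mv _ _); ring.
have cB' : continuous (fun t => lam (-1) * B t) by cont.
have cD' : continuous (fun t => mu 1 * D t) by cont.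
have cAB : continuous (fun t => A t + lam (-1) * B t) by cont.
have cCD : continuous (fun t => C t + mu 1 * D t) by cont.
rewrite (ointD _ _ cAB cCD) (ointD _ _ cA cB') (ointD _ _ cC cD') !ointZ//.
by apply: etrans (f_equal2 +%R Eu Ev) _; exact: addr0.
Qed.

End ClosedLoop.

(** * The Volterra transform on integrable functions *)

Section PlaneMeasurability.
Context {R : realType}.
Notation mR := (measurableTypeR R).
Notation leb := (@lebesgue_measure R).

(** Links the topology of the plane to the product sigma-algebra: an open set is a union of boxes
    with rational centre and radius. Boxes not contained in [U] are replaced by [set0], so the union
    runs over all rationals. *)
Lemma open_measurable_prod (U : set (R * R)) : open U ->
  measurable (U : set (mR * mR)).
Proof.
move=> oU.
pose box (a b r : R) : set (mR * mR) := `]a - r, a + r[%classic `*` `]b - r, b + r[%classic.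
pose P (a b r : R) := box a b r `<=` U.
pose C (q1 q2 q3 : rat) : set (mR * mR) :=
  if `[< P (ratr q1) (ratr q2) (ratr q3) >] then box (ratr q1) (ratr q2) (ratr q3)
  else set0.
have -> : (U : set (mR * mR)) = \bigcup_q1 \bigcup_q2 \bigcup_q3 C q1 q2 q3.
  apply/seteqP; split=> [[x y] Uxy|p [q1 _ [q2 _ [q3 _]]]]; last first.
    by rewrite /C; case: asboolP => // Pq /Pq.
  have [[A1 A2] /= [/nbhs_ballP[e1 /= e10 E1] /nbhs_ballP[e2 /= e20 E2]] AU] :=
    oU _ Uxy.
  pose e := Num.min e1 e2 / 2.
  have e0 : 0 < e by rewrite divr_gt0// lt_min e10.
  have ee1 : 2 * e <= e1 by rewrite mulrC divfK// ge_min lexx.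
  have ee2 : 2 * e <= e2 by rewrite mulrC divfK// ge_min lexx orbT.
  have [q3] := rat_in_itvoo e0; rewrite in_itv /= => /andP[r0 re].
  set r : R := ratr q3 in r0 re.
  have xr : x - r < x + r by lra.
  have yr : y - r < y + r by lra.
  have [q1] := rat_in_itvoo xr; rewrite in_itv /= => /andP[x1 x2].
  have [q2] := rat_in_itvoo yr; rewrite in_itv /= => /andP[y1 y2].
  exists q1 => //; exists q2 => //; exists q3 => //; rewrite /C.
  have Pq : P (ratr q1) (ratr q2) r.
    move=> [x' y'] [/=]; rewrite !in_itv /= => /andP[? ?] /andP[? ?].
    apply: AU; split => /=; [apply: E1|apply: E2];
    by rewrite /ball /= ltr_norml; apply/andP; split; lra.
  case: asboolP => [_|/(_ Pq)//]; rewrite -/r.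
  by split => /=; rewrite in_itv /=; apply/andP; split; lra.
apply: bigcupT_measurable_rat => q1; apply: bigcupT_measurable_rat => q2.
apply: bigcupT_measurable_rat => q3; rewrite /C; case: ifPn => // _.
by apply: measurableX; exact: measurable_itv.
Qed.

Lemma continuous_measurable_prod (f : R -> R -> R) :
  continuous (fun p : R * R => f p.1 p.2) ->
  measurable_fun [set: mR * mR] (fun p => f p.1 p.2).
Proof.
move=> /continuousP cf; apply: (measurability _ (RGenOpens.measurableE R)).
move=> _ [_ [a [b ->] <-]]; rewrite setTI; apply: open_measurable_prod.
exact/cf/interval_open.
Qed.

(* Signed indicator of the double cone, so that
   [\int_(-w)^w f z dz = \int_(-1)^1 f z * cone z w dz] for either sign of [w]. *)
Definition cone (z w : R) : R := (`|z| <= w)%R%:R - (`|z| <= - w)%R%:R.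

Lemma measurable_cone : measurable_fun [set: mR * mR] (fun p => cone p.1 p.2).
Proof.
have half (f : R -> R -> R) : continuous (fun p : R * R => f p.1 p.2) ->
    measurable_fun [set: mR * mR] (fun p => (`|p.1| <= f p.1 p.2)%R%:R : R).
  move=> cf; pose A : set (mR * mR) := [set p | 0 <= f p.1 p.2 - `|p.1|].
  have cg : continuous (fun p : R * R => f p.1 p.2 - `|p.1|) by cont.
  have mA : measurable A.
    have := @continuous_measurable_prod (fun z w => f z w - `|z|) cg measurableT
      `[0, +oo[%classic (measurable_itv _).
    rewrite setTI; congr measurable; apply/seteqP; split=> p /=;
    by rewrite in_itv /= andbT.
  apply: (eq_measurable_fun (\1_A : mR * mR -> R)); last exact: measurable_indic.
  move=> p _; rewrite indicE /A; congr (nat_of_bool _)%:R; rewrite -subr_ge0.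
  by apply/idP/idP => [H|]; [rewrite inE in H|rewrite inE].
apply: measurable_funB.
  by apply: (half (fun _ w => w)); cont.
by apply: (half (fun _ w => - w)); cont.
Qed.

Lemma cone_bound z w : `|cone z w| <= (`|z| <= `|w|)%R%:R.
Proof.
have nz := normr_ge0 z.
rewrite /cone; have [w0|/ltW w0] := leP 0 w.
  rewrite (ger0_norm w0); have [zw|zw] := leP `|z| w; have [zw'|zw'] := leP `|z| (- w);
  by rewrite ?subrr ?subr0 ?sub0r ?normrN ?normr0 ?normr1 //; lra.
rewrite (ler0_norm w0); have [zw|zw] := leP `|z| w; have [zw'|zw'] := leP `|z| (- w);
by rewrite ?subrr ?subr0 ?sub0r ?normrN ?normr0 ?normr1 //; lra.
Qed.

End PlaneMeasurability.

(** * Exchange of integrals on the square, for integrable functions *)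

Section FubiniInterval.
Context {R : realType}.
Notation mR := (measurableTypeR R).
Notation leb := (@lebesgue_measure R).
Implicit Types (f g : R -> R) (H : R -> R -> R).

Let mI : measurable (I11 : set mR) := @measurable_I11 R.

Let L1_restrict f : L1_I f -> leb.-integrable setT (EFin \o (f \_ I11)).
Proof. by move=> if1; rewrite -restrict_EFin; apply/(integrable_mkcond _ mI). Qed.

Let restrict_L1 f : leb.-integrable setT (EFin \o (f \_ I11)) -> L1_I f.
Proof. by rewrite -restrict_EFin => /(integrable_mkcond _ mI). Qed.

Let integral_restrict f : L1_I f ->
  (\int[leb]_x ((f \_ I11) x)%:E)%E = (Rintegral leb I11 f)%:E.
Proof.
move=> /L1_restrict if1; rewrite Rintegral_mkcond /Rintegral fineK//.
exact: integrable_fin_num if1.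
Qed.

Lemma Fubini_I11 f H (B : R) : L1_I f ->
  measurable_fun [set: mR * mR] (fun p => H p.1 p.2) ->
  (forall z w, -1 <= z <= 1 -> -1 <= w <= 1 -> `|H z w| <= B) ->
  let V w := Rintegral leb I11 (fun z => f z * H z w) in
  L1_I V /\ forall g, continuous g ->
  Rintegral leb I11 (fun z => f z * Rintegral leb I11 (fun w => g w * H z w)) =
  Rintegral leb I11 (fun w => g w * V w).
Proof.
move=> if1 mH HB V.
have mH1 w : measurable_fun setT (H^~ w) := measurable_fun_pair1 w mH.
have mH2 z : measurable_fun setT (H z) := measurable_fun_pair2 z mH.
have iH1 w : -1 <= w <= 1 -> L1_I (fun z => f z * H z w).
  move=> w1; apply: (@L1_bounded_mul _ _ _ B) => //; first exact: measurable_funTS.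
  by move=> z z1; exact: HB.
have iH2 g z : L1_I g -> -1 <= z <= 1 -> L1_I (fun w => g w * H z w).
  move=> ig z1; apply: (@L1_bounded_mul _ _ _ B) => //; first exact: measurable_funTS.
  by move=> w w1; exact: HB.
have key g : L1_I g -> L1_I (fun w => g w * V w) /\
    Rintegral leb I11 (fun z => f z * Rintegral leb I11 (fun w => g w * H z w)) =
    Rintegral leb I11 (fun w => g w * V w).
  move=> ig.
  (* Extension by zero, so that Fubini on the whole plane applies; the partial integrals [F1] and
     [F2] are then exact at every point, which also yields the measurability of [V]. *)
  pose F (p : mR * mR) : R := (f \_ I11) p.1 * ((g \_ I11) p.2 * H p.1 p.2).
  have mres (k : R -> R) : L1_I k -> measurable_fun setT (k \_ I11).
    by move=> /L1_measurable mk; apply/(measurable_restrictT _ mI).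
  have mF : measurable_fun setT F.
    apply: measurable_funM.
      exact: (measurableT_comp (mres _ if1) measurable_fst).
    apply: measurable_funM => //.
    exact: (measurableT_comp (mres _ ig) measurable_snd).
  pose K z := Rintegral leb I11 (fun w => g w * H z w).
  have F2 z : (\int[leb]_w (F (z, w))%:E)%E = (((fun z => f z * K z) \_ I11) z)%:E.
    rewrite /F /=; case: (pselect (I11 z)) => Iz; last first.
      rewrite !patchE memNset//; under eq_integral do rewrite mul0r.
      by rewrite integral0.
    rewrite !patchE mem_set//.
    have := integral_restrict (L1Z (f z) (iH2 g z ig Iz)).
    rewrite RintegralZl//; last exact: iH2.
    move=> <-; apply: eq_integral => w _; congr (_%:E).
    by rewrite !patchE; case: ifPn => // _; rewrite mul0r mulr0.
  have F1 w : (\int[leb]_z (F (z, w))%:E)%E = (((fun w => g w * V w) \_ I11) w)%:E.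
    rewrite /F /=; case: (pselect (I11 w)) => Iw; last first.
      rewrite !patchE memNset//; under eq_integral do rewrite mul0r mulr0.
      by rewrite integral0.
    rewrite !patchE mem_set//.
    have := integral_restrict (L1Z (g w) (iH1 w Iw)).
    rewrite RintegralZl//; last exact: iH1.
    move=> <-; apply: eq_integral => z _; congr (_%:E).
    by rewrite !patchE; case: ifPn => // _; [ring|rewrite mul0r].
  have iF : (leb \x leb)%E.-integrable setT (EFin \o F).
    apply/integrable12ltyP; first exact/measurable_EFinP.
    pose c := Rintegral leb I11 (fun w => `|g w|).
    have bnd z : (\int[leb]_w `|(F (z, w))%:E| <=
        (((fun z => B * c * `|f z|) \_ I11) z)%:E)%E.
      case: (pselect (I11 z)) => Iz; last first.
        rewrite [X in (_ <= X%:E)%E]patchE memNset// /F /=; under eq_integral do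
          rewrite patchE memNset//= mul0r normr0.
        by rewrite integral0.
      have ib : L1_I (fun w => `|f z| * B * `|g w|) by apply: L1Z; exact: L1_abs.
      rewrite [X in (_ <= X%:E)%E]patchE mem_set//.
      have -> : B * c * `|f z| = Rintegral leb I11 (fun w => `|f z| * B * `|g w|).
        by rewrite RintegralZl//; [rewrite -/c; ring|exact: L1_abs].
      rewrite -integral_restrict//; apply: ge0_le_integral => //.
      - apply: measurableT_comp => //; apply/measurable_EFinP.
        exact: (measurable_fun_pair2 z mF).
      - exact: measurable_int (L1_restrict ib).
      - move=> w _; rewrite lee_fin /F /=; rewrite [X in _ <= X]patchE.
        case: ifPn => [/set_mem Iw|Iw].
          rewrite patchE mem_set// patchE mem_set// !normrM -mulrA ler_wpM2l//.
          by rewrite mulrC ler_wpM2r// HB.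
        by rewrite [(g \_ _) _]patchE (negbTE Iw) mul0r mulr0 normr0.
    have ic : L1_I (fun z => B * c * `|f z|) by apply: L1Z; exact: L1_abs.
    apply: (@le_lt_trans _ _ (\int[leb]_z (((fun z => B * c * `|f z|) \_ I11) z)%:E)%E).
      apply: ge0_le_integral => //.
      - by move=> z _; apply: integral_ge0.
      - apply: (@measurable_fun_fubini_tonelli_F _ _ _ _ _ _
          (fun p => `|(F p)%:E|)%E) => //.
        by apply: measurableT_comp => //; exact/measurable_EFinP.
      - exact: measurable_int (L1_restrict ic).
      - by move=> z _; exact: bnd.
    by rewrite integral_restrict// ltry.
  have iV : L1_I (fun w => g w * V w).
    apply: (@le_L1 _ _ (fun w => B * Rintegral leb I11 (fun z => `|f z|) * g w)).
    - apply/(measurable_restrictT _ mI)/measurable_EFinP.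
      have := measurable_fubini_G iF; congr (measurable_fun _ _).
      by apply/funext => w; rewrite /fubini_G /= F1.
    - exact: L1Z.
    move=> w Iw; rewrite normrM [X in _ <= X]normrM mulrC; apply: ler_wpM2r => //.
    apply: le_trans (ler_norm _).
    apply: le_trans (le_normr_Rintegral mI (iH1 w Iw)) _.
    rewrite -RintegralZl//; last exact: L1_abs.
    apply: le_Rintegral => //; first exact: (L1_abs (iH1 w Iw)).
      exact: (L1Z B (L1_abs if1)).
    by move=> z Iz; rewrite normrM mulrC ler_wpM2r// HB.
  have iK : L1_I (fun z => f z * K z).
    apply: restrict_L1; have := integrable_fubini_F iF.
    by congr (_.-integrable _ _); apply/funext => z; rewrite /fubini_F /= F2.
  split; first exact: iV.
  have := Fubini iF => /=.
  under eq_integral do rewrite F2.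
  under [X in _ = X]eq_integral do rewrite F1.
  rewrite (integral_restrict iK) (integral_restrict iV); exact: EFin_inj.
(* [g = 1] gives the integrability of [V] itself. *)
have c1 : continuous (fun _ : R => 1 : R) by cont.
split=> [|g cg]; last by have [] := key g (L1_continuous cg).
have [+ _] := key _ (L1_continuous c1); congr L1_I.
by apply/funext => w; rewrite mul1r.
Qed.

End FubiniInterval.

(** * The target state as a function, and criteria for its vanishing *)

Section Vanishing.
Context {R : realType}.
Notation mR := (measurableTypeR R).
Notation leb := (@lebesgue_measure R).
Implicit Types (f g : R -> R) (L : R -> R -> R).

Let mI : measurable (I11 : set mR) := @measurable_I11 R.

Lemma measurable_indicator (D : set R) (P : R -> bool) (i : interval R) :
  (forall w, P w = (w \in i)) -> measurable_fun D (fun w => (P w)%:R : R).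
Proof.
move=> Pi; apply: (eq_measurable_fun (\1_[set` i] : R -> R)).
  by move=> w _; rewrite indicE Pi mem_setE.
exact: measurable_indic.
Qed.

Lemma L1_indicator f (P : R -> bool) (i : interval R) : L1_I f ->
  (forall w, P w = (w \in i)) -> L1_I (fun w => f w * (P w)%:R).
Proof.
move=> if1 Pi; apply: (@L1_bounded_mul _ _ _ 1) => //.
  exact: measurable_indicator Pi.
by move=> w _; case: (P w); rewrite ?normr1 ?normr0.
Qed.

Lemma Rintegral_indicator f (P : R -> bool) (A : set R) :
  (forall w, A w <-> (I11 w /\ P w)) ->
  Rintegral leb I11 (fun w => f w * (P w)%:R) = Rintegral leb A f.
Proof.
move=> AP; have -> : A = I11 `&` [set w | P w] by apply/seteqP; split=> w; rewrite AP.
rewrite Rintegral_mkcondr; apply: eq_Rintegral => w _; rewrite patchE.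
case: ifPn => [/set_mem /= ->|nP]; first by rewrite mulr1.
case Pw : (P w); last by rewrite mulr0.
by move: nP; rewrite mem_set.
Qed.

Lemma adj_cone L g z : continuous (fun q : R * R => L q.1 q.2) -> continuous g ->
  -1 <= z <= 1 ->
  adj L g z = Rintegral leb I11 (fun w => g w * (cone z w * L z w)).
Proof.
move=> cL cg z1; pose h w := L z w * g w.
have ch : continuous h by rewrite /h; cont.
have chN : continuous (fun w => h (- w)) by cont.
have nz1 : `|z| <= 1 by rewrite ler_norml.
have nz0 := normr_ge0 z.
have Ei w : (`|z| <= w) = (w \in `[`|z|, +oo[) by rewrite in_itv /= andbT.
have Ej w : (`|z| <= - w) = (w \in `]-oo, - `|z|]) by rewrite in_itv /= lerNr.
transitivity (Rintegral leb I11 (fun w => h w * (`|z| <= w)%R%:R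
    - h w * (`|z| <= - w)%R%:R)); last first.
  by apply: eq_Rintegral => w _; rewrite /cone /h; ring.
have ih := L1_continuous ch.
rewrite RintegralB//; [|exact: L1_indicator Ei|exact: L1_indicator Ej].
rewrite (@Rintegral_indicator h _ `[`|z|, 1]%classic); last first.
  move=> w /=; rewrite in_itv /= /I11 /=; split=> [/andP[? ?]|[/andP[? ?] ?]].
    by split=> //; apply/andP; split=> //; lra.
  by apply/andP.
rewrite (@Rintegral_indicator h _ `[-1, - `|z|]%classic); last first.
  move=> w /=; rewrite in_itv /= /I11 /=; split=> [/andP[? ?]|[/andP[? ?] ?]].
    by split; [apply/andP; split=> //; lra|lra].
  by apply/andP; split=> //; lra.
rewrite !RintegralE//; last by lra.
by rewrite /adj ointB// (oint_opp _ _ ch).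
Qed.

(** The integral operator of the transform, from [- w] to [w], written over a fixed domain so that
    Fubini applies. *)
Definition volt L f w : R := Rintegral leb I11 (fun z => f z * (cone z w * L z w)).

Lemma moment_adj L f : continuous (fun q : R * R => L q.1 q.2) -> L1_I f ->
  L1_I (volt L f) /\
  forall g, continuous g -> moment f (adj L g) = moment (volt L f) g.
Proof.
move=> cL if1; have [B B0 LB] := bounded_on_square cL.
have [|z w z1 w1|iV VE] := @Fubini_I11 _ f (fun z w => cone z w * L z w) B if1.
- apply: measurable_funM; first exact: measurable_cone.
  exact: continuous_measurable_prod.
- have C1 : `|cone z w| <= 1.
    by apply: le_trans (cone_bound _ _) _; case: (`|z| <= `|w|).
  have := ler_pM (normr_ge0 _) (normr_ge0 _) C1 (LB z w z1 w1).
  by rewrite -normrM mul1r.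
split=> // g cg; rewrite /moment.
transitivity (Rintegral leb I11 (fun z => f z *
    Rintegral leb I11 (fun w => g w * (cone z w * L z w)))).
  by apply: eq_Rintegral => z; rewrite inE => z1; rewrite adj_cone.
by rewrite VE//; apply: eq_Rintegral => w _; rewrite mulrC.
Qed.

(** Identifies the functional [target] with the moments of an integrable function, the transformed
    state. *)
Lemma moment_transform L1 L2 f1 f2 :
  continuous (fun q : R * R => L1 q.1 q.2) ->
  continuous (fun q : R * R => L2 q.1 q.2) -> L1_I f1 -> L1_I f2 ->
  let alpha w := f1 w - (volt L1 f1 w + volt L2 f2 w) in
  L1_I alpha /\ forall g, continuous g ->
  moment f1 (fun w => g w - adj L1 g w) + moment f2 (fun w => - adj L2 g w) =
  moment alpha g.
Proof.
move=> cL1 cL2 if1 if2 alpha.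
have [i1 E1] := moment_adj cL1 if1; have [i2 E2] := moment_adj cL2 if2.
have i12 := L1D i1 i2.
split=> [|g cg]; first exact: L1B.
have ca1 := cont_adj cL1 cg; have ca2 := cont_adj cL2 cg.
have caN : continuous (fun w => - adj L1 g w) by cont.
rewrite (momentD if1 cg caN).
have opp f (k : R -> R) : L1_I f -> continuous k -> moment f (fun w => - k w) = - moment f k.
  move=> if0 ck; rewrite -mulN1r -momentZ//; congr moment.
  by apply/funext => w; rewrite mulN1r.
rewrite !opp// E1// E2// -(momentB if1 i12 cg).
suff -> : moment (fun w => volt L1 f1 w + volt L2 f2 w) g =
  moment (volt L1 f1) g + moment (volt L2 f2) g by rewrite opprD addrA.
rewrite /moment -RintegralD//; [|exact: L1_mul..].
by apply: eq_Rintegral => w _; rewrite mulrDl.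
Qed.

Lemma ae_imply (P Q : R -> Prop) : (forall x, P x -> Q x) ->
  {ae leb, forall x, P x} -> {ae leb, forall x, Q x}.
Proof. by move=> PQ; apply: filterS; [exact: (ae_filter_ringOfSetsType leb)|exact: PQ]. Qed.

Definition null f : Prop := {ae leb, forall w, I11 w -> f w = 0}.

(** Lebesgue differentiation: almost everywhere, [f] extended by zero is the derivative of its
    primitive, and that primitive is identically zero. *)
Lemma null_of_prefix f : L1_I f ->
  (forall x, -1 <= x <= 1 -> Rintegral leb `[-1, x] f = 0) -> null f.
Proof.
move=> if1 f0.
have irf : leb.-integrable setT (EFin \o (f \_ I11)).
  by rewrite -restrict_EFin; apply/(integrable_mkcond _ mI).
have ify y : leb.-integrable `]-oo, y] (EFin \o (f \_ I11)).
  by apply: integrableS irf => //; exact: measurable_itv.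
pose F (x : R) : R := Rintegral leb `]-oo, x] (f \_ I11).
have : {ae leb, forall x, derivable F x 1 /\ derive1 F x = (f \_ I11) x}.
  exact: FTC1Ny ify (integrable_locally mI if1).
have F0 : F = fun=> 0.
  apply/funext => x; rewrite /F -Rintegral_mkcondr.
  have [x1|x1] := ltP x (-1).
    rewrite (_ : _ `&` _ = set0) ?Rintegral_set0//.
    apply/seteqP; split=> // w [] /=; rewrite in_itv /= /I11 /= => ? /andP[? ?]; lra.
  pose y := Num.min x 1.
  rewrite (_ : _ `&` _ = `[-1, y]%classic).
    apply: f0; rewrite /y; have [x2|_] := leP x 1; first by rewrite x1 x2.
    by apply/andP; split; lra.
  apply/seteqP; split=> w /=; rewrite !in_itv /= /I11 /= /y le_min.
    by move=> [-> /andP[-> ->]].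
  by move=> /andP[-> /andP[-> ->]].
rewrite F0; apply: ae_imply => x [_ +] Ix.
by rewrite derive1_cst patchE mem_set.
Qed.

Lemma null_Rintegral f g : measurable_fun I11 f -> measurable_fun I11 g ->
  null (fun w => f w - g w) -> Rintegral leb I11 f = Rintegral leb I11 g.
Proof.
move=> mf mg fg; congr fine; apply: ae_eq_integral => //; [exact/measurable_EFinP..|].
by apply: ae_imply fg => w fgw Iw; congr (_%:E); apply/eqP; rewrite -subr_eq0 fgw.
Qed.

Lemma null_abs f : L1_I f -> Rintegral leb I11 (fun w => `|f w|) = 0 -> null f.
Proof.
move=> if1 f0; have mf : measurable_fun (I11 : set mR) (EFin \o f).
  by move: if1 => /integrableP[].
have E : (\int[leb]_(x in I11) `|(EFin \o f) x|)%E = 0%E.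
  transitivity (Rintegral leb I11 (fun w => `|f w|))%:E; last by rewrite f0.
  by rewrite /Rintegral fineK//; exact: (integrable_fin_num mI (L1_abs if1)).
have := (ae_eq_integral_abs _ mI mf).1 E.
by apply: ae_imply => w fw Iw; have [] := fw Iw.
Qed.

(* Second differences in [a] of the squared positive parts converge boundedly
   to the indicator of [theta < a]. *)
Lemma moment_indicator f (theta nu : R -> R) A : L1_I f ->
  continuous theta -> continuous nu ->
  (forall a, a <= A ->
    moment f (fun w => Num.max 0 (a - theta w) ^+ 2 * nu w) = 0) ->
  forall a, a <= A ->
  Rintegral leb I11 (fun w => f w * nu w * (theta w < a)%R%:R) = 0.
Proof.
move=> if1 ct cn H a aA.
have ifn := L1_mul if1 cn.
pose P (x w : R) := Num.max 0 (x - theta w) ^+ 2.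
pose h (n : nat) : R := n.+1%:R^-1.
have h0 n : 0 < h n by rewrite invr_gt0 ltr0n.
(* Backward differences, since the hypothesis covers only levels up to [A]. If [theta w < a] and the
   step is small, all three terms are full squares and [q n w = 1]; if [a <= theta w], all are
   zero. *)
pose q n w := (2 * h n ^+ 2)^-1 * (P a w - 2 * P (a - h n) w + P (a - 2 * h n) w).
have cP x : continuous (P x) by rewrite /P; cont.
have cq n : continuous (q n) by have := cP a; have := cP (a - h n);
  have := cP (a - 2 * h n) => ? ? ?; rewrite /q; cont.
have h20 n : 0 < 2 * h n ^+ 2 by rewrite mulr_gt0// exprn_gt0.
have qb n w : 0 <= q n w <= 1.
  (* Both outer terms are expanded at the middle level; their linear parts cancel, which leaves a
     value between 0 and [2 * h n ^+ 2]. *)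
  pose m := Num.max 0 (a - h n - theta w).
  have T1 : 0 <= P a w - P (a - h n) w - h n * (2 * m) <= h n ^+ 2.
    have := pos2_taylor (a - h n - theta w) (a - theta w).
    by have -> : a - theta w - (a - h n - theta w) = h n by ring.
  have T2 : 0 <= P (a - 2 * h n) w - P (a - h n) w - - h n * (2 * m) <= h n ^+ 2.
    have := pos2_taylor (a - h n - theta w) (a - 2 * h n - theta w).
    have -> : a - 2 * h n - theta w - (a - h n - theta w) = - h n by ring.
    by rewrite sqrrN.
  move: T1 T2 => /andP[? ?] /andP[? ?]; rewrite /q; apply/andP; split.
    by rewrite mulr_ge0// ?invr_ge0 ?(ltW (h20 n))//; lra.
  by rewrite mulrC ler_pdivrMr// mul1r; lra.
have Iq n : Rintegral leb I11 (fun w => f w * nu w * q n w) = 0.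
  have c1 : continuous (fun w => P a w * nu w) by have := cP a => ?; cont.
  have c2 : continuous (fun w => P (a - h n) w * nu w) by have := cP (a - h n) => ?; cont.
  have c3 : continuous (fun w => P (a - 2 * h n) w * nu w).
    by have := cP (a - 2 * h n) => ?; cont.
  have c12 : continuous (fun w => P a w * nu w + -2 * (P (a - h n) w * nu w)).
    by move: c1 c2; set u1 := (fun w => _); set u2 := (fun w => _) => ? ?;
    apply: contD => //; apply: contM => //; exact: cont_cst.
  have c2' : continuous (fun w => -2 * (P (a - h n) w * nu w)).
    by apply: contM => //; exact: cont_cst.
  have := H a aA; have := H (a - h n) _; have := H (a - 2 * h n) _.
  have hn := h0 n.
  move=> /(_ ltac:(lra)) E3 /(_ ltac:(lra)) E2 E1.
  transitivity (moment f (fun w => (2 * h n ^+ 2)^-1 *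
      (P a w * nu w + -2 * (P (a - h n) w * nu w) + P (a - 2 * h n) w * nu w))).
    by apply: eq_Rintegral => w _; rewrite /q; ring.
  rewrite momentZ//; last exact: contD.
  rewrite (momentD if1 c12 c3) (momentD if1 c1 c2') (momentZ _ if1 c2).
  by rewrite E1 E2 E3; ring.
have iq n : L1_I (fun w => f w * nu w * q n w) by exact: L1_mul.
have ia := L1_abs ifn.
have cvg1 := @dominated_cvg _ mR R leb I11 mI
  (fun n w => (f w * nu w * q n w)%:E)
  (fun w => (f w * nu w * (theta w < a)%R%:R)%:E) (fun w => `|f w * nu w|%:E).
have {cvg1} : (\int[leb]_(x in I11) (f x * nu x * q n x)%:E @[n --> \oo] -->
    \int[leb]_(x in I11) (f x * nu x * (theta x < a)%R%:R)%:E)%E.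
  apply: cvg1 => //.
  - by move=> n; exact: measurable_int (iq n).
  - move=> w Iw; apply: cvg_near_cst.
    have [ta|at_] := ltP (theta w) a.
      have e0 : 0 < (a - theta w) / 2 by rewrite divr_gt0// subr_gt0.
      have := near_infty_natSinv_lt (PosNum e0); apply: filterS => n /= hn.
      have {}hn : h n < (a - theta w) / 2 by [].
      congr (_ * _)%:E; rewrite /q /P !max_r; [|by have := h0 n; lra..].
      by have h0' : h n != 0 by [rewrite gt_eqF]; field.
    apply: nearW => n; congr (_ * _)%:E; rewrite /q /P.
    by rewrite !max_l; [rewrite expr0n /=; ring|have := h0 n; lra..].
  - move=> n w Iw; rewrite /= lee_fin normrM ler_piMr// ger0_norm.
      by have /andP[] := qb n w.
    by have /andP[] := qb n w.
rewrite (_ : (fun n => _) = (fun=> 0%E)).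
  move=> /(cvg_unique _ (cvg_cst 0%E)) E.
  by rewrite /Rintegral -E.
apply/funext => n; have := Iq n; rewrite /Rintegral => Iqn.
by rewrite -(fineK (integrable_fin_num mI (iq n))) /= Iqn.
Qed.

Lemma null_cancel f (nu : R -> R) : (forall w, nu w != 0) ->
  null (fun w => f w * nu w) -> null f.
Proof.
move=> nu0; apply: ae_imply => w H Iw; apply/eqP.
by move/eqP: (H Iw); rewrite mulf_eq0 (negbTE (nu0 w)) orbF.
Qed.

Lemma null_increasing f (theta nu : R -> R) : L1_I f ->
  continuous theta -> continuous nu -> (forall w, nu w != 0) ->
  (forall x y, x < y -> theta x < theta y) ->
  (forall a, a <= theta 1 ->
    moment f (fun w => Num.max 0 (a - theta w) ^+ 2 * nu w) = 0) -> null f.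
Proof.
move=> if1 ct cn nu0 th H; apply: (null_cancel nu0).
have ifn := L1_mul if1 cn.
apply: null_of_prefix => // x /andP[x1 x2].
have thE w : (theta w < theta x) = (w < x).
  have [/th//|xw] := ltP w x; apply/negbTE; rewrite -leNgt.
  by move: xw; rewrite le_eqVlt => /predU1P[->//|/th /ltW].
have := moment_indicator if1 ct cn H (_ : theta x <= theta 1).
move=> /(_ _) E; have {E} : Rintegral leb I11
    (fun w => f w * nu w * (theta w < theta x)%R%:R) = 0.
  by apply: E; move: x2; rewrite le_eqVlt => /predU1P[->//|/th /ltW].
rewrite (@Rintegral_indicator _ _ `[-1, x[%classic); last first.
  move=> w; rewrite thE /= in_itv /= /I11 /=; split=> [/andP[? ?]|[/andP[? ?] ?]].
    by split=> //; apply/andP; split=> //; lra.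
  by apply/andP.
rewrite Rintegral_itv_bndo_bndc//.
apply: (integrableS mI (measurable_itv _) _ ifn).
by move=> w /=; rewrite in_itv /= /I11 /= => /andP[? ?]; apply/andP; split=> //; lra.
Qed.

(** Sublevel sets of [theta] are now intervals ending at 1. The one starting at -1 gives the total
    integral, and prefixes follow by subtraction. *)
Lemma null_decreasing f (theta nu : R -> R) : L1_I f ->
  continuous theta -> continuous nu -> (forall w, nu w != 0) ->
  (forall x y, x < y -> theta y < theta x) ->
  (forall a, a <= theta (-1) ->
    moment f (fun w => Num.max 0 (a - theta w) ^+ 2 * nu w) = 0) -> null f.
Proof.
move=> if1 ct cn nu0 th H; apply: (null_cancel nu0).
have ifn := L1_mul if1 cn.
have ifn' : leb.-integrable `[-1, 1] (EFin \o (fun w => f w * nu w)).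
  by move: ifn; rewrite /L1_I I11E.
have thE x w : (theta w < theta x) = (x < w).
  have [/th//|xw] := ltP x w; apply/negbTE; rewrite -leNgt.
  by move: xw; rewrite le_eqVlt => /predU1P[->//|/th /ltW].
have suffix x : -1 <= x <= 1 -> Rintegral leb `]x, 1] (fun w => f w * nu w) = 0.
  move=> /andP[x1 x2].
  have E : Rintegral leb I11 (fun w => f w * nu w * (theta w < theta x)%R%:R) = 0.
    apply: (moment_indicator if1 ct cn H).
    by move: x1; rewrite le_eqVlt => /predU1P[->//|/th /ltW].
  rewrite -E (@Rintegral_indicator _ _ `]x, 1]%classic)// => w.
  rewrite thE /= in_itv /= /I11 /=; split=> [/andP[? ?]|[/andP[? ?] ?]].
    by split=> //; apply/andP; split=> //; lra.
  by apply/andP.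
have m11 : -1 <= (-1 : R) <= 1 by lra.
have total : Rintegral leb `[-1, 1] (fun w => f w * nu w) = 0.
  rewrite -(suffix _ m11) -Rintegral_itv_obnd_cbnd//.
  by apply: integrableS ifn' => //; exact: subset_itv_oc_cc.
apply: null_of_prefix => // x x11; have /andP[x1 x2] := x11.
have := Rintegral_itvB (x := x) ifn'; rewrite !bnd_simp => /(_ x1 x2).
by rewrite total (suffix x x11) sub0r => /eqP; rewrite oppr_eq0 => /eqP.
Qed.

End Vanishing.

(** * Uniqueness for the homogeneous Volterra equation *)

Section VolterraUniqueness.
Context {R : realType}.
Notation mR := (measurableTypeR R).
Notation leb := (@lebesgue_measure R).
Implicit Types (f g u v : R -> R) (L : R -> R -> R).

Let mI : measurable (I11 : set mR) := @measurable_I11 R.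

Definition mass f r : R := Rintegral leb I11 (fun z => `|f z| * (`|z| <= r)%R%:R).

Let indE (r w : R) : (`|w| <= r) = (w \in `[- r, r]).
Proof. by rewrite in_itv /= ler_norml. Qed.

Lemma mass_mono f r s : L1_I f -> r <= s -> mass f r <= mass f s.
Proof.
move=> if1 rs; have ia := L1_abs if1.
apply: le_Rintegral => //.
- exact: (L1_indicator ia (indE r)).
- exact: (L1_indicator ia (indE s)).
move=> w _; rewrite ler_wpM2l// ler_nat.
by case: leP => // wr; rewrite (le_trans wr rs).
Qed.

Lemma mass_ge0 f r : 0 <= mass f r.
Proof. by apply: Rintegral_ge0 => w _; rewrite mulr_ge0. Qed.

Lemma volt_bound L f (N : R) : continuous (fun q : R * R => L q.1 q.2) -> L1_I f ->
  (forall z w, -1 <= z <= 1 -> -1 <= w <= 1 -> `|L z w| <= N) ->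
  forall w, -1 <= w <= 1 -> `|volt L f w| <= N * mass f `|w|.
Proof.
move=> cL if1 LN w w1; have ia := L1_abs if1.
have ii := L1_indicator ia (indE `|w|).
have mcL : measurable_fun setT (fun z => cone z w * L z w).
  apply: (@measurable_fun_pair1 _ _ _ mR mR mR (fun p => cone p.1 p.2 * L p.1 p.2) w).
  by apply: measurable_funM; [exact: measurable_cone|exact: continuous_measurable_prod].
have N0 : 0 <= N by apply: le_trans (LN w w w1 w1).
have cLN z : -1 <= z <= 1 -> `|cone z w * L z w| <= N * (`|z| <= `|w|)%R%:R.
  move=> z1; rewrite normrM mulrC.
  exact: ler_pM (normr_ge0 _) (normr_ge0 _) (LN z w z1 w1) (cone_bound z w).
have ifc : L1_I (fun z => f z * (cone z w * L z w)).
  apply: (@L1_bounded_mul _ _ _ N) => //; first exact: measurable_funTS.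
  move=> z z1; apply: le_trans (cLN z z1) _.
  by case: (`|z| <= `|w|); rewrite ?mulr1 ?mulr0.
apply: le_trans (le_normr_Rintegral mI ifc) _.
rewrite /mass -RintegralZl//.
apply: le_Rintegral => //; [exact: (L1_abs ifc)|exact: (L1Z N ii)|].
by move=> z z1; rewrite normrM mulrCA ler_wpM2l// cLN.
Qed.

(* No mass on [|z| <= r0] propagates to [|z| <= r0 + 1 / (8 N)]. *)
Lemma volterra_null u v U V (N : R) : 0 < N ->
  L1_I u -> L1_I v -> L1_I U -> L1_I V ->
  null (fun w => u w - U w) -> null (fun w => v w - V w) ->
  (forall w, -1 <= w <= 1 -> `|U w| <= N * (mass u `|w| + mass v `|w|)) ->
  (forall w, -1 <= w <= 1 -> `|V w| <= N * (mass u `|w| + mass v `|w|)) ->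
  null u /\ null v.
Proof.
move=> N0 iu iv iU iV uU vV UN VN.
pose f (w : R) : R := `|u w| + `|v w|; pose F (w : R) : R := `|U w| + `|V w|.
pose m (r : R) : R := mass u r + mass v r.
have i_f : L1_I f by apply: L1D; exact: L1_abs.
have iF : L1_I F by apply: L1D; exact: L1_abs.
have mE r : m r = Rintegral leb I11 (fun w => f w * (`|w| <= r)%R%:R).
  rewrite /m /mass -RintegralD//.
  - by apply: eq_Rintegral => w _; rewrite mulrDl.
  - exact: (L1_indicator (L1_abs iu) (indE r)).
  - exact: (L1_indicator (L1_abs iv) (indE r)).
have fF : null (fun w => f w - F w).
  have : {ae leb, forall w, (I11 w -> u w - U w = 0) /\ (I11 w -> v w - V w = 0)}.
    by apply: filterS2 uU vV; [exact: (ae_filter_ringOfSetsType leb)|split].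
  apply: ae_imply => w [A B] Iw; rewrite /f /F.
  move: (A Iw) (B Iw) => /eqP; rewrite subr_eq0 => /eqP -> /eqP; rewrite subr_eq0.
  by move/eqP ->; rewrite subrr.
have m_ge0 r : 0 <= m r by rewrite addr_ge0 ?mass_ge0.
have Rcst (r : R) : 0 <= r <= 1 ->
    Rintegral leb I11 (fun w => 1 * (`|w| <= r)%R%:R) = 2 * r.
  move=> /andP[r0 r1]; rewrite (@Rintegral_indicator _ (fun=> 1) _ `[-r, r]%classic).
    rewrite RintegralE; [|exact: cont_cst|lra].
    rewrite (@oint_derive _ (fun x => x) (fun=> 1)); [ring|exact: cont_cst|].
    exact: has_deriv_id.
  move=> w; rewrite /= in_itv /= /I11 /= ler_norml; split=> [/andP[? ?]|[]//].
  by split; apply/andP; split; lra.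
(* Only [r < |w| <= s] carries mass. There [F] is at most [2 * N * m s], and this set has measure
   [2 * (s - r)]. *)
have step (r s : R) : 0 <= r -> r <= s -> s <= 1 -> m r = 0 -> m s <= 4 * N * (s - r) * m s.
  move=> r0 rs s1 mr0.
  pose D (w : R) : R := (`|w| <= s)%R%:R - (`|w| <= r)%R%:R.
  have D0 (w : R) : 0 <= D w.
    by rewrite /D subr_ge0 ler_nat; case: leP => // wr; rewrite (le_trans wr rs).
  have iD (g : R -> R) : L1_I g -> L1_I (fun w => g w * D w).
    move=> ig; have := L1B (L1_indicator ig (indE s)) (L1_indicator ig (indE r)).
    by congr L1_I; apply/funext => w; rewrite /D mulrBr.
  have DE (g : R -> R) : L1_I g -> Rintegral leb I11 (fun w => g w * D w) =
      Rintegral leb I11 (fun w => g w * (`|w| <= s)%R%:R) -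
      Rintegral leb I11 (fun w => g w * (`|w| <= r)%R%:R).
    move=> ig; rewrite -RintegralB//.
    - by apply: eq_Rintegral => w _; rewrite /D mulrBr.
    - exact: L1_indicator (indE s).
    - exact: L1_indicator (indE r).
  have i1 : L1_I (fun _ : R => 1 : R) by apply: L1_continuous; exact: cont_cst.
  have mFD : m s = Rintegral leb I11 (fun w => F w * D w).
    rewrite -[m s]subr0 -mr0 !mE -DE//; apply: null_Rintegral.
    - exact: L1_measurable (iD _ i_f).
    - exact: L1_measurable (iD _ iF).
    by apply: ae_imply fF => w fw Iw; rewrite -mulrBl fw// mul0r.
  rewrite {1}mFD.
  apply: (@le_trans _ _ (Rintegral leb I11 (fun w => 2 * N * m s * (1 * D w)))).
    apply: le_Rintegral => //; first exact: iD.
      exact: (L1Z (2 * N * m s) (iD _ i1)).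
    move=> w Iw; rewrite mul1r.
    have [ws|ws] := leP `|w| s; last first.
      have -> : D w = 0.
        by rewrite /D leNgt ws /= leNgt (le_lt_trans rs ws) /= subrr.
      by rewrite !mulr0.
    apply: ler_wpM2r => //.
    have mws : m `|w| <= m s by apply: lerD; exact: mass_mono.
    have := UN w Iw; have := VN w Iw; rewrite -/(m _) /F.
    by have := ler_wpM2l (ltW N0) mws; lra.
  rewrite RintegralZl//; last exact: iD.
  rewrite DE// !Rcst; [|lra|lra].
  have -> : 2 * N * m s * (2 * s - 2 * r) = 4 * N * (s - r) * m s by ring.
  exact: lexx.
(* Makes the factor [4 * N * d] equal to 1/2, so [m s <= m s / 2] forces [m s = 0]. *)
pose d := (8 * N)^-1.
have d0 : 0 < d by rewrite invr_gt0 mulr_gt0.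
have dN : d * N = 8^-1 by rewrite /d invfM -mulrA mulVf ?mulr1// gt_eqF.
have mn (n : nat) : m (Num.min (n%:R * d) 1) = 0.
  elim: n => [|n IHn].
    rewrite mul0r min_l// mE (@Rintegral_indicator _ f _ [set 0]).
      by rewrite Rintegral_set1.
    move=> w /=; rewrite normr_le0 /I11 /=; split=> [->|[_ /eqP]//].
    by rewrite eqxx; split=> //; apply/andP; split; lra.
  set r := Num.min _ _ in IHn; set s := Num.min _ _.
  have nd : 0 <= n%:R * d by rewrite mulr_ge0// ltW.
  have E : n.+1%:R * d = n%:R * d + d by rewrite -natr1 mulrDl mul1r.
  have [r0 [rs [s1 sd]]] : 0 <= r /\ r <= s /\ s <= 1 /\ s - r <= d.
    clear -nd d0 E; rewrite /r /s E !minEle.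
    by repeat case: ifPn; rewrite -?ltNge => *; repeat split; lra.
  have := step r s r0 rs s1 IHn; have ms := m_ge0 s => H.
  apply/eqP; rewrite eq_le ms andbT.
  have : 4 * N * (s - r) * m s <= 4 * N * d * m s.
    by rewrite ler_wpM2r// ler_wpM2l// mulr_ge0// ltW.
  have -> : 4 * N * d * m s = 4 * (d * N) * m s by ring.
  rewrite dN; lra.
have m1 : m 1 = 0.
  have dV0 : 0 <= d^-1 by rewrite invr_ge0 ltW.
  have nd := archi_boundP dV0.
  by have := mn (Num.bound d^-1); rewrite min_r// -ler_pdivrMr// div1r ltW.
have mass1 g : mass g 1 = Rintegral leb I11 (fun w => `|g w|).
  apply: eq_Rintegral => w; rewrite inE /I11 /= => w1.
  by rewrite (_ : (`|w| <= 1) = true) ?mulr1// ler_norml.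
have mu0 := mass_ge0 u 1; have mv0 := mass_ge0 v 1; rewrite /m in m1.
by split; apply: null_abs => //; rewrite -mass1; lra.
Qed.

Lemma null_state (u v : R -> R -> R) t :
  L2_I (fun w => u w t) -> L2_I (fun w => v w t) ->
  null (fun w => u w t) -> null (fun w => v w t) -> state_norm2 u v t = 0.
Proof.
move=> [mu _] [mv _] u0 v0; rewrite /state_norm2.
transitivity (Rintegral leb I11 (fun _ : R => 0 : R)).
  apply: null_Rintegral => //.
    by apply: measurable_funD; exact: measurable_funX.
  have : {ae leb, forall w, (I11 w -> u w t = 0) /\ (I11 w -> v w t = 0)}.
    by apply: filterS2 u0 v0; [exact: (ae_filter_ringOfSetsType leb)|split].
  apply: ae_imply => w [A B] Iw.
  by rewrite (A Iw) (B Iw) expr0n addr0 subr0.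
rewrite RintegralI11; last exact: cont_cst.
rewrite (@oint_derive _ (fun=> 0) (fun=> 0)) ?subrr//; first exact: cont_cst.
exact: has_deriv_cst.
Qed.

End VolterraUniqueness.

(** * Reduction to globally defined coefficients *)

Section Extension.
Context {R : realType}.
Implicit Types (f df : R -> R).
Notation leb := (@lebesgue_measure R).

Let m11 : (-1 : R) < 1. Proof. lra. Qed.

Definition clip : R -> R := clamp (-1) 1.

Lemma clip_in x : -1 <= clip x <= 1.
Proof. by rewrite /clip clamp_ge clamp_le// ltW. Qed.

Lemma clip_id x : -1 <= x <= 1 -> clip x = x.
Proof. exact: clamp_id. Qed.

Lemma cont_clip f : {within I11, continuous f} -> continuous (fun x => f (clip x)).
Proof.
move=> /subspace_continuousP cf x; apply/(continuous_epsP (fun x => f (clip x))) => e e0.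
have /cvgrPdist_le/(_ e e0) := cf (clip x) (clip_in x).
move=> /nbhs_ballP[d /= d0 dP]; exists d => // y yd; rewrite distrC.
apply: dP; last exact: clip_in.
by rewrite /ball /= distrC; apply: le_lt_trans yd; exact: clamp_dist.
Qed.

(** Prolonging [f] with its end slopes could lose positivity. The logarithmic derivative is
    prolonged instead, by its end values, and exponentiated. *)
Lemma positive_C1_extension f df : C1_on_I f df ->
  (forall x, -1 <= x <= 1 -> 0 < f x) ->
  exists F F', [/\ has_deriv F F', continuous F', forall x, 0 < F x &
    forall x, -1 <= x <= 1 -> F x = f x /\ F' x = df x].
Proof.
move=> [cdf dfE] f0; pose g x := df (clip x).
have cg : continuous g by exact: cont_clip.
pose F0 x := f (-1) + oint g (-1) x.
have F0E x : -1 <= x <= 1 -> f x = F0 x.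
  apply: (oint_extension m11 cg) => {}x e x1 e0.
  have /cvgrPdist_le/(_ e e0) /nbhs_ballP[d /= d0 dP] := dfE x x1.
  exists d => // y y1 yd; rewrite /g (clip_id x1).
  have [->|yx] := eqVneq y x; first by rewrite !subrr mul0r subrr normr0 mulr0.
  have yx0 : y - x != 0 by rewrite subr_eq0.
  have := dP (y - x); rewrite /ball /= sub0r normrN => /(_ yd).
  have -> : x + (y - x) = y by ring.
  move=> /(_ (conj yx0 y1)) H.
  have -> : f y - f x - (y - x) * df x =
      - ((df x - (y - x)^-1 * (f y - f x)) * (y - x)) by field.
  by rewrite normrN normrM ler_wpM2r.
have dF0 : has_deriv F0 g.
  apply: has_deriv_eq (has_derivD (has_deriv_cst _)
    (has_derivB (is_derive_prim cg) (has_deriv_cst _))) _ => x /=.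
  by rewrite subr0 add0r.
have cF0 := is_derive_continuous dF0.
pose G x := F0 (clip x).
have ccl : continuous clip by exact: continuous_clamp.
have cG : continuous G by rewrite /G; cont.
have G0 x : 0 < G x by rewrite /G -F0E ?f0 ?clip_in.
have Gn0 x : G x != 0 by rewrite gt_eqF.
have cGV := cont_inv cG Gn0.
pose k x := g x * (G x)^-1.
have ck : continuous k by rewrite /k; cont.
pose K x := prim k x - prim k (-1).
have dK : has_deriv K k.
  apply: has_deriv_eq (has_derivB (is_derive_prim ck) (has_deriv_cst _)) _ => x /=.
  by rewrite subr0.
have cK := is_derive_continuous dK.
have dexp : has_deriv (@expR R) expR by move=> x; exact: is_derive_expR.
have cexp := is_derive_continuous dexp.
have d1 := has_deriv_comp dexp dK.
have d2 := has_deriv_comp dexp (has_derivN dK).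
have dq := has_derivM dF0 d2.
(* On [-1,1] the factors have opposite logarithmic derivatives, so the product keeps its value at
   -1. *)
have qE x : -1 <= x <= 1 -> F0 x * expR (- K x) = f (-1).
  move=> /andP[x1 x2].
  have cq : continuous (fun x => g x * expR (- K x) + F0 x * (expR (- K x) * - k x)).
    by cont.
  have := oint_derive (-1) x cq dq.
  rewrite (oint0 cq x1); last first.
    move=> y /andP[y1 y2]; have y11 : -1 <= y <= 1 by rewrite y1 (le_trans y2 x2).
    have := Gn0 y; rewrite /k /G (clip_id y11) => n0.
    by move: (expR _) => s; field.
  have K1 : K (-1) = 0 by rewrite /K subrr.
  have F1 : F0 (-1) = f (-1) by rewrite /F0 ointxx addr0.
  rewrite K1 F1 oppr0 expR0 mulr1.
  by move=> /esym /eqP; rewrite subr_eq0 => /eqP.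
exists (fun x => f (-1) * expR (K x)), (fun x => f (-1) * (expR (K x) * k x)).
have FE x : -1 <= x <= 1 -> f (-1) * expR (K x) = f x.
  move=> x11; rewrite -(qE x x11) -mulrA -expRD addNr expR0 mulr1.
  by rewrite F0E.
split.
- apply: has_deriv_eq (has_derivM (has_deriv_cst _) d1) _ => x /=.
  by rewrite mul0r add0r.
- by cont.
- by move=> x; rewrite mulr_gt0 ?expR_gt0 ?f0// lexx; lra.
move=> x x11; split; first exact: FE.
rewrite mulrA FE// F0E// /k /G /g (clip_id x11) mulrCA divff ?mulr1//.
by rewrite gt_eqF// -F0E// f0.
Qed.

(** Composition of [L] with a continuous retraction of the plane onto [Eset]. *)
Definition retract (L : R -> R -> R) z w : R :=
  L (clamp (- `|clip w|) `|clip w| z) (clip w).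

Lemma retract_id L z w : Eset (z, w) -> retract L z w = L z w.
Proof.
move=> [/= w1 zw]; rewrite /retract clip_id// clamp_id//.
by rewrite -ler_norml.
Qed.

Lemma cont_retract L : {within Eset, continuous (fun p : R * R => L p.1 p.2)} ->
  continuous (fun p : R * R => retract L p.1 p.2).
Proof.
move=> /subspace_continuousP cL.
have ccl : continuous clip by exact: continuous_clamp.
pose rho z w : R := clamp (- `|clip w|) `|clip w| z.
have crho : continuous (fun p : R * R => rho p.1 p.2).
  have -> : (fun p : R * R => rho p.1 p.2) = (fun p : R * R =>
      Num.max (- `|clip p.2|) (- Num.max (- p.1) (- `|clip p.2|))).
    by apply/funext => p; rewrite /rho /clamp oppr_max !opprK.
  by cont.
have cclip2 : continuous (fun p : R * R => clip p.2) by cont.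
have inE' z w : Eset (rho z w, clip w).
  split => /=; first exact: clip_in.
  by rewrite ler_norml clamp_ge clamp_le// ge0_cp// normr_ge0.
move=> [z w]; apply/(continuous2_epsP (retract L)) => e e0.
have /cvgrPdist_le/(_ e e0) := cL _ (inE' z w).
case=> -[A1 A2] /= [/nbhs_ballP[d1 /= d10 D1] /nbhs_ballP[d2 /= d20 D2]] AP.
have /(continuous2_epsP rho)/(_ (d1 / 2)) := crho (z, w).
case=> [|r1 r10 R1]; first by rewrite divr_gt0.
exists (Num.min r1 d2); first by rewrite lt_min r10.
move=> z' w'; rewrite !lt_min => /andP[z1 _] /andP[w1 w2].
rewrite distrC; apply: (AP (rho z' w', clip w')); last exact: inE'.
split => /=; [apply: D1|apply: D2]; rewrite /ball /= distrC.
  by apply: le_lt_trans (R1 _ _ z1 w1) _; lra.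
by apply: le_lt_trans w2; exact: clamp_dist.
Qed.

Lemma deriv_eq0_local (f : R -> R) x a (d : R) : 0 < d ->
  (forall y, `|y - x| < d -> f y = 0) -> is_derive x (1 : R) f a -> a = 0.
Proof.
move=> d0 f0 dfa; apply: (is_derive_unique dfa); apply/is_derive_epsP => e e0.
exists d => // y yd; rewrite (f0 y yd) (f0 x) ?subrr ?normr0//.
by rewrite mulr0 !subr0 normr0 mulr_ge0// ltW.
Qed.

(** A test function vanishes on the open set [|w| < |z|], hence so do its partial derivatives;
    within the square of integration only points of [Eset] remain. *)
Lemma weak_transport_eq (a a' p p' b b' q q' : R -> R) (L M F G : R -> R -> R) :
  (forall x, -1 <= x <= 1 -> [/\ a x = b x, a' x = b' x, p x = q x & p' x = q' x]) ->
  (forall z w, Eset (z, w) -> L z w = M z w /\ F z w = G z w) ->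
  weak_transport a a' p p' L F -> weak_transport b b' q q' M G.
Proof.
move=> ab LM wt phi phiz phiw C12 supp.
have [dz [dw _]] := C12; have [d [d0 dP]] := supp.
have out z w : `|w| < `|z| -> phi z w = 0.
  by move=> wz; apply/eqP/negPn/negP => /dP[? _]; lra.
have outz z w : `|w| < `|z| -> phiz z w = 0.
  move=> wz; apply: (deriv_eq0_local (d := `|z| - `|w|) _ _ (dz z w)).
    by rewrite subr_gt0.
  move=> y yz; apply: out; have := ler_dist_dist z y; rewrite distrC in yz.
  by have := ler_norm (`|z| - `|y|); lra.
have outw z w : `|w| < `|z| -> phiw z w = 0.
  move=> wz; apply: (deriv_eq0_local (d := `|z| - `|w|) _ _ (dw z w)).
    by rewrite subr_gt0.
  move=> y yw; apply: out; have := ler_dist_dist y w.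
  by have := ler_norm (`|y| - `|w|); lra.
have E2 (f g : R -> R -> R) : (forall z w, -1 <= z <= 1 -> -1 <= w <= 1 -> f z w = g z w) ->
    int2 f = int2 g.
  move=> fg; apply: eq_Rintegral => w; rewrite inE => w1.
  by apply: eq_Rintegral => z; rewrite inE => z1; exact: fg.
have EL : int2 (fun z w => L z w * (a' w * phi z w + a w * phiw z w
      + p' z * phi z w + p z * phiz z w)) =
    int2 (fun z w => M z w * (b' w * phi z w + b w * phiw z w
      + q' z * phi z w + q z * phiz z w)).
  apply: E2 => z w z1 w1; have [wz|zw] := ltP `|w| `|z|.
    by rewrite (out _ _ wz) (outz _ _ wz) (outw _ _ wz) !mulr0 !addr0 !mulr0.
  have [-> _] := LM z w (conj w1 zw).
  by have [-> -> _ _] := ab w w1; have [_ _ -> ->] := ab z z1.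
have EF : int2 (fun z w => F z w * phi z w) = int2 (fun z w => G z w * phi z w).
  apply: E2 => z w z1 w1; have [wz|zw] := ltP `|w| `|z|.
    by rewrite (out _ _ wz) !mulr0.
  by have [_ ->] := LM z w (conj w1 zw).
by rewrite -EL -EF; exact: wt.
Qed.

(** The feedback laws read the kernels on [w = 1] and [w = -1] only, and these two segments lie in
    [Eset]. *)
Lemma closed_loop_sol_eq (lam lam' mu mu' b c k k' l l' e f : R -> R)
    (L11 L12 L21 L22 M11 M12 M21 M22 u v : R -> R -> R) :
  (forall x, -1 <= x <= 1 -> [/\ lam x = k x, lam' x = k' x, mu x = l x & mu' x = l' x]) ->
  (forall x, -1 <= x <= 1 -> b x = e x /\ c x = f x) ->
  (forall z w, Eset (z, w) ->
    [/\ L11 z w = M11 z w, L12 z w = M12 z w, L21 z w = M21 z w & L22 z w = M22 z w]) ->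
  closed_loop_sol lam lam' mu mu' b c L11 L12 L21 L22 u v ->
  closed_loop_sol k k' l l' e f M11 M12 M21 M22 u v.
Proof.
move=> E1 E2 E3 [H1 [H2 [H3 H4]]]; split; first exact: H1.
split; first exact: H2.
have one : -1 <= (1 : R) <= 1 by lra.
have mone : -1 <= (-1 : R) <= 1 by lra.
have edge z (w : R) : -1 <= z <= 1 -> w = 1 \/ w = -1 -> Eset (z, w).
  by move=> z1 [->|->]; split => //=; rewrite ?normrN normr1 ler_norml.
have U1E t : U1_fb M11 M12 u v t = U1_fb L11 L12 u v t.
  have A1 : Rintegral leb I11 (fun z => u z t * M11 z (-1)) =
      Rintegral leb I11 (fun z => u z t * L11 z (-1)).
    apply: eq_Rintegral => z; rewrite inE => z1.
    by have [-> _ _ _] := E3 z (-1) (edge z _ z1 (or_intror erefl)).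
  have A2 : Rintegral leb I11 (fun z => v z t * M12 z (-1)) =
      Rintegral leb I11 (fun z => v z t * L12 z (-1)).
    apply: eq_Rintegral => z; rewrite inE => z1.
    by have [_ -> _ _] := E3 z (-1) (edge z _ z1 (or_intror erefl)).
  by rewrite /U1_fb A1 A2.
have U2E t : U2_fb M21 M22 u v t = U2_fb L21 L22 u v t.
  have A1 : Rintegral leb I11 (fun z => u z t * M21 z 1) =
      Rintegral leb I11 (fun z => u z t * L21 z 1).
    apply: eq_Rintegral => z; rewrite inE => z1.
    by have [_ _ -> _] := E3 z 1 (edge z _ z1 (or_introl erefl)).
  have A2 : Rintegral leb I11 (fun z => v z t * M22 z 1) =
      Rintegral leb I11 (fun z => v z t * L22 z 1).
    apply: eq_Rintegral => z; rewrite inE => z1.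
    by have [_ _ _ ->] := E3 z 1 (edge z _ z1 (or_introl erefl)).
  by rewrite /U2_fb A1 A2.
split=> phi phiw phit T C12 phi1 phiT.
  have EA : Rintegral leb (I0T T) (fun t => Rintegral leb I11 (fun w =>
        u w t * (phit w t + k' w * phi w t + k w * phiw w t) + e w * v w t * phi w t)) =
      Rintegral leb (I0T T) (fun t => Rintegral leb I11 (fun w =>
        u w t * (phit w t + lam' w * phi w t + lam w * phiw w t) + b w * v w t * phi w t)).
    apply: eq_Rintegral => t _; apply: eq_Rintegral => w; rewrite inE => w1.
    by have [-> -> _ _] := E1 w w1; have [-> _] := E2 w w1.
  have EB : Rintegral leb (I0T T) (fun t => phi (-1) t * U1_fb M11 M12 u v t) =
      Rintegral leb (I0T T) (fun t => phi (-1) t * U1_fb L11 L12 u v t).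
    by apply: eq_Rintegral => t _; rewrite U1E.
  have [Em _ _ _] := E1 _ mone; rewrite EA EB -Em.
  exact: H3.
have EA : Rintegral leb (I0T T) (fun t => Rintegral leb I11 (fun w =>
      v w t * (phit w t - l' w * phi w t - l w * phiw w t) + f w * u w t * phi w t)) =
    Rintegral leb (I0T T) (fun t => Rintegral leb I11 (fun w =>
      v w t * (phit w t - mu' w * phi w t - mu w * phiw w t) + c w * u w t * phi w t)).
  apply: eq_Rintegral => t _; apply: eq_Rintegral => w; rewrite inE => w1.
  by have [_ _ -> ->] := E1 w w1; have [_ ->] := E2 w w1.
have EB : Rintegral leb (I0T T) (fun t => phi 1 t * U2_fb M21 M22 u v t) =
    Rintegral leb (I0T T) (fun t => phi 1 t * U2_fb L21 L22 u v t).
  by apply: eq_Rintegral => t _; rewrite U2E.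
have [_ _ Em _] := E1 _ one; rewrite EA EB -Em.
exact: H4.
Qed.

End Extension.

(** * Reflection [w -> - w] together with the exchange of [u] and [v] *)

Section Mirror.
Context {R : realType}.

Lemma int2_opp (f : R -> R -> R) : continuous (fun q : R * R => f q.1 q.2) ->
  int2 (fun z w => f (- z) (- w)) = int2 f.
Proof.
move=> cf; rewrite (int2E cf) int2E; last by cont.
have cI : continuous (fun w => oint (fun z => f z w) (-1) 1).
  by apply: (@cont_oint _ _ (fun w z => f z w)); cont.
have -> : (fun w => oint (fun z => f (- z) (- w)) (-1) 1) =
    (fun w => oint (fun z => f z (- w)) (-1) 1).
  apply/funext => w; have cw : continuous (fun z => f z (- w)) by cont.
  by rewrite (oint_opp _ _ cw) opprK.
by rewrite (oint_opp _ _ cI) opprK.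
Qed.

(** The kernel changes sign because reflection reverses the orientation of the integral from [- w]
    to [w]. *)
Lemma weak_transport_opp (a a' p p' : R -> R) (L F : R -> R -> R) :
  continuous a -> continuous a' -> continuous p -> continuous p' ->
  continuous (fun q : R * R => L q.1 q.2) ->
  continuous (fun q : R * R => F q.1 q.2) ->
  weak_transport a a' p p' L F ->
  weak_transport (fun w => a (- w)) (fun w => - a' (- w))
    (fun z => p (- z)) (fun z => - p' (- z))
    (fun z w => - L (- z) (- w)) (fun z w => F (- z) (- w)).
Proof.
move=> ca ca' cp cp' cL cF wt phi phiz phiw [dz [dw [cphi [cphiz cphiw]]]] [d [d0 dP]].
pose psi z w := phi (- z) (- w).
pose psiz z w := - phiz (- z) (- w).
pose psiw z w := - phiw (- z) (- w).
have C12 : C1_2 psi psiz psiw.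
  split; [|split; [|split; [|split]]]; [| |by rewrite /psi /psiz /psiw; cont..].
    by move=> x y; exact: (@has_deriv_opp _ (phi^~ (- y)) (phiz^~ (- y)) (dz^~ (- y)) x).
  by move=> x y; exact: (@has_deriv_opp _ (phi (- x)) (phiw (- x)) (dw (- x)) y).
have supp : exists d : R, 0 < d /\ forall z w, psi z w != 0 ->
    `|z| + d <= `|w| /\ `|w| <= 1 - d.
  by exists d; split=> // z w /dP; rewrite !normrN.
have := wt psi psiz psiw C12 supp.
rewrite -[in X in - X = _ -> _]int2_opp; last by rewrite /psi /psiz /psiw; cont.
rewrite -[in X in _ = X -> _]int2_opp; last by rewrite /psi; cont.
rewrite /psi /psiz /psiw => E.
have N (f g : R -> R -> R) : (forall z w, f z w = g z w) -> int2 f = int2 g.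
  by move=> fg; congr int2; apply/funext => z; apply/funext => w.
etransitivity; last etransitivity; last first.
- by apply: N => z w; instantiate (1 := fun z w => F (- z) (- w) * phi (- - z) (- - w));
  rewrite /= !opprK.
- exact: E.
by congr (- _); apply: N => z w; rewrite !opprK; ring.
Qed.

(** The sign change of the kernels also absorbs the minus sign in the diagonal value of [L21], so
    the reflected pair meets the same conditions with [b] and [c] exchanged. *)
Lemma half_kernel_mirror (lam lam' mu mu' b c : R -> R) (L21 L22 : R -> R -> R) :
  has_deriv lam lam' -> continuous lam' -> has_deriv mu mu' -> continuous mu' ->
  (forall x, 0 < lam x) -> (forall x, 0 < mu x) ->
  (forall x, -1 <= x <= 1 -> lam x = mu (- x)) -> continuous b -> continuous c ->
  continuous (fun q : R * R => L21 q.1 q.2) ->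
  continuous (fun q : R * R => L22 q.1 q.2) ->
  weak_transport mu mu' mu mu' L22 (fun z w => b z * L21 z w - mu' z * L22 z w) ->
  weak_transport mu mu' (fun z => - lam z) (fun z => - lam' z) L21
    (fun z w => lam' z * L21 z w + c z * L22 z w) ->
  (forall w, -1 <= w <= 1 -> L22 (- w) w = 0) ->
  (forall w, -1 <= w <= 1 -> L21 w w = - c w / (lam w + mu w)) ->
  half_kernel (fun x => mu (- x)) (fun x => - mu' (- x))
    (fun x => lam (- x)) (fun x => - lam' (- x)) (fun x => c (- x)) (fun x => b (- x))
    (fun z w => - L22 (- z) (- w)) (fun z w => - L21 (- z) (- w)).
Proof.
move=> dlam clam' dmu cmu' lam0 mu0 sym cb cc cL21 cL22 eq22 eq21 bc22 bc21.
have clam := is_derive_continuous dlam; have cmu := is_derive_continuous dmu.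
have opp11 (w : R) : -1 <= w <= 1 -> -1 <= - w <= 1 by lra.
split.
- exact: has_deriv_opp.
- by cont.
- exact: has_deriv_opp.
- by cont.
- by move=> x; exact: mu0.
- by move=> x; exact: lam0.
- by move=> x x1; rewrite opprK sym.
- by cont.
- by cont.
- by cont.
- by cont.
- have := weak_transport_opp cmu cmu' cmu cmu' cL22 _ eq22.
  move=> /(_ ltac:(cont)); congr weak_transport.
  by apply/funext => z; apply/funext => w; ring.
- have clamN : continuous (fun z => - lam z) by cont.
  have clamN' : continuous (fun z => - lam' z) by cont.
  have := weak_transport_opp cmu cmu' clamN clamN' cL21 _ eq21.
  move=> /(_ ltac:(cont)); congr weak_transport.
  by apply/funext => z; apply/funext => w; ring.
- by move=> w /opp11 w1; rewrite opprK -{1}[w]opprK bc22 ?oppr0.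
by move=> w /opp11 w1; rewrite bc21// mulNr opprK [lam _ + _]addrC.
Qed.

End Mirror.

Section MirrorEvolution.
Context {R : realType}.

(** The component whose test function vanishes at both ends is now [u], so it is [U1] that drops out
    and [U2] that plays the part of the feedback. *)
Lemma half_evolution_mirror (lam lam' mu mu' b c : R -> R) (L21 L22 : R -> R -> R)
    (Mu Mv : R -> (R -> R) -> R) :
  continuous (fun q : R * R => L21 q.1 q.2) ->
  continuous (fun q : R * R => L22 q.1 q.2) ->
  bounded_functional Mu -> bounded_functional Mv ->
  (forall T h h' f1 f1' f2 f2', 0 < T -> test_fun 0 T h h' ->
    has_deriv f1 f1' -> continuous f1' -> has_deriv f2 f2' -> continuous f2' ->
    f1 1 = 0 -> f1 (-1) = 0 -> f2 (-1) = 0 ->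
    oint (fun t => (Mu (Num.max 0 t) f1 + Mv (Num.max 0 t) f2) * h' t +
      (Mu (Num.max 0 t) (fun w => lam' w * f1 w + lam w * f1' w + c w * f2 w) +
       Mv (Num.max 0 t) (fun w => b w * f1 w - (mu' w * f2 w + mu w * f2' w)) +
       mu 1 * f2 1 * (Mu (Num.max 0 t) (fun z => L21 z 1) +
                      Mv (Num.max 0 t) (fun z => L22 z 1))) * h t) 0 T = 0) ->
  half_evolution (fun x => mu (- x)) (fun x => - mu' (- x))
    (fun x => lam (- x)) (fun x => - lam' (- x)) (fun x => c (- x)) (fun x => b (- x))
    (fun z w => - L22 (- z) (- w)) (fun z w => - L21 (- z) (- w))
    (fun t h => Mv t (fun w => h (- w))) (fun t h => Mu t (fun w => h (- w))).
Proof.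
move=> cL21 cL22 bMu bMv ev T h h' f1 f1' f2 f2' T0 th df1 cf1' df2 cf2' f11 f21 f2m.
have df1N := has_deriv_opp df1; have df2N := has_deriv_opp df2.
have cf1N : continuous (fun w => - f1' (- w)) by cont.
have cf2N : continuous (fun w => - f2' (- w)) by cont.
have l1 : continuous (fun z => L21 z 1) by cont.
have l2 : continuous (fun z => L22 z 1) by cont.
rewrite -[RHS](ev T h h' _ _ _ _ T0 th df2N cf2N df1N cf1N) ?opprK//.
congr (oint _ _ _); apply/funext => t.
have m0 : 0 <= Num.max 0 t :> R by rewrite le_max lexx.
move: (Num.max 0 t) m0 => s s0.
cbv beta; rewrite [X in X * h' t]addrC; congr (_ + _ * _).
have -> : Mv s (fun w => - L22 (- - w) 1) = - Mv s (fun z => L22 z 1).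
  rewrite -(bf_opp bMv s0 l2); congr (Mv s _).
  by apply/funext => w; rewrite !opprK.
have -> : Mu s (fun w => - L21 (- - w) 1) = - Mu s (fun z => L21 z 1).
  rewrite -(bf_opp bMu s0 l1); congr (Mu s _).
  by apply/funext => w; rewrite !opprK.
have -> : Mv s (fun w => - mu' (- - w) * f1 (- w) + mu (- - w) * f1' (- w)
      + b (- - w) * f2 (- w)) =
    Mv s (fun w => b w * f2 (- w) - (mu' w * f1 (- w) + mu w * - f1' (- w))).
  by congr (Mv s _); apply/funext => w; rewrite !opprK; ring.
have -> : Mu s (fun w => c (- - w) * f1 (- w)
      - (- lam' (- - w) * f2 (- w) + lam (- - w) * f2' (- w))) =
    Mu s (fun w => lam' w * f2 (- w) + lam w * - f2' (- w) + c w * f1 (- w)).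
  by congr (Mu s _); apply/funext => w; rewrite !opprK; ring.
by ring.
Qed.

Lemma adj_mirror (L : R -> R -> R) g z :
  adj (fun z w => - L (- z) (- w)) g (- z) = adj L (fun w => g (- w)) z.
Proof.
rewrite /adj normrN; congr (oint _ _ _); apply/funext => w.
by rewrite !opprK; ring.
Qed.

End MirrorEvolution.

(** * Finite-time extinction of the closed loop *)

Theorem theorem2 (R : realType) (lam lam' mu mu' b c : R -> R)
    (L11 L12 L21 L22 : R -> R -> R) :
  C1_on_I lam lam' -> C1_on_I mu mu' ->
  (forall w, -1 <= w <= 1 -> 0 < lam w) ->
  (forall w, -1 <= w <= 1 -> 0 < mu w) ->
  (forall w, -1 <= w <= 1 -> lam w = mu (- w)) ->
  {within I11, continuous b} -> {within I11, continuous c} ->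
  kernel_eqs lam lam' mu mu' b c L11 L12 L21 L22 ->
  exists T : R, 0 < T /\
    forall u v : R -> R -> R,
      closed_loop_sol lam lam' mu mu' b c L11 L12 L21 L22 u v ->
      forall t, T <= t -> state_norm2 u v t = 0.
Proof.
move=> C1lam C1mu lam_gt0 mu_gt0 sym cb cc.
move=> [cL11 [cL12 [cL21 [cL22 [eq11 [eq12 [eq22 [eq21 [bc11 [bc12 [bc22 bc21]]]]]]]]]]].
have [k [k' [dk ck' k0 kE]]] := positive_C1_extension C1lam lam_gt0.
have [m [m' [dm cm' m0 mE]]] := positive_C1_extension C1mu mu_gt0.
pose e x := b (clip x); pose f x := c (clip x).
have ce : continuous e by exact: cont_clip.
have cf : continuous f by exact: cont_clip.
have ck := is_derive_continuous dk; have cm := is_derive_continuous dm.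
have eE x : -1 <= x <= 1 -> e x = b x by move=> x1; rewrite /e clip_id.
have fE x : -1 <= x <= 1 -> f x = c x by move=> x1; rewrite /f clip_id.
set M11 := retract L11; set M12 := retract L12.
set M21 := retract L21; set M22 := retract L22.
have cM11 : continuous (fun q : R * R => M11 q.1 q.2) by exact: cont_retract.
have cM12 : continuous (fun q : R * R => M12 q.1 q.2) by exact: cont_retract.
have cM21 : continuous (fun q : R * R => M21 q.1 q.2) by exact: cont_retract.
have cM22 : continuous (fun q : R * R => M22 q.1 q.2) by exact: cont_retract.
have E1 (z w : R) : Eset (z, w) -> -1 <= z <= 1.
  by move=> [/= w1 zw]; rewrite -ler_norml (le_trans zw)// ler_norml.
have N11 (w : R) : -1 <= w <= 1 -> -1 <= - w <= 1 by lra.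
have diag (w : R) : -1 <= w <= 1 -> Eset (w, w) by move=> w1; split.
have adiag (w : R) : -1 <= w <= 1 -> Eset (- w, w) by move=> w1; split; rewrite //= normrN.
have sym' x : -1 <= x <= 1 -> k x = m (- x).
  by move=> x1; have [-> _] := kE x x1; have [-> _] := mE _ (N11 x x1); exact: sym.
have hk1 : half_kernel k k' m m' e f M11 M12.
  split; [exact: dk|exact: ck'|exact: dm|exact: cm'|exact: k0|exact: m0|exact: sym'
    |exact: ce|exact: cf|exact: cM11|exact: cM12|..].
  - apply: weak_transport_eq eq11 => [x x1|z w Ezw].
      by have [-> ->] := kE x x1.
    rewrite /M11 /M12 !retract_id//; split=> //.
    by have [_ ->] := kE z (E1 z w Ezw); rewrite fE// (E1 z w).
  - apply: weak_transport_eq eq12 => [x x1|z w Ezw].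
      by have [-> ->] := kE x x1; have [-> ->] := mE x x1.
    rewrite /M11 /M12 !retract_id//; split=> //.
    by have [_ ->] := mE z (E1 z w Ezw); rewrite eE// (E1 z w).
  - by move=> w w1; rewrite /M11 retract_id ?bc11//; exact: adiag.
  move=> w w1; rewrite /M12 retract_id ?bc12//; try exact: diag.
  by have [-> _] := kE w w1; have [-> _] := mE w w1; rewrite eE.
have hk2 : half_kernel (fun x => m (- x)) (fun x => - m' (- x))
    (fun x => k (- x)) (fun x => - k' (- x)) (fun x => f (- x)) (fun x => e (- x))
    (fun z w => - M22 (- z) (- w)) (fun z w => - M21 (- z) (- w)).
  apply: (half_kernel_mirror dk ck' dm cm' k0 m0 sym' ce cf cM21 cM22).
  - apply: weak_transport_eq eq22 => [x x1|z w Ezw].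
      by have [-> ->] := mE x x1.
    rewrite /M21 /M22 !retract_id//; split=> //.
    by have [_ ->] := mE z (E1 z w Ezw); rewrite eE// (E1 z w).
  - apply: weak_transport_eq eq21 => [x x1|z w Ezw].
      by have [-> ->] := kE x x1; have [-> ->] := mE x x1.
    rewrite /M21 /M22 !retract_id//; split=> //.
    by have [_ ->] := kE z (E1 z w Ezw); rewrite fE// (E1 z w).
  - by move=> w w1; rewrite /M22 retract_id ?bc22//; exact: adiag.
  move=> w w1; rewrite /M21 retract_id ?bc21//; try exact: diag.
  by have [-> _] := kE w w1; have [-> _] := mE w w1; rewrite fE.
pose lm x := m (- x).
have m11 : (-1 : R) < 1 by lra.
have T1 : 0 < travel k 1 by rewrite -(travel0 k); exact: (travel_incr hk1).
have T2 : 0 < travel lm 1 by rewrite -(travel0 lm); exact: (travel_incr hk2).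
(* Each target component is extinct after its own travel time; the sum bounds both and depends on
   [lam] and [mu] only, not on the solution. *)
exists (travel k 1 + travel lm 1); split; first exact: addr_gt0.
move=> u v cl0 t Tt.
have cl : closed_loop_sol k k' m m' e f M11 M12 M21 M22 u v.
  apply: closed_loop_sol_eq cl0 => [x x1|x x1|z w Ezw].
  - by have [-> ->] := kE x x1; have [-> ->] := mE x x1.
  - by rewrite eE ?fE.
  - by rewrite /M11 /M12 /M21 /M22 !retract_id.
have [pu pv] := closed_loop_L1 cl.
have bMu := L1_path_functional pu; have bMv := L1_path_functional pv.
set Mu := (fun t h => _) in bMu; set Mv := (fun t h => _) in bMv.
have ev := closed_loop_evolution cl ck ck' cm cm' ce cf cM11 cM12 cM21 cM22.
have ev1 : half_evolution k k' m m' e f M11 M12 Mu Mv.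
  move=> T h h' f1 f1' f2 f2' T0 th df1 cf1' df2 cf2' f11 f21 f2m.
  rewrite -[RHS](ev T h h' f1 f1' f2 f2' T0 th df1 cf1' df2 cf2' f11 f2m).
  by congr (oint _ _ _); apply/funext => s; rewrite f21 mulr0 mul0r addr0.
have ev2 : half_evolution (fun x => m (- x)) (fun x => - m' (- x))
    (fun x => k (- x)) (fun x => - k' (- x)) (fun x => f (- x)) (fun x => e (- x))
    (fun z w => - M22 (- z) (- w)) (fun z w => - M21 (- z) (- w))
    (fun t h => Mv t (fun w => h (- w))) (fun t h => Mu t (fun w => h (- w))).
  apply: (half_evolution_mirror cM21 cM22 bMu bMv) => T h h' f1 f1' f2 f2' T0 th df1 cf1' df2 cf2' f11 f1m f2m.
  rewrite -[RHS](ev T h h' f1 f1' f2 f2' T0 th df1 cf1' df2 cf2' f11 f2m).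
  by congr (oint _ _ _); apply/funext => s; rewrite f1m mulr0 mul0r subr0.
have t0 : 0 <= t by lra.
have [iu _] := pu; have [iv _] := pv; have {}iu := iu t t0; have {}iv := iv t t0.
pose ut w := u w t; pose vt w := v w t.
have [ia aE] := moment_transform cM11 cM12 iu iv.
have [ib bE] := moment_transform cM22 cM21 iv iu.
have cinv (g : R -> R) : continuous g -> (forall x, 0 < g x) ->
    continuous (fun x => (g x)^-1) /\ forall x, (g x)^-1 != 0.
  move=> cg g0; have gn0 x : g x != 0 by rewrite gt_eqF.
  by split=> [|x]; [exact: cont_inv|rewrite invr_neq0].
have [ckV kV0] := cinv k ck k0.
have clm : continuous lm by rewrite /lm; cont.
have [clV lV0] := cinv lm clm (fun x => m0 (- x)).
have nu : null (fun w => ut w - (volt M11 ut w + volt M12 vt w)).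
  apply: (null_increasing ia _ ckV kV0 (travel_incr hk1)).
    exact: is_derive_continuous (has_deriv_travel hk1).
  move=> a a1; have := target_profile_eq0 hk1 bMu bMv ev1 (_ : travel k 1 <= t) a1.
  have cp : continuous (profile k a) by exact: (cont_profile hk1).
  rewrite /target (aE _ cp) => H; apply: H; lra.
(* Back in the original variable, the profiles of the reflected problem are read at [- w], so the
   travel time decreases with [w]. *)
have nv : null (fun w => vt w - (volt M22 vt w + volt M21 ut w)).
  have ctr := is_derive_continuous (has_deriv_travel hk2).
  have ctrN : continuous (fun w => travel lm (- w)) by cont.
  have cN : continuous (fun w : R => - w) by apply: contN; exact: cont_id.
  have clVN : continuous (fun w => (lm (- w))^-1) := cont_comp clV cN.
  apply: (null_decreasing ib ctrN clVN) => [w|x y xy|a].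
  - exact: lV0.
  - by apply: (travel_incr hk2); rewrite ltrN2.
  rewrite opprK => a1.
  have := target_profile_eq0 hk2 (bounded_functional_opp bMv)
    (bounded_functional_opp bMu) ev2 (_ : travel lm 1 <= t) a1.
  have cp : continuous (profile lm a) by exact: (cont_profile hk2).
  have cpN : continuous (fun w => profile lm a (- w)) by cont.
  rewrite /target => H; rewrite -[RHS]H; last by lra.
  rewrite -(bE _ cpN) /Mu /Mv.
  have AE L w : adj (fun z w => - L (- z) (- w)) (profile lm a) (- w) =
      adj L (fun w => profile lm a (- w)) w by exact: adj_mirror.
  have EM (p g1 g2 : R -> R) : g1 =1 g2 -> moment p g1 = moment p g2.
    by move=> /funext ->.
  by apply: f_equal2; apply: EM => w; rewrite -?/lm AE.
have [B11 B110 B11P] := bounded_on_square cM11.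
have [B12 B120 B12P] := bounded_on_square cM12.
have [B21 B210 B21P] := bounded_on_square cM21.
have [B22 B220 B22P] := bounded_on_square cM22.
(* A common bound of the four kernels, so that both rows of the Volterra system satisfy one
   estimate. *)
pose N := B11 + B12 + B21 + B22.
have N0 : 0 < N by rewrite /N !addr_gt0.
have UV (L L' : R -> R -> R) (g g' : R -> R) (C C' : R) :
    continuous (fun q : R * R => L q.1 q.2) ->
    continuous (fun q : R * R => L' q.1 q.2) -> L1_I g -> L1_I g' ->
    C <= N -> C' <= N ->
    (forall z w, -1 <= z <= 1 -> -1 <= w <= 1 -> `|L z w| <= C) ->
    (forall z w, -1 <= z <= 1 -> -1 <= w <= 1 -> `|L' z w| <= C') ->
    forall w, -1 <= w <= 1 ->
    `|volt L g w + volt L' g' w| <= N * (mass g `|w| + mass g' `|w|).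
  move=> cL cL' ig ig' CN CN' LC LC' w w1; apply: le_trans (ler_normD _ _) _.
  rewrite mulrDr; apply: lerD.
    apply: le_trans (volt_bound cL ig LC w1) _.
    by rewrite ler_wpM2r ?mass_ge0.
  apply: le_trans (volt_bound cL' ig' LC' w1) _.
  by rewrite ler_wpM2r ?mass_ge0.
have [nu0 nv0] : null ut /\ null vt.
  apply: (volterra_null N0 iu iv _ _ nu nv).
  - by apply: L1D; [exact: (moment_adj cM11 iu).1|exact: (moment_adj cM12 iv).1].
  - by apply: L1D; [exact: (moment_adj cM22 iv).1|exact: (moment_adj cM21 iu).1].
  - move=> w w1; apply: (UV _ _ _ _ _ _ cM11 cM12 iu iv _ _ B11P B12P w w1);
    by rewrite /N; lra.
  - move=> w w1; rewrite [mass ut _ + _]addrC.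
    apply: (UV _ _ _ _ _ _ cM22 cM21 iv iu _ _ B22P B21P w w1);
    by rewrite /N; lra.
have [L2uv _] := cl0; have [L2u L2v] := L2uv t t0.
exact: null_state L2u L2v nu0 nv0.
Qed.
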